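(* Let $Q(\lambda)=\lambda^2M+\lambda C+K$ with $M,C,K\in\mathbb{C}^{n\times n}$ have normal rank $r<n$ and satisfy $\|M\|_2=\|K\|_2=1$ (spectral norm), and let $\lambda_0\in\mathbb{C}$ be a simple (finite) eigenvalue of $Q$. Let $$C_1(\lambda)=\lambda\begin{bmatrix}M&0\\0&I_n\end{bmatrix}+\begin{bmatrix}C&K\\-I_n&0\end{bmatrix}$$ be the first companion form linearization of $Q$. Then, for $0<\delta\le\frac{n-r}{8n^2}$, there exist constants $c_1\approx1.46$, $c_2\approx1.08$ such that the $\delta$-weak condition numbers $\kappa_w^{(C_1)}(\delta)$ and $\kappa_w^{(Q)}(\delta)$ of $\lambda_0$, as an eigenvalue of $C_1$ and of $Q$ respectively, satisfy $$\frac{\kappa_w^{(C_1)}(\delta)}{\kappa_w^{(Q)}(\delta)}\le\begin{cases}c_1&\text{if }|\lambda_0|<1\text{ and }\|C\|_2\le1,\\ c_2&\text{if }|\lambda_0|\ge1.\end{cases}$$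
   Context: The following definitions are applied to $P=Q$ (size $p=n$, degree $m=2$) and to $P=C_1$ (size $p=2n$, degree $m=1$). $C_1$ is a strong linearization of $Q$; $\lambda_0$ is also a simple eigenvalue of $C_1$. Let $P(\lambda)=\sum_{i=0}^m\lambda^iA_i$ be a matrix polynomial with $A_i\in\mathbb{C}^{p\times p}$. Its normal rank is $\rho=\max_{\lambda\in\mathbb{C}}\operatorname{rank}P(\lambda)$. A number $\lambda_0\in\mathbb{C}$ is a (finite) eigenvalue if $\operatorname{rank}P(\lambda_0)<\rho$; it is simple if, in the Smith canonical form of $P$, exactly one of the nonzero invariant polynomials vanishes at $\lambda_0$, and it has a simple zero there. Then $\dim\ker P(\lambda_0)=p-\rho+1$. Singular spaces. Let $\mathcal{N}(P)=\{x(\lambda)\in\mathbb{C}(\lambda)^p: P(\lambda)x(\lambda)\equiv0\}$ and $\mathcal{N}_*(P)=\{y(\lambda)\in\mathbb{C}(\overline\lambda)^p: y(\lambda)^*P(\lambda)\equiv0\}$; both have dimension $p-\rho$. A minimal basis is a polynomial basis whose sum of column degrees is minimal among all polynomial bases. If $[x_1(\lambda),\dots,x_{p-\rho}(\lambda)]$ and $[y_1(\lambda),\dots,y_{p-\rho}(\lambda)]$ are minimal bases of $\mathcal{N}(P)$ and $\mathcal{N}_*(P)$, set $\ker_{\lambda_0}(P)=\operatorname{range}[x_1(\lambda_0),\dots,x_{p-\rho}(\lambda_0)]$ and $\ker_{\lambda_0}(P^* )=\operatorname{range}[y_1(\lambda_0),\dots,y_{p-\rho}(\lambda_0)]$. Bases.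 Choose $[X\ x]$ and $[Y\ y]$ in $\mathbb{C}^{p\times(p-\rho+1)}$ with orthonormal columns, being bases of $\ker P(\lambda_0)$ and $\ker(P(\lambda_0)^* )$ respectively, such that the columns of $X$ (the first $p-\rho$ columns) form a basis of $\ker_{\lambda_0}(P)$ and those of $Y$ a basis of $\ker_{\lambda_0}(P^* )$. Weak condition number. For a perturbation $E(\lambda)=\sum_{i=0}^m\lambda^iE_i$, $E_i\in\mathbb{C}^{p\times p}$, let $\|E\|=(\sum_{i=0}^m\|E_i\|_F^2)^{1/2}$ and define the directional sensitivity (whenever $Y^*E(\lambda_0)X$ is nonsingular, which holds almost surely below) $$\sigma_E=\frac{1}{\|E\|}\left|\frac{\det\big([Y\ y]^*E(\lambda_0)[X\ x]\big)}{y^*P'(\lambda_0)x\cdot\det\big(Y^*E(\lambda_0)X\big)}\right|.$$ Let $N=p^2(m+1)$, and write $E\sim\mathcal{U}(2N)$ if the vectorization of $[E_0\ E_1\ \cdots\ E_m]$ is uniformly distributed on the unit sphere of $\mathbb{C}^{N}$. The $\delta$-weak condition number of $\lambda_0$ as an eigenvalue of $P$ is $$\kappa_w^{(P)}(\delta)=\inf\{t\in\mathbb{R}:\ \mathbb{P}(\sigma_E<t)\ge1-\delta\},\qquad E\sim\mathcal{U}(2N).$$ *)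

(* Defs.v *)
From HB Require Import structures.
From mathcomp Require Import all_boot all_order all_algebra.
From mathcomp Require Import all_classical all_reals all_analysis.
From mathcomp Require Import complex.

Set Implicit Arguments.
Unset Strict Implicit.
Unset Printing Implicit Defensive.

Import Order.TTheory GRing.Theory Num.Theory.
Import numFieldNormedType.Exports.

Local Open Scope classical_set_scope.
Local Open Scope ring_scope.
Local Open Scope sesquilinear_scope.

Section Norms.
Variable R : realType.
Implicit Types m n : nat.

Definition cabs (z : R[i]) : R := Normc.normc z.

Definition frobenius_norm m n (A : 'M[R[i]]_(m, n)) : R :=
  Num.sqrt (\sum_(i < m) \sum_(j < n) cabs (A i j) ^+ 2).

(* On a column vector the Frobenius norm is the Euclidean norm. *)
Definition spectral_norm m n (A : 'M[R[i]]_(m, n)) : R :=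
  sup [set frobenius_norm (A *m v) | v in [set v : 'cV[R[i]]_n |
                                             frobenius_norm v <= 1]].

End Norms.

Section ColumnSpaces.
Variables (F : fieldType) (p k : nat).

Definition col_range (A : 'M[F]_(p, k)) : set 'cV[F]_p :=
  [set A *m c | c in [set: 'cV[F]_k]].

Definition col_basis (A : 'M[F]_(p, k)) (S : set 'cV[F]_p) : Prop :=
  \rank A = k /\ col_range A = S.

End ColumnSpaces.

Section MatrixPolynomials.
Variable R : realType.
Local Notation C := R[i].
Implicit Types p k : nat.

Definition mxeval p k (P : 'M[{poly C}]_(p, k)) (z : C) : 'M[C]_(p, k) :=
  map_mx (horner_eval z) P.

Definition mxderiv p k (P : 'M[{poly C}]_(p, k)) : 'M[{poly C}]_(p, k) :=
  map_mx (@deriv C) P.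

Definition normal_rank p (P : 'M[{poly C}]_p) : nat :=
  \max_(k < p.+1 | `[< exists z : C, \rank (mxeval P z) = k >]) k.

Definition finite_eigenvalue p (P : 'M[{poly C}]_p) (l0 : C) : Prop :=
  (\rank (mxeval P l0) < normal_rank P)%N.

(* [d] is the list of the nonzero invariant polynomials of [P]; the remaining
   diagonal entries of the Smith form are the default value 0 of [d`_i]. *)
Definition smith_form p (P : 'M[{poly C}]_p) (d : seq {poly C}) : Prop :=
  [/\ (size d <= p)%N,
      {in d, forall q, q \is monic},
      sorted (fun q1 q2 : {poly C} => (q1 %| q2)%R) d &
      exists U V : 'M[{poly C}]_p,
        [/\ U \in unitmx, V \in unitmx &
            U *m P *m V = diag_mx (\row_(i < p) d`_i)]].

Definition simple_eigenvalue p (P : 'M[{poly C}]_p) (l0 : C) : Prop :=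
  finite_eigenvalue P l0 /\
  exists d : seq {poly C},
    [/\ smith_form P d,
        count (fun q => root q l0) d = 1%N &
        {in d, forall q, root q l0 -> mup l0 q = 1%N}].

Definition mxfrac p k (P : 'M[{poly C}]_(p, k)) :
    'M[{fraction {poly C}}]_(p, k) :=
  map_mx (@tofrac {poly C}) P.

Definition singular_space p (P : 'M[{poly C}]_p) :
    set 'cV[{fraction {poly C}}]_p :=
  [set x | mxfrac P *m x = 0].

Definition col_degree p k (B : 'M[{poly C}]_(p, k)) (j : 'I_k) : nat :=
  \max_(i < p) (size (B i j)).-1.

Definition minimal_basis p k (P : 'M[{poly C}]_p) (B : 'M[{poly C}]_(p, k)) :
    Prop :=
  col_basis (mxfrac B) (singular_space P) /\
  forall B' : 'M[{poly C}]_(p, k),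
    col_basis (mxfrac B') (singular_space P) ->
    (\sum_(j < k) col_degree B j <= \sum_(j < k) col_degree B' j)%N.

(* The range of [B(l0)] does not depend on the minimal basis [B]. *)
Definition ker_at p (P : 'M[{poly C}]_p) (l0 : C) : set 'cV[C]_p :=
  [set v | exists B : 'M[{poly C}]_(p, p - normal_rank P),
             minimal_basis P B /\ col_range (mxeval B l0) v].

(* With [mu] the conjugate of [lambda], the vectors [y(lambda)], rational in
   [mu], such that [y(lambda)^* P(lambda) = 0] are those of the kernel of
   [P(lambda)^* = \sum_i mu^i A_i^*].  So the left singular space of [P] is the
   singular space of the following matrix polynomial in the indeterminate
   [mu], and evaluation at [lambda = l0] is evaluation at [mu = l0^*]. *)
Definition mxpoly_adj p (P : 'M[{poly C}]_p) : 'M[{poly C}]_p :=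
  map_mx (map_poly (fun z : C => z^*)) P^T.

Definition left_ker_at p (P : 'M[{poly C}]_p) (l0 : C) : set 'cV[C]_p :=
  ker_at (mxpoly_adj P) (l0^*).

Definition adapted_bases p k (P : 'M[{poly C}]_p) (l0 : C)
    (X : 'M[C]_(p, k)) (x : 'cV[C]_p) (Y : 'M[C]_(p, k)) (y : 'cV[C]_p) :
    Prop :=
  [/\ (row_mx X x)^t* *m row_mx X x = 1%:M,
      col_basis (row_mx X x) [set v | mxeval P l0 *m v = 0] &
      col_basis X (ker_at P l0)] /\
  [/\ (row_mx Y y)^t* *m row_mx Y y = 1%:M,
      col_basis (row_mx Y y) [set v | (mxeval P l0)^t* *m v = 0] &
      col_basis Y (left_ker_at P l0)].

End MatrixPolynomials.

Section UniformSphere.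
Variable R : realType.
Implicit Types d : nat.

(* Lebesgue measure on [R^d], as the iterated product of the Lebesgue measure
   of the line (cf. [product_measure1]). *)
Fixpoint lebesgue_vol d : set (d.-tuple R) -> \bar R :=
  if d is d'.+1 then
    fun A => (\int[@lebesgue_measure R]_x
                lebesgue_vol [set u : d'.-tuple R | A (cons_tuple x u)])%E
  else fun A => \d_[tuple] A.

Definition tuple_norm d (u : d.-tuple R) : R :=
  Num.sqrt (\sum_(i < d) tnth u i ^+ 2).

(* Normalized surface measure of the unit sphere of [R^d], in polar
   coordinates: the proportion of the unit ball that is filled by the cone
   with vertex 0 over (the trace on the sphere of) [A]. *)
Definition sphere_uniform d (A : set (d.-tuple R)) : R :=
  fine (lebesgue_vol
    [set u : d.-tuple R | 0 < tuple_norm u <= 1 /\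
       A (map_tuple (fun c : R => c / tuple_norm u) u)])
  / fine (lebesgue_vol [set u : d.-tuple R | tuple_norm u <= 1]).

End UniformSphere.

Section WeakCondition.
Variables (R : realType) (m p : nat).
Local Notation C := R[i].

(* Coefficients [E_0, ..., E_m] of a perturbation of grade [m]. *)
Definition perturbation := 'I_m.+1 -> 'M[C]_p.

Definition pert_eval (E : perturbation) (z : C) : 'M[C]_p :=
  \sum_(i < m.+1) z ^+ i *: E i.

Definition pert_norm (E : perturbation) : R :=
  Num.sqrt (\sum_(i < m.+1) frobenius_norm (E i) ^+ 2).

(* [N = (m + 1) p^2]; [C^N] is identified with [R^(2N)], real parts first. *)
Let N := (m.+1 * (p * p))%N.

Definition pert_of_coords (u : (N + N).-tuple R) : perturbation :=
  fun i => vec_mx (row i (vec_mx (\row_(j < N)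
    (Complex (tnth u (lshift N j)) (tnth u (rshift N j)))))).

(* The probability of the event [A] when [E ~ U(2N)]. *)
Definition pert_uniform (A : set perturbation) : R :=
  sphere_uniform (pert_of_coords @^-1` A).

Definition sensitivity k (P : 'M[{poly C}]_p) (l0 : C)
    (X : 'M[C]_(p, k)) (x : 'cV[C]_p) (Y : 'M[C]_(p, k)) (y : 'cV[C]_p)
    (E : perturbation) : R :=
  (pert_norm E)^-1 *
  cabs (\det ((row_mx Y y)^t* *m pert_eval E l0 *m row_mx X x) /
        ((y^t* *m mxeval (mxderiv P) l0 *m x) 0 0 *
         \det (Y^t* *m pert_eval E l0 *m X))).

(* Independent of the choice of bases satisfying [adapted_bases]. *)
Definition weak_condition k (P : 'M[{poly C}]_p) (l0 : C)
    (X : 'M[C]_(p, k)) (x : 'cV[C]_p) (Y : 'M[C]_(p, k)) (y : 'cV[C]_p)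
    (delta : R) : R :=
  inf [set t : R |
        1 - delta <= pert_uniform [set E | sensitivity P l0 X x Y y E < t]].

End WeakCondition.

Section Quadratic.
Variables (R : realType) (n : nat).
Local Notation C := R[i].

Definition quadratic_poly (M D K : 'M[C]_n) : 'M[{poly C}]_n :=
  'X^2 *: map_mx polyC M + 'X *: map_mx polyC D + map_mx polyC K.

Definition companion1 (M D K : 'M[C]_n) : 'M[{poly C}]_(n + n) :=
  'X *: map_mx polyC (block_mx M 0 0 1%:M) +
  map_mx polyC (block_mx D K (- 1%:M) 0).

End Quadratic.

(* Main.v *)
(* A uniform point of the sphere is the direction of a Gaussian vector.  Put
   [g = sqrt (sum_i |l0|^(2 i)) / |y^* P'(l0) x|] and let [H] be the normalized matrix
   [[Y y]^* E(l0) [X x]], with last column [h]; let [u] be the vector of cofactors along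
   that column and [e] the last basis vector.  Then
   [sigma_E^2 = g^2 |u.h|^2 / (|u.e|^2 |E|^2)].  Unitary invariance allows to rotate [e],
   and to rotate [h] given [u]; hence, for [tau >= 1] and [k = p - rho],
   [P(sigma_E >= g sqrt tau) = E (1 - (1 - Z / tau)^k)], where [Z] is the squared
   modulus of one coordinate of a uniform point, with first two moments [1 / N] and
   [2 / (N (N + 1))].  So this probability is [k / (N tau)] up to a second order term,
   and [k] is the same for [Q] and [C1].

   It remains to compare the two values of [g].  The vectors [x1] and [y1] are
   proportional to [(l0 x, x)] and to the projection of [(y, (l0 M + C)^* y)] orthogonal
   to [Y1].  Since [Y^* Q'(l0) x = 0], the square of the ratio of the [g]'s is at most
   [(1 + a)^2 (1 + b) / (1 + a + a^2)], [a = |l0|^2], [b = |(l0 M + C)^* y|^2], and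
   [b <= min (1 / a) ((1 + |l0|)^2)] by the normalization of the coefficients. *)
Require Import Defs.
From HB Require Import structures.
From mathcomp Require Import all_boot all_order all_algebra.
From mathcomp Require Import all_classical all_reals all_analysis.
From mathcomp Require Import complex.
From mathcomp Require Import measurable_realfun ring lra.

Set Implicit Arguments.
Unset Strict Implicit.
Unset Printing Implicit Defensive.

Import Order.TTheory GRing.Theory Num.Theory.
Import numFieldNormedType.Exports.
Local Open Scope classical_set_scope.
Local Open Scope ring_scope.

(** * Iterated product measures *)

(** The measure on the sphere is given by iterated one-dimensional integrals, where invariance under
    rotations is not visible. It comes from the uniqueness of translation-invariant sigma-finite
    measures: Lebesgue measure transported by a unitary map, a dilation or a regrouping of
    coordinates is again translation invariant, and the remaining constant is read off on a Gaussian
    density, so no Jacobian is computed. Since 1 / 0 = 0 and the infimum of the empty set is 0,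
    events are written in cross-multiplied form and vanishing minors are confined to null sets. The
    dimensions are N = 3 n^2 for Q and N = 2 (2 n)^2 = 8 n^2 for C1. To first order the thresholds
    tau of C1 and Q for the same delta are thus in ratio 3 / 8; this is enlarged to 437 / 1000 to
    absorb the second order term. For a >= 1 and b <= 1 / a the comparison of the g's is worst at a
    = b = 1, where it equals 8 / 3, so c2 exceeds 1 only because of this enlargement. The bound on
    delta says exactly that the threshold of C1 is at least 1, the range in which the formula for
    the tail holds. *)

Section Push.
Local Open Scope ereal_scope.
Context d1 d2 (X : measurableType d1) (Y : measurableType d2) (R : realType).
Variables (f : X -> Y) (mf : measurable_fun [set: X] f).

(* The measurability proof is an argument so that [push] can carry instances. *)
Definition push (m : set X -> \bar R) : set Y -> \bar R :=
  let _ := mf in pushforward m f.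

Variable m : {measure set X -> \bar R}.

Lemma push0 : push m set0 = 0.
Proof. by rewrite /push /pushforward preimage_set0 measure0. Qed.

Lemma push_ge0 A : 0 <= push m A.
Proof. exact: measure_ge0. Qed.

Lemma push_semi_sigma_additive : semi_sigma_additive (push m).
Proof.
move=> F mF tF mUF; rewrite /push /pushforward preimage_bigcup.
apply: measure_semi_sigma_additive.
- by move=> n; rewrite -[X in measurable X]setTI; exact: mf.
- apply/trivIsetP => /= i j _ _ ij; rewrite -preimage_setI.
  by move/trivIsetP : tF => /(_ _ _ _ _ ij) ->//; rewrite preimage_set0.
- by rewrite -preimage_bigcup -[X in measurable X]setTI; exact: mf.
Qed.

HB.instance Definition _ := isMeasure.Build _ _ _ (push m)
  push0 push_ge0 push_semi_sigma_additive.

End Push.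

Section PushSigmaFinite.
Local Open Scope ereal_scope.
Context d1 d2 (X : measurableType d1) (Y : measurableType d2) (R : realType).
Variables (f : X -> Y) (g : Y -> X).
Hypotheses (mf : measurable_fun [set: X] f) (mg : measurable_fun [set: Y] g).
Hypothesis fK : cancel f g.

Lemma push_sigma_finite (m : {sigma_finite_measure set X -> \bar R}) :
  sigma_finite [set: Y] (push mf m).
Proof.
have [F FT Fm] := sigma_finiteT m.
exists (fun n => g @^-1` F n); first by rewrite -preimage_bigcup -FT preimage_setT.
move=> n; have [mFn Fnoo] := Fm n; split.
  by rewrite -[X in measurable X]setTI; apply: mg.
rewrite /push /pushforward -comp_preimage (_ : g \o f = id) //.
by apply/funext => x; apply: fK.
Qed.

Definition push_sfin (m : {sigma_finite_measure set X -> \bar R}) :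
  {sigma_finite_measure set Y -> \bar R} :=
  HB.pack_for {sigma_finite_measure set Y -> \bar R} (push mf m)
    (Measure_isSigmaFinite.Build _ _ _ (push mf m) (push_sigma_finite m)).

End PushSigmaFinite.

Section ProductSigmaFinite.
Local Open Scope ereal_scope.
Context d1 d2 (X : measurableType d1) (Y : measurableType d2) (R : realType).
Variables (m1 : {sigma_finite_measure set X -> \bar R})
  (m2 : {sigma_finite_measure set Y -> \bar R}).

Lemma prod_sigma_finite : sigma_finite [set: X * Y] (m1 \x m2).
Proof.
have /sigma_finiteP[F [TF ndF Foo]] := sigma_finiteT m1.
have /sigma_finiteP[G [TG ndG Goo]] := sigma_finiteT m2.
exists (fun n => F n `*` G n).
  apply/esym; rewrite -subTset => -[x y] _.
  have [n _ Fnx] : (\bigcup_i F i) x by rewrite -TF.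
  have [k _ Gky] : (\bigcup_i G i) y by rewrite -TG.
  exists (maxn n k) => //; split => /=.
    by move: Fnx; apply/subsetPset/ndF/leq_maxl.
  by move: Gky; apply/subsetPset/ndG/leq_maxr.
move=> n; have [mF Fy] := Foo n; have [mG Gy] := Goo n; split.
  exact: measurableX.
by rewrite product_measure1E// lte_mul_pinfty// ge0_fin_numE.
Qed.

Definition prod_sfin : {sigma_finite_measure set (X * Y)%type -> \bar R} :=
  HB.pack_for {sigma_finite_measure set (X * Y)%type -> \bar R} (m1 \x m2)
    (Measure_isSigmaFinite.Build _ _ _ (m1 \x m2) prod_sigma_finite).

End ProductSigmaFinite.

Section TuplePower.
Local Open Scope ereal_scope.
Variable R : realType.
Local Notation mR := (measurableTypeR R).

Definition ocons d (p : mR * d.-tuple mR) : d.+1.-tuple mR :=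
  [tuple of p.1 :: p.2].
Definition osplit d (u : d.+1.-tuple mR) : mR * d.-tuple mR :=
  (thead u, [tuple of behead u]).

Lemma measurable_ocons d : measurable_fun [set: mR * d.-tuple mR] (@ocons d).
Proof. exact: measurable_cons. Qed.

Lemma measurable_osplit d : measurable_fun [set: d.+1.-tuple mR] (@osplit d).
Proof.
apply: measurable_fun_pair => /=; last exact: measurable_behead.
exact: measurable_tnth.
Qed.

Lemma oconsK d : cancel (@ocons d) (@osplit d).
Proof.
move=> [x u]; rewrite /osplit /ocons /= theadE; congr pair.
exact/val_inj.
Qed.

Variable m : {sigma_finite_measure set mR -> \bar R}.

(** The recursion returns a sigma-finite measure, not a bare set function, because Tonelli is
    applied at every later step. *)
Fixpoint mpow d : {sigma_finite_measure set (d.-tuple mR) -> \bar R} :=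
  match d with
  | 0 => [the {sigma_finite_measure set (0.-tuple mR) -> \bar R} of \d_[tuple]]
  | d'.+1 => push_sfin (@measurable_ocons d') (@measurable_osplit d') (@oconsK d')
     (prod_sfin m (mpow d'))
  end.

Lemma integral_mpowS d (f : d.+1.-tuple mR -> \bar R) :
  measurable_fun setT f -> (forall u, 0 <= f u) ->
  \int[mpow d.+1]_u f u = \int[m]_x \int[mpow d]_u f (ocons (x, u)).
Proof.
move=> mf f0; rewrite [LHS](ge0_integral_pushforward (@measurable_ocons d)) //.
rewrite fubini_tonelli1 //.
exact: (measurableT_comp mf (@measurable_ocons d)).
by move=> p; apply: f0.
Qed.

Lemma integral_mpow0 (f : 0.-tuple mR -> \bar R) :
  \int[mpow 0]_u f u = f [tuple].
Proof.
rewrite integral_dirac ?diracT ?mul1e //.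
move=> _ Y mY; rewrite setTI.
have [Yf|Yf] := pselect (Y (f [tuple])).
  by rewrite (_ : _ @^-1` _ = setT) //; apply/seteqP; split => // u _;
    rewrite /= tuple0.
rewrite (_ : _ @^-1` _ = set0) //; apply/seteqP; split => // u /=.
by rewrite tuple0.
Qed.

End TuplePower.

(** Both sides unfold to the same iterated integral of sections. This is where the recursive volume
    of the statement becomes a genuine measure. *)
Lemma lebesgue_volE (R : realType) d (A : set (d.-tuple (measurableTypeR R))) :
  @lebesgue_vol R d A = mpow [the {sigma_finite_measure set _ -> \bar R} of @lebesgue_measure R] d A.
Proof.
elim: d A => [//|d IH] A /=.
rewrite /push /pushforward /product_measure1; apply: eq_integral => x _ /=.
rewrite IH; congr (mpow _ _ _); apply/seteqP; split => u /=.
  by rewrite /xsection /= inE.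
by rewrite /xsection /= inE.
Qed.

(** * Uniqueness of translation-invariant measures *)

Section Invariance.
Local Open Scope ereal_scope.
Context d (T : measurableType d) (R : realType).

(** Stated on nonnegative functions rather than on sets, so that it is a change of variables usable
    inside double integrals. *)
Definition invariant_under (m : set T -> \bar R) (phi : T -> T) : Prop :=
  forall f : T -> \bar R, measurable_fun [set: T] f -> (forall x, 0 <= f x) ->
    \int[m]_x f (phi x) = \int[m]_x f x.

Variables (add : T -> T -> T) (opp : T -> T).
Hypothesis madd : measurable_fun [set: T * T] (fun p => add p.1 p.2).
Hypothesis mopp : measurable_fun [set: T] opp.
Hypothesis oppK : involutive opp.
Hypothesis addC : commutative add.
Hypothesis addK : forall x y, add (add x y) (opp y) = x.
Hypothesis subDr : forall x y, add x (opp (add y x)) = opp y.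

Definition translation_invariant (m : set T -> \bar R) : Prop :=
  forall a, invariant_under m (add^~ a).

Let mradd a : measurable_fun [set: T] (add^~ a).
Proof.
apply: (measurableT_comp madd (_ : measurable_fun setT (fun x => (x, a)))).
exact: measurable_fun_pair.
Qed.

Let mladd a : measurable_fun [set: T] (add a).
Proof.
apply: (measurableT_comp madd (_ : measurable_fun setT (fun x => (a, x)))).
exact: measurable_fun_pair.
Qed.

(** The classical argument for uniqueness of Haar measure: write the product as the double integral
    of f(x) w(y + x), translate x by y under [m], exchange the integrals, then translate y by x
    under [n]. *)
Lemma translation_invariant_swap (m n : {sigma_finite_measure set T -> \bar R})
    (f w : T -> \bar R) :
  translation_invariant m -> translation_invariant n ->
  measurable_fun [set: T] f -> (forall x, 0 <= f x) ->
  measurable_fun [set: T] w -> (forall x, 0 <= w x) ->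
  (\int[m]_x f x) * (\int[n]_x w x) = (\int[m]_x w x) * (\int[n]_x f (opp x)).
Proof.
move=> mI nI mf f0 mw w0.
have mw' a : measurable_fun [set: T] (fun y => w (add y a)) by exact: measurableT_comp.
have mf' : measurable_fun [set: T] (fun y => f (opp y)) by exact: measurableT_comp.
have mfr a : measurable_fun [set: T] (fun y => f (add a (opp y))).
  exact: (measurableT_comp mf (measurableT_comp (mladd a) mopp)).
have mfl a : measurable_fun [set: T] (fun y => f (add y (opp a))).
  exact: (measurableT_comp mf (mradd _)).
rewrite -ge0_integralZr//; last exact: integral_ge0.
under eq_integral => x _.
  rewrite -(nI x w mw w0) -ge0_integralZl//.
  over.
rewrite (@fubini_tonelli _ _ _ _ _ m n (fun p => f p.1 * w (add p.2 p.1)))/=; first last.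
- by move=> p; apply: mule_ge0.
- apply: emeasurable_funM; first exact: measurableT_comp.
  apply: (measurableT_comp mw) => /=.
  apply: (measurableT_comp madd (_ : measurable_fun setT (fun p => (p.2, p.1)))).
  exact: measurable_fun_pair.
under eq_integral => y _.
  rewrite (_ : (fun x => f x * w (add y x)) =
     (fun x => (fun z => f (add z (opp y)) * w z) (add x y))); last first.
    by apply/funext => x; rewrite addK addC.
  rewrite (mI y (fun z => f (add z (opp y)) * w z)); first last.
  - by move=> x; apply: mule_ge0.
  - exact: emeasurable_funM.
  over.
rewrite -(@fubini_tonelli _ _ _ _ _ m n (fun p => f (add p.1 (opp p.2)) * w p.1))/=; first last.
- by move=> p; apply: mule_ge0.
- apply: emeasurable_funM; last exact: measurableT_comp.
  apply: (measurableT_comp mf).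
  apply: (measurableT_comp madd (_ : measurable_fun setT (fun p => (p.1, opp p.2)))).
  by apply: measurable_fun_pair => //; exact: measurableT_comp.
under eq_integral => x _.
  rewrite ge0_integralZr//.
  rewrite -(nI x (fun y => f (add x (opp y))))//.
  rewrite (_ : (fun y => f (add x (opp (add y x)))) = (fun y => f (opp y))); last first.
    by apply/funext => y; rewrite subDr.
  over.
rewrite /= ge0_integralZl//; last exact: integral_ge0.
by rewrite muleC.
Qed.

(** The swap identity with both measures equal to [m], divided by the finite positive integral of
    [w], shows that [m] is invariant under [opp]. A second use, applied to f(-x), then removes the
    reflection. *)
Theorem translation_invariant_unique (m n : {sigma_finite_measure set T -> \bar R})
    (f w : T -> \bar R) :
  translation_invariant m -> translation_invariant n ->
  measurable_fun [set: T] w -> (forall x, 0 <= w x) ->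
  0 < \int[m]_x w x < +oo ->
  measurable_fun [set: T] f -> (forall x, 0 <= f x) ->
  (\int[m]_x f x) * (\int[n]_x w x) = (\int[m]_x w x) * (\int[n]_x f x).
Proof.
move=> mI nI mw w0 /andP[W0 Woo] mf f0.
have mfo : measurable_fun [set: T] (fun x => f (opp x)) by exact: measurableT_comp.
have [r r0 Wr] : exists2 r : R, (0 < r)%R & \int[m]_x w x = r%:E.
  exists (fine (\int[m]_x w x)); first by rewrite fine_gt0// W0.
  by rewrite fineK// ge0_fin_numE ?(ltW W0).
have fo : \int[m]_x f (opp x) = \int[m]_x f x.
  have := translation_invariant_swap mI mI mf f0 mw w0.
  rewrite [LHS]muleC Wr => /(congr1 (fun z => (r^-1)%:E * z)).
  by rewrite !muleA -EFinM mulVf ?gt_eqF// !mul1e.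
rewrite -fo (translation_invariant_swap mI nI mfo _ mw w0)//.
by congr (_ * _); apply: eq_integral => x _ /=; rewrite oppK.
Qed.

End Invariance.

Section TupleSpace.
Local Open Scope ereal_scope.
Variable R : realType.
Local Notation mR := (measurableTypeR R).
Local Notation V d := (d.-tuple mR).

Definition tadd d (u v : V d) : V d := [tuple (tnth u i + tnth v i)%R | i < d].
Definition topp d (u : V d) : V d := [tuple (- tnth u i)%R | i < d].
Definition sqnorm d (u : V d) : R := (\sum_(i < d) tnth u i ^+ 2)%R.

Lemma measurable_tadd d : measurable_fun [set: V d * V d] (fun p => tadd p.1 p.2).
Proof.
apply/measurable_fun_tnthP => i.
rewrite (_ : _ \o _ = (fun p => tnth p.1 i + tnth p.2 i)%R); last first.
  by apply/funext => p /=; rewrite tnth_mktuple.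
apply: measurable_funD.
  exact: (measurableT_comp (measurable_tnth i) measurable_fst).
exact: (measurableT_comp (measurable_tnth i) measurable_snd).
Qed.

Lemma measurable_ocons1 d (x : mR) :
  measurable_fun [set: V d] (fun u : V d => ocons (x, u)).
Proof.
have h : measurable_fun [set: V d] (fun u : V d => (x, u) : mR * V d).
  by apply: measurable_fun_pair.
exact: (measurableT_comp (@measurable_ocons R d) h).
Qed.

Lemma measurable_taddr d (a : V d) : measurable_fun [set: V d] (fun u => tadd u a).
Proof.
apply/measurable_fun_tnthP => i.
rewrite (_ : _ \o _ = (fun p => tnth p i + tnth a i)%R); last first.
  by apply/funext => p /=; rewrite tnth_mktuple.
by apply: measurable_funD => //; exact: measurable_tnth.
Qed.

Lemma measurable_topp d : measurable_fun [set: V d] (@topp d).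
Proof.
apply/measurable_fun_tnthP => i.
rewrite (_ : _ \o _ = (fun p => - tnth p i)%R); last first.
  by apply/funext => p /=; rewrite tnth_mktuple.
by apply: measurableT_comp => //; exact: measurable_tnth.
Qed.

Lemma measurable_sqnorm d : measurable_fun [set: V d] (@sqnorm d).
Proof.
apply: measurable_sum => i.
apply: measurable_funX; exact: measurable_tnth.
Qed.

Lemma toppK d : involutive (@topp d).
Proof. by move=> u; apply: eq_from_tnth => i; rewrite !tnth_mktuple opprK. Qed.

Lemma taddC d : commutative (@tadd d).
Proof. by move=> u v; apply: eq_from_tnth => i; rewrite !tnth_mktuple addrC. Qed.

Lemma taddK d (u v : V d) : tadd (tadd u v) (topp v) = u.
Proof. by apply: eq_from_tnth => i; rewrite !tnth_mktuple addrK. Qed.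

Lemma tsubDr d (u v : V d) : tadd u (topp (tadd v u)) = topp v.
Proof. by apply: eq_from_tnth => i; rewrite !tnth_mktuple opprD addrCA subrr addr0. Qed.

Lemma tadd_ocons d x (u : V d) a :
  tadd (ocons (x, u)) a = ocons ((x + thead a)%R, tadd u [tuple of behead a]).
Proof.
apply: eq_from_tnth => i; rewrite tnth_mktuple.
case: (unliftP ord0 i) => [j|] ->.
  by rewrite /ocons /= !tnthS tnth_mktuple [in LHS](tuple_eta a) tnthS.
by rewrite !tnth0.
Qed.

Lemma sqnorm_ocons d x (u : V d) : sqnorm (ocons (x, u)) = (x ^+ 2 + sqnorm u)%R.
Proof.
rewrite /sqnorm big_ord_recl tnth0; congr (_ + _)%R.
by apply: eq_bigr => i _; rewrite tnthS.
Qed.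

Lemma sqnorm_ge0 d (u : V d) : (0 <= sqnorm u)%R.
Proof. by apply: sumr_ge0 => i _; rewrite sqr_ge0. Qed.

Local Notation leb1 := [the {sigma_finite_measure set mR -> \bar R} of @lebesgue_measure R].
Definition leb d := mpow leb1 d.

Lemma measurable_addr (a : R) : measurable_fun [set: mR] ((fun x => x + a)%R : mR -> mR).
Proof. exact: measurable_funD. Qed.

Lemma lebesgue_measure_shift (a : R) (A : set mR) : measurable A ->
  @lebesgue_measure R ((fun x => x + a)%R @^-1` A) = @lebesgue_measure R A.
Proof.
move=> mA; apply/esym.
apply: (lebesgue_measure_unique (mu := push (measurable_addr a) leb1)) mA => X [[b c]] _ <-.
rewrite /= /push /pushforward.
rewrite (_ : _ @^-1` _ = `](b - a)%R, (c - a)%R]%classic); last first.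
  by apply/seteqP; split => x /=; rewrite !in_itv /= ltrBlDr lerBrDr.
rewrite !lebesgue_measure_itv /= !lte_fin ltrD2r.
by case: ifP => // _; rewrite -!EFinD; congr EFin; ring.
Qed.

Lemma leb1_shift (a : R) : invariant_under leb1 (fun x => x + a)%R.
Proof.
move=> f mf f0.
transitivity (\int[push (measurable_addr a) leb1]_x f x).
  by rewrite (ge0_integral_pushforward (measurable_addr a)).
apply: eq_measure_integral => A mA _; exact: lebesgue_measure_shift.
Qed.

Lemma integral_lebS d (f : V d.+1 -> \bar R) :
  measurable_fun [set: V d.+1] f -> (forall u, 0 <= f u) ->
  \int[leb d.+1]_u f u = \int[leb1]_x \int[leb d]_u f (ocons (x, u)).
Proof. exact: integral_mpowS. Qed.

Lemma leb_translation d : translation_invariant (@tadd d) (leb d).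
Proof.
elim: d => [|d IH] a f mf f0; first by rewrite !integral_mpow0 !tuple0.
have mfa : measurable_fun [set: V d.+1] (fun u => f (tadd u a)).
  exact: (measurableT_comp mf (measurable_taddr a)).
have mo x : measurable_fun [set: V d] (fun u => f (ocons (x, u))).
  exact: (measurableT_comp mf (measurable_ocons1 x)).
rewrite !integral_lebS//.
under eq_integral => x _.
  under eq_integral do rewrite tadd_ocons.
  rewrite (IH _ (fun u => f (ocons ((x + thead a)%R, u))))//.
  over.
rewrite (leb1_shift (thead a) (f := fun x => \int[leb d]_u f (ocons (x, u))))//.
  apply: (measurable_fun_fubini_tonelli_F (m2 := leb d) (f \o @ocons R d)) => //.
  exact: (measurableT_comp mf (measurable_ocons (d := d))).
  by move=> p; apply: f0.
by move=> x; apply: integral_ge0 => u _; apply: f0.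
Qed.

End TupleSpace.

(** * Gaussian measure *)

Section GaussianTuple.
Local Open Scope ereal_scope.
Variable R : realType.
Local Notation mR := (measurableTypeR R).
Local Notation V d := (d.-tuple mR).
Local Notation leb1 := [the {sigma_finite_measure set mR -> \bar R} of @lebesgue_measure R].

(** With variance 1/2 the density is exp(-x^2) / sqrt pi, so the product density depends on [sqnorm]
    without a factor 2. *)
Let s2 : R := Num.sqrt (2^-1).
Let s2N0 : s2 != 0%R. Proof. by rewrite gt_eqF// sqrtr_gt0 invr_gt0. Qed.
Let s2E : (s2 ^+ 2 *+ 2)%R = 1%R.
Proof. by rewrite sqr_sqrtr ?invr_ge0// -mulr_natr mulVf. Qed.

Definition gauss1 := [the {sigma_finite_measure set mR -> \bar R} of normal_prob 0 s2].
Definition gauss d := mpow gauss1 d.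
Definition gpeak : R := (Num.sqrt pi)^-1.

Lemma gpeak_gt0 : (0 < gpeak)%R.
Proof. by rewrite invr_gt0 sqrtr_gt0 pi_gt0. Qed.

Let pdfE x : normal_pdf 0 s2 x = (gpeak * expR (- x ^+ 2))%R.
Proof.
rewrite normal_pdfE// /normal_peak /normal_fun s2E subr0 divr1; congr (_ * _)%R.
by rewrite /gpeak -[in RHS](mul1r pi) -s2E mulrnAl.
Qed.

(** The Radon-Nikodym derivative of the normal law and its explicit density have the same integral
    over every measurable set, hence agree almost everywhere. *)
Lemma integral_gauss1 (f : mR -> \bar R) : measurable_fun [set: mR] f ->
  (forall x, 0 <= f x) ->
  \int[gauss1]_x f x = \int[leb1]_x (f x * (gpeak * expR (- x ^+ 2))%:E).
Proof.
move=> mf f0; have dom : normal_prob 0 s2 `<< leb1 by exact: normal_prob_dominates.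
rewrite -(Radon_Nikodym_SigmaFinite.change_of_variables dom)//.
under [RHS]eq_integral do rewrite -pdfE.
have mpdf : measurable_fun [set: mR] (fun x => (normal_pdf 0 s2 x)%:E).
  by apply/measurable_EFinP; exact: measurable_normal_pdf.
have mRN := measurable_int _ (Radon_Nikodym_SigmaFinite.f_integrable dom).
apply: ge0_ae_eq_integral => //.
- exact: emeasurable_funM.
- exact: emeasurable_funM.
- by move=> x _; apply: mule_ge0 => //; exact: Radon_Nikodym_SigmaFinite.f_ge0.
- by move=> x _; apply: mule_ge0 => //; rewrite lee_fin normal_pdf_ge0.
apply: ae_eqe_mul2l; apply: integral_ae_eq => //.
  exact: Radon_Nikodym_SigmaFinite.f_integrable.
by move=> E _ mE; rewrite -Radon_Nikodym_SigmaFinite.f_integral.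
Qed.

Definition gdens d (u : V d) : R := (gpeak ^+ d * expR (- sqnorm u))%R.

Lemma gdens_ge0 d (u : V d) : (0 <= gdens u)%R.
Proof. by rewrite mulr_ge0 ?expR_ge0// exprn_ge0// ltW// gpeak_gt0. Qed.

Lemma measurable_gdens d : measurable_fun [set: V d] (fun u : V d => (gdens u)%:E).
Proof.
apply/measurable_EFinP; apply: measurable_funM => //.
by do 2!apply: measurableT_comp => //; exact: measurable_sqnorm.
Qed.

Lemma integral_gaussS d (f : V d.+1 -> \bar R) :
  measurable_fun [set: V d.+1] f -> (forall u, 0 <= f u) ->
  \int[gauss d.+1]_u f u = \int[gauss1]_x \int[gauss d]_u f (ocons (x, u)).
Proof. exact: integral_mpowS. Qed.

Lemma measurable_section d (f : V d.+1 -> \bar R) (x : mR) :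
  measurable_fun [set: V d.+1] f -> measurable_fun [set: V d] (fun u => f (ocons (x, u))).
Proof. by move=> mf; exact: (measurableT_comp mf (measurable_ocons1 x)). Qed.

Lemma measurable_integral_section d (n : {sigma_finite_measure set (V d) -> \bar R})
    (f : V d.+1 -> \bar R) : measurable_fun [set: V d.+1] f -> (forall u, 0 <= f u) ->
  measurable_fun [set: mR] (fun x => \int[n]_u f (ocons (x, u))).
Proof.
move=> mf f0.
apply: (measurable_fun_fubini_tonelli_F (m2 := n) (f \o @ocons R d)) => //.
  exact: (measurableT_comp mf (measurable_ocons (d := d))).
by move=> p; apply: f0.
Qed.

Lemma integral_gauss d (f : V d -> \bar R) :
  measurable_fun [set: V d] f -> (forall u, 0 <= f u) ->
  \int[gauss d]_u f u = \int[leb R d]_u (f u * (gdens u)%:E).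
Proof.
elim: d f => [|d IH] f mf f0.
  rewrite /gauss /leb !integral_mpow0.
  by rewrite /gdens expr0 mul1r /sqnorm big_ord0 oppr0 expR0 mule1.
have mfg : measurable_fun [set: V d.+1] (fun u => f u * (gdens u)%:E).
  by apply: emeasurable_funM => //; exact: measurable_gdens.
rewrite integral_gaussS// integral_lebS//; last first.
  by move=> u; rewrite mule_ge0// lee_fin gdens_ge0.
rewrite integral_gauss1; first last.
- by move=> x; apply: integral_ge0.
- exact: measurable_integral_section.
apply: eq_integral => x _; have mfx := measurable_section x mf.
rewrite (IH (fun u => f (ocons (x, u))))//.
rewrite -ge0_integralZr//; first last.
- by rewrite lee_fin mulr_ge0 ?expR_ge0// ltW// gpeak_gt0.
- by move=> u _; rewrite mule_ge0// lee_fin gdens_ge0.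
- by apply: emeasurable_funM => //; exact: measurable_gdens.
apply: eq_integral => u _; rewrite -muleA -EFinM; congr (_ * _%:E).
rewrite /gdens sqnorm_ocons opprD expRD (exprS gpeak) mulrACA.
by rewrite [(_ ^+ d * _)%R]mulrC [(expR (- sqnorm u) * _)%R]mulrC.
Qed.

Lemma gaussT d : gauss d [set: V d] = 1.
Proof.
rewrite -[LHS]mul1e -integral_cst//.
elim: d => [|d IH]; first by rewrite /gauss integral_mpow0.
rewrite integral_gaussS//.
under eq_integral => x _ do rewrite IH.
by rewrite integral_cst// mul1e; exact: (@probability_setT _ _ _ (normal_prob 0 s2)).
Qed.

Lemma integral_gdens d : \int[leb R d]_u (gdens u)%:E = 1.
Proof.
rewrite -(gaussT d) -[RHS]mul1e -integral_cst// integral_gauss//.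
by apply: eq_integral => u _; rewrite mul1e.
Qed.

End GaussianTuple.

(** * Change of variables from translation invariance *)

Section Transport.
Local Open Scope ereal_scope.
Variable R : realType.
Local Notation mR := (measurableTypeR R).
Local Notation V d := (d.-tuple mR).

Lemma integral_push d1 d2 (X : measurableType d1) (Y : measurableType d2)
    (phi : X -> Y) (mphi : measurable_fun [set: X] phi)
    (m : {measure set X -> \bar R}) (f : Y -> \bar R) :
  measurable_fun [set: Y] f -> (forall y, 0 <= f y) ->
  \int[push mphi m]_y f y = \int[m]_x f (phi x).
Proof. by move=> mf f0; rewrite (ge0_integral_pushforward mphi). Qed.

(** The image of [m] under [phi] is translation invariant, hence a multiple of Lebesgue measure;
    testing against [gdens], whose Lebesgue integral is 1, gives the factor. The left inverse [psi]
    makes the image sigma-finite. *)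
Lemma leb_transport d0 (T : measurableType d0) d (phi : T -> V d) (psi : V d -> T)
    (m : {sigma_finite_measure set T -> \bar R}) (f : V d -> \bar R) :
  measurable_fun [set: T] phi -> measurable_fun [set: V d] psi -> cancel phi psi ->
  (forall a (h : V d -> \bar R), measurable_fun [set: V d] h -> (forall u, 0 <= h u) ->
    \int[m]_x h (tadd (phi x) a) = \int[m]_x h (phi x)) ->
  measurable_fun [set: V d] f -> (forall u, 0 <= f u) ->
  \int[m]_x f (phi x) = (\int[m]_x (gdens (phi x))%:E) * \int[leb R d]_u f u.
Proof.
move=> mphi mpsi phiK tinv mf f0.
pose n := push_sfin mphi mpsi phiK m.
have mg := measurable_gdens (R := R) (d := d).
have g0 (u : V d) : 0 <= (gdens u)%:E by rewrite lee_fin gdens_ge0.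
have nI : translation_invariant (@tadd R d) n.
  move=> a h mh h0; rewrite !integral_push ?tinv//.
  exact: (measurableT_comp mh (measurable_taddr a)).
have := translation_invariant_unique (measurable_tadd (d := d))
  (measurable_topp (d := d)) (@toppK R d) (@taddC R d) (@taddK R d) (@tsubDr R d)
  (@leb_translation R d) nI mg g0 _ mf f0.
rewrite integral_gdens lte01 ltry => /(_ isT).
by rewrite !integral_push// mul1e muleC => ->.
Qed.

(** General in [T] in order to cover both a unitary map of one space and the gluing of two
    independent blocks, where [T] is a product. *)
Lemma gauss_transport d0 (T : measurableType d0) d (phi : T -> V d) (psi : V d -> T)
    (m : {sigma_finite_measure set T -> \bar R}) (g : T -> \bar R) (f : V d -> \bar R) :
  measurable_fun [set: T] phi -> measurable_fun [set: V d] psi -> cancel phi psi ->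
  (forall a (h : V d -> \bar R), measurable_fun [set: V d] h -> (forall u, 0 <= h u) ->
    \int[m]_x h (tadd (phi x) a) = \int[m]_x h (phi x)) ->
  (forall x, (gdens (phi x))%:E = g x) -> \int[m]_x g x = 1 ->
  measurable_fun [set: V d] f -> (forall u, 0 <= f u) ->
  \int[m]_x (f (phi x) * g x) = \int[gauss R d]_u f u.
Proof.
move=> mphi mpsi phiK tinv gE g1 mf f0.
rewrite integral_gauss//.
have fg0 (u : V d) : 0 <= f u * (gdens u)%:E by rewrite mule_ge0// lee_fin gdens_ge0.
have mfg : measurable_fun [set: V d] (fun u => f u * (gdens u)%:E).
  by apply: emeasurable_funM => //; exact: measurable_gdens.
rewrite -[RHS]mul1e -g1.
under [X in X * _]eq_integral => x _ do rewrite -gE.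
rewrite -(leb_transport mphi mpsi phiK tinv mfg fg0).
by apply: eq_integral => x _; rewrite gE.
Qed.

End Transport.

(** * Complex coordinates and measurability *)

Section ComplexCoordinates.
Variable R : realType.
Local Notation C := R[i].
Local Notation mR := (measurableTypeR R).
Local Notation V N := ((N + N).-tuple mR).
Local Open Scope sesquilinear_scope.

(** The layout, real parts first, is the one of [pert_of_coords]. *)
Definition cvec N (u : V N) : 'cV[C]_N :=
  \col_j (Complex (tnth u (lshift N j)) (tnth u (rshift N j))).

Definition vtup N (z : 'cV[C]_N) : V N :=
  [tuple match fintype.split i with
         | inl j => complex.Re (z j 0) | inr j => complex.Im (z j 0) end | i < N + N].

Lemma vtup_lshift N (z : 'cV[C]_N) j : tnth (vtup z) (lshift N j) = complex.Re (z j 0).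
Proof.
rewrite tnth_mktuple; case: fintype.splitP => i /= ij; last first.
  by move: (ltn_ord j); rewrite ij ltnNge leq_addr.
by congr (complex.Re (z _ 0)); apply/val_inj.
Qed.

Lemma vtup_rshift N (z : 'cV[C]_N) j : tnth (vtup z) (rshift N j) = complex.Im (z j 0).
Proof.
rewrite tnth_mktuple; case: fintype.splitP => i /= ij.
  by move: (ltn_ord i); rewrite -ij ltnNge leq_addr.
by congr (complex.Im (z _ 0)); apply/val_inj => /=; move/addnI: ij.
Qed.

Lemma vtupK N : cancel (@vtup N) (@cvec N).
Proof.
move=> z; apply/colP => j; rewrite mxE vtup_lshift vtup_rshift.
by case: (z j 0).
Qed.

Lemma cvecK N : cancel (@cvec N) (@vtup N).
Proof.
move=> u; apply: eq_from_tnth => i; rewrite -(splitK i).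
case: (fintype.split i) => j /=; first by rewrite vtup_lshift mxE.
by rewrite vtup_rshift mxE.
Qed.

Definition nsq (z : C) : R := complex.Re z ^+ 2 + complex.Im z ^+ 2.
Definition vnsq N (z : 'cV[C]_N) : R := \sum_j nsq (z j 0).

Lemma nsq_ge0 z : 0 <= nsq z.
Proof. by rewrite addr_ge0 ?sqr_ge0. Qed.

Lemma vnsq_ge0 N (z : 'cV[C]_N) : 0 <= vnsq z.
Proof. by apply: sumr_ge0 => j _; apply: nsq_ge0. Qed.

Lemma nsqE (z : C) : (nsq z)%:C%C = z^* * z.
Proof. by rewrite add_Re2_Im2 sqr_normc mulrC. Qed.

Lemma sqnorm_cvec N (u : V N) : sqnorm u = vnsq (cvec u).
Proof.
rewrite /sqnorm big_split_ord /= -big_split /=.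
by apply: eq_bigr => j _; rewrite /nsq mxE.
Qed.

Lemma vnsqE N (z : 'cV[C]_N) : (vnsq z)%:C%C = (z^t* *m z) 0 0.
Proof.
rewrite mxE /vnsq raddf_sum /=; apply: eq_bigr => j _.
by rewrite nsqE !mxE.
Qed.

Lemma cvec_tadd N (u v : V N) : cvec (tadd u v) = cvec u + cvec v.
Proof. by apply/colP => j; rewrite !mxE !tnth_mktuple. Qed.

Lemma vtupD N (z w : 'cV[C]_N) : vtup (z + w) = tadd (vtup z) (vtup w).
Proof. by apply: (can_inj (@cvecK N)); rewrite cvec_tadd !vtupK. Qed.

End ComplexCoordinates.

Section ComplexMeasurable.
Context d (T : measurableType d) (R : realType).
Local Notation C := R[i].
Local Notation mR := (measurableTypeR R).
Implicit Types f g : T -> C.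

Definition cmeas f : Prop :=
  measurable_fun [set: T] (fun x => complex.Re (f x)) /\
  measurable_fun [set: T] (fun x => complex.Im (f x)).

Lemma cmeas_cst (c : C) : cmeas (fun=> c).
Proof. by split; exact: measurable_cst. Qed.

Lemma cmeasD f g : cmeas f -> cmeas g -> cmeas (fun x => f x + g x).
Proof.
move=> [f1 f2] [g1 g2]; split.
  rewrite (_ : (fun x => _) = (fun x => complex.Re (f x) + complex.Re (g x))).
    exact: measurable_funD.
  by apply/funext => x; case: (f x) (g x) => [? ?] [? ?].
rewrite (_ : (fun x => _) = (fun x => complex.Im (f x) + complex.Im (g x))).
  exact: measurable_funD.
by apply/funext => x; case: (f x) (g x) => [? ?] [? ?].
Qed.

Lemma cmeasM f g : cmeas f -> cmeas g -> cmeas (fun x => f x * g x).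
Proof.
move=> [f1 f2] [g1 g2]; split.
  rewrite (_ : (fun x => _) = (fun x => complex.Re (f x) * complex.Re (g x) -
    complex.Im (f x) * complex.Im (g x))).
    by apply: measurable_funB; exact: measurable_funM.
  by apply/funext => x; case: (f x) (g x) => [? ?] [? ?].
rewrite (_ : (fun x => _) = (fun x => complex.Re (f x) * complex.Im (g x) +
    complex.Im (f x) * complex.Re (g x))).
  by apply: measurable_funD; exact: measurable_funM.
by apply/funext => x; case: (f x) (g x) => [? ?] [? ?].
Qed.

Lemma cmeas_sum (I : Type) (s : seq I) (P : pred I) (F : I -> T -> C) :
  (forall i, cmeas (F i)) -> cmeas (fun x => \sum_(i <- s | P i) F i x).
Proof.
move=> mF; elim: s => [|i s IH].
  rewrite (_ : (fun x => _) = (fun=> 0)); first exact: cmeas_cst.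
  by apply/funext => x; rewrite big_nil.
case Pi : (P i).
  rewrite (_ : (fun x => _) = (fun x => F i x + \sum_(j <- s | P j) F j x)).
    exact: cmeasD.
  by apply/funext => x; rewrite big_cons Pi.
rewrite (_ : (fun x => _) = (fun x => \sum_(j <- s | P j) F j x))//.
by apply/funext => x; rewrite big_cons Pi.
Qed.

Lemma cmeas_prod (I : Type) (s : seq I) (P : pred I) (F : I -> T -> C) :
  (forall i, cmeas (F i)) -> cmeas (fun x => \prod_(i <- s | P i) F i x).
Proof.
move=> mF; elim: s => [|i s IH].
  rewrite (_ : (fun x => _) = (fun=> 1)); first exact: cmeas_cst.
  by apply/funext => x; rewrite big_nil.
case Pi : (P i).
  rewrite (_ : (fun x => _) = (fun x => F i x * \prod_(j <- s | P j) F j x)).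
    exact: cmeasM.
  by apply/funext => x; rewrite big_cons Pi.
rewrite (_ : (fun x => _) = (fun x => \prod_(j <- s | P j) F j x))//.
by apply/funext => x; rewrite big_cons Pi.
Qed.

Lemma measurable_nsq f : cmeas f -> measurable_fun [set: T] (fun x => nsq (f x)).
Proof. by move=> [f1 f2]; apply: measurable_funD; exact: measurable_funX. Qed.

Definition mxmeas m n (A : T -> 'M[C]_(m, n)) : Prop :=
  forall i j, cmeas (fun x => A x i j).

Lemma mxmeas_cst m n (A : 'M[C]_(m, n)) : mxmeas (fun=> A).
Proof. by move=> i j; exact: cmeas_cst. Qed.

Lemma mxmeasM m n p (A : T -> 'M[C]_(m, n)) (B : T -> 'M[C]_(n, p)) :
  mxmeas A -> mxmeas B -> mxmeas (fun x => A x *m B x).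
Proof.
move=> mA mB i j.
rewrite (_ : (fun x => _) = (fun x => \sum_k A x i k * B x k j)).
  by apply: cmeas_sum => k; exact: cmeasM.
by apply/funext => x; rewrite mxE.
Qed.

Lemma cmeas_det n (A : T -> 'M[C]_n) : mxmeas A -> cmeas (fun x => \det (A x)).
Proof.
move=> mA; apply: cmeas_sum => s; apply: cmeasM; first exact: cmeas_cst.
by apply: cmeas_prod => i.
Qed.

Lemma measurable_vnsq N (z : T -> 'cV[C]_N) :
  mxmeas z -> measurable_fun [set: T] (fun x => vnsq (z x)).
Proof. by move=> mz; apply: measurable_sum => j; exact: measurable_nsq. Qed.

Lemma measurable_vtup N (z : T -> 'cV[C]_N) :
  mxmeas z -> measurable_fun [set: T] (fun x => vtup (z x) : (N + N).-tuple mR).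
Proof.
move=> mz; apply/measurable_fun_tnthP => i; rewrite -(splitK i).
case: (fintype.split i) => j /=.
  rewrite (_ : _ \o _ = (fun x => complex.Re (z x j 0))); first by have [] := mz j 0.
  by apply/funext => x /=; rewrite vtup_lshift.
rewrite (_ : _ \o _ = (fun x => complex.Im (z x j 0))); first by have [] := mz j 0.
by apply/funext => x /=; rewrite vtup_rshift.
Qed.

Lemma mxmeas_cvec N (u : T -> (N + N).-tuple mR) :
  measurable_fun [set: T] u -> mxmeas (fun x => cvec (u x)).
Proof.
move=> mu j k; split.
  rewrite (_ : (fun x => _) = (fun x => tnth (u x) (lshift N j))).
    exact: (measurableT_comp (measurable_tnth _) mu).
  by apply/funext => x; rewrite mxE.
rewrite (_ : (fun x => _) = (fun x => tnth (u x) (rshift N j))).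
  exact: (measurableT_comp (measurable_tnth _) mu).
by apply/funext => x; rewrite mxE.
Qed.

End ComplexMeasurable.

(** * Unitary invariance and independence of Gaussian blocks *)

Section GaussianInvariance.
Local Open Scope ereal_scope.
Variable R : realType.
Local Notation C := R[i].
Local Notation mR := (measurableTypeR R).
Local Notation V N := ((N + N).-tuple mR).
Local Open Scope sesquilinear_scope.

Definition mxact M N (A : 'M[C]_(M, N)) (u : V N) : V M := vtup (A *m cvec u).

Lemma measurable_mxact M N (A : 'M[C]_(M, N)) : measurable_fun [set: V N] (mxact A).
Proof.
apply: measurable_vtup; apply: mxmeasM; first exact: mxmeas_cst.
by apply: mxmeas_cvec.
Qed.

Lemma mxactD M N (A : 'M[C]_(M, N)) u v : mxact A (tadd u v) = tadd (mxact A u) (mxact A v).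
Proof. by rewrite /mxact cvec_tadd mulmxDr vtupD. Qed.

Lemma mxactM M N P (A : 'M[C]_(M, N)) (B : 'M[C]_(N, P)) u :
  mxact A (mxact B u) = mxact (A *m B) u.
Proof. by rewrite /mxact vtupK mulmxA. Qed.

Lemma mxact1 N (u : V N) : mxact 1%:M u = u.
Proof. by rewrite /mxact mul1mx cvecK. Qed.

Lemma vnsq_unitary N (U : 'M[C]_N) z : U^t* *m U = 1%:M -> vnsq (U *m z) = vnsq z.
Proof.
move=> UU; apply: complexI; rewrite !vnsqE trmx_mul map_mxM.
by rewrite -mulmxA (mulmxA _ U) UU mul1mx.
Qed.

(** A unitary map preserves [sqnorm], hence the Gaussian density, and it turns translations into
    translations. *)
Lemma gauss_unitary N (U : 'M[C]_N) (f : V N -> \bar R) : U^t* *m U = 1%:M ->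
  measurable_fun [set: V N] f -> (forall u, 0 <= f u) ->
  \int[gauss R (N + N)]_u f (mxact U u) = \int[gauss R (N + N)]_u f u.
Proof.
move=> UU mf f0; have UU' := mulmx1C UU.
have mU := measurable_mxact U.
have mfU : measurable_fun [set: V N] (fun u => f (mxact U u)) by exact: (measurableT_comp mf mU).
rewrite integral_gauss//.
apply: (gauss_transport (phi := mxact U) (psi := mxact (U^t*)) (m := leb R (N + N))
  (g := fun u => (gdens u)%:E)) => //.
- exact: measurable_mxact.
- by move=> u; rewrite mxactM UU mxact1.
- move=> a h mh h0.
  have mhU : measurable_fun [set: V N] (fun u => h (mxact U u)) by exact: (measurableT_comp mh mU).
  (* Translating by [a] after [U] is translating by the image of [a] under the adjoint before
     [U]. *)
  rewrite -(@leb_translation R _ (mxact (U^t*) a) _ mhU)//.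
  by apply: eq_integral => u _; rewrite mxactD mxactM UU' mxact1.
- by move=> u; rewrite /gdens !sqnorm_cvec vtupK vnsq_unitary.
- exact: integral_gdens.
Qed.

(** Plain concatenation of tuples would interleave real and imaginary parts wrongly, so the gluing
    is done on complex columns. *)
Definition vcat M N (p : V M * V N) : V (M + N) :=
  vtup (col_mx (cvec p.1) (cvec p.2)).

Definition vuncat M N (w : V (M + N)) : V M * V N :=
  (vtup (usubmx (cvec w)), vtup (dsubmx (cvec w))).

Lemma vcatK M N : cancel (@vcat M N) (@vuncat M N).
Proof. by move=> [u v]; rewrite /vuncat vtupK col_mxKu col_mxKd !cvecK. Qed.

Lemma vuncatK M N : cancel (@vuncat M N) (@vcat M N).
Proof. by move=> w; rewrite /vcat /= !vtupK vsubmxK cvecK. Qed.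

Lemma mxmeas_col_mx d (T : measurableType d) M N P (A : T -> 'M[C]_(M, P)) (B : T -> 'M[C]_(N, P)) :
  mxmeas A -> mxmeas B -> mxmeas (fun x => col_mx (A x) (B x)).
Proof.
move=> mA mB i j; rewrite -(splitK i); case: (fintype.split i) => k /=.
  rewrite (_ : (fun x => _) = (fun x => A x k j)); first exact: mA.
  by apply/funext => x; rewrite col_mxEu.
rewrite (_ : (fun x => _) = (fun x => B x k j)); first exact: mB.
by apply/funext => x; rewrite col_mxEd.
Qed.

Lemma measurable_vcat M N : measurable_fun [set: V M * V N] (@vcat M N).
Proof. by apply: measurable_vtup; apply: mxmeas_col_mx; exact: mxmeas_cvec. Qed.

Lemma measurable_vuncat M N : measurable_fun [set: V (M + N)] (@vuncat M N).
Proof.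
have mc : mxmeas (fun w : V (M + N) => cvec w) by exact: mxmeas_cvec.
apply: measurable_fun_pair; apply: measurable_vtup => i j.
  rewrite (_ : (fun x => _) = (fun x => cvec x (lshift N i) j)); first exact: mc.
  by apply/funext => x; rewrite mxE.
rewrite (_ : (fun x => _) = (fun x => cvec x (rshift M i) j)); first exact: mc.
by apply/funext => x; rewrite mxE.
Qed.

Lemma vnsq_col_mx M N (z : 'cV[C]_M) (w : 'cV[C]_N) :
  vnsq (col_mx z w) = (vnsq z + vnsq w)%R.
Proof.
rewrite /vnsq big_split_ord /=; congr (_ + _)%R; apply: eq_bigr => j _.
  by rewrite col_mxEu.
by rewrite col_mxEd.
Qed.

Lemma gdens_vcat M N (p : V M * V N) : gdens (vcat p) = (gdens p.1 * gdens p.2)%R.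
Proof.
rewrite /gdens !sqnorm_cvec vtupK vnsq_col_mx opprD expRD mulrACA -exprD.
by rewrite addnACA.
Qed.

(** The density is multiplicative over blocks, and a translation of the glued vector is a pair of
    translations. *)
Lemma gauss_vcat M N (f : V (M + N) -> \bar R) :
  measurable_fun [set: V (M + N)] f -> (forall u, 0 <= f u) ->
  \int[gauss R (M + M)]_u \int[gauss R (N + N)]_v f (vcat (u, v)) =
  \int[gauss R ((M + N) + (M + N))]_w f w.
Proof.
move=> mf f0.
have mfc : measurable_fun [set: V M * V N] (fun p => f (vcat p)).
  exact: (measurableT_comp mf (@measurable_vcat M N)).
have g0 n (v : n.-tuple mR) : 0 <= (gdens v)%:E by rewrite lee_fin gdens_ge0.
have mg1 : measurable_fun [set: V M * V N] (fun p => (gdens p.1)%:E).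
  exact: (measurableT_comp (measurable_gdens (d := M + M)) measurable_fst).
have mg2 : measurable_fun [set: V M * V N] (fun p => (gdens p.2)%:E).
  exact: (measurableT_comp (measurable_gdens (d := N + N)) measurable_snd).
pose m := prod_sfin (leb R (M + M)) (leb R (N + N)).
pose g (p : V M * V N) := (gdens p.1)%:E * (gdens p.2)%:E.
have mg : measurable_fun [set: V M * V N] g by exact: emeasurable_funM.
have gp0 p : 0 <= g p by exact: mule_ge0.
rewrite -(gauss_transport (psi := @vuncat M N) (phi := @vcat M N) (m := m) (g := g))//.
- rewrite fubini_tonelli1//=; last 2 first.
  + exact: emeasurable_funM.
  + by move=> p; rewrite mule_ge0.
  rewrite integral_gauss; first last.
  + by move=> u; apply: integral_ge0.
  + exact: (measurable_fun_fubini_tonelli_F (m2 := gauss R (N + N)) (fun p => f (vcat p))).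
  apply: eq_integral => u _; rewrite /fubini_F /=.
  have mfu : measurable_fun [set: V N] (fun v => f (vcat (u, v))).
    exact: (measurableT_comp mfc (pair1_measurable u)).
  rewrite integral_gauss// -ge0_integralZr//; first last.
  + by move=> v _; apply: mule_ge0.
  + by apply: emeasurable_funM => //; exact: measurable_gdens.
  by apply: eq_integral => v _; rewrite /g /= muleAC muleA.
- exact: measurable_vcat.
- exact: measurable_vuncat.
- exact: vcatK.
- move=> c h mh h0; rewrite -(vuncatK c); case: (vuncat c) => a b.
  have mhc : measurable_fun [set: V M * V N] (fun p => h (vcat p)).
    exact: (measurableT_comp mh (@measurable_vcat M N)).
  have vcatD u v : tadd (vcat (u, v)) (vcat (a, b)) = vcat (tadd u a, tadd v b).
    by rewrite /vcat /= -vtupD add_col_mx !cvec_tadd.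
  have mhD : measurable_fun [set: V M * V N] (fun p => h (tadd (vcat p) (vcat (a, b)))).
    exact: (measurableT_comp (measurableT_comp mh (measurable_taddr _)) (@measurable_vcat M N)).
  rewrite !fubini_tonelli1// /fubini_F.
  under eq_integral => u _.
    under eq_integral do rewrite vcatD.
    rewrite (@leb_translation R _ b (fun v => h (vcat (tadd u a, v))))//; last first.
      exact: (measurableT_comp mhc (pair1_measurable (tadd u a))).
    over.
  rewrite (@leb_translation R _ a (fun u => \int[leb R (N + N)]_v h (vcat (u, v))))//.
    exact: (measurable_fun_fubini_tonelli_F (m2 := leb R (N + N)) (fun p => h (vcat p))).
  by move=> u; exact: integral_ge0.
- by move=> p; rewrite gdens_vcat EFinM.
- rewrite fubini_tonelli1// /fubini_F /g /=.
  under eq_integral => u _.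
    rewrite ge0_integralZl//; last exact: measurable_gdens.
    rewrite integral_gdens mule1; over.
  exact: integral_gdens.
Qed.

End GaussianInvariance.

(** * Dilations and decomposition into balls *)

Section Scaling.
Local Open Scope ereal_scope.
Variable R : realType.
Local Notation mR := (measurableTypeR R).
Local Notation V d := (d.-tuple mR).
Local Notation leb1 := [the {sigma_finite_measure set mR -> \bar R} of @lebesgue_measure R].

Definition tscale d (s : R) (u : V d) : V d := [tuple (s * tnth u i)%R | i < d].

Lemma measurable_tscale d s : measurable_fun [set: V d] (@tscale d s).
Proof.
apply/measurable_fun_tnthP => i.
rewrite (_ : _ \o _ = (fun p => s * tnth p i)%R); last first.
  by apply/funext => p /=; rewrite tnth_mktuple.
by apply: measurable_funM => //; exact: measurable_tnth.
Qed.

Lemma tscaleA d s t (u : V d) : tscale s (tscale t u) = tscale (s * t) u.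
Proof. by apply: eq_from_tnth => i; rewrite !tnth_mktuple mulrA. Qed.

Lemma tscale1 d (u : V d) : tscale 1 u = u.
Proof. by apply: eq_from_tnth => i; rewrite !tnth_mktuple mul1r. Qed.

Lemma tscaleD d s (u v : V d) : tscale s (tadd u v) = tadd (tscale s u) (tscale s v).
Proof. by apply: eq_from_tnth => i; rewrite !tnth_mktuple mulrDr. Qed.

Lemma sqnorm_tscale d s (u : V d) : sqnorm (tscale s u) = (s ^+ 2 * sqnorm u)%R.
Proof.
by rewrite /sqnorm mulr_sumr; apply: eq_bigr => i _; rewrite tnth_mktuple exprMn.
Qed.

(** For the standard deviation [t] below, the normal density is [s] times the integrand, and it has
    integral 1. *)
Lemma integral_gauss_scale1 (s : R) : (0 < s)%R ->
  \int[leb1]_x (gpeak R * expR (- (s ^+ 2 * x ^+ 2)))%:E = (s^-1)%:E.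
Proof.
move=> s0; pose t : R := (Num.sqrt (2^-1) / s)%R.
have t0 : t != 0%R.
  by rewrite gt_eqF// divr_gt0// sqrtr_gt0 invr_gt0.
have t2 : (t ^+ 2 *+ 2)%R = (s ^- 2)%R.
  rewrite /t expr_div_n sqr_sqrtr ?invr_ge0// -mulr_natr mulrAC mulVf//.
  by rewrite mul1r.
have := @integral_normal_pdf R 0%R t.
rewrite normal_pdfE//.
have E x : (normal_peak t * normal_fun 0 t x = s * (gpeak R * expR (- (s ^+ 2 * x ^+ 2))))%R.
  rewrite /normal_peak /normal_fun subr0 t2 mulrA; congr (_ * expR _)%R.
    rewrite -mulrnAl t2 sqrtrM ?invr_ge0 ?sqr_ge0// -exprVn sqrtr_sqr.
    by rewrite gtr0_norm ?invr_gt0// invfM invrK.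
  by rewrite invrK mulNr mulrC.
under eq_integral do rewrite E EFinM.
rewrite ge0_integralZl//.
- move=> /(congr1 (fun z => (s^-1)%:E * z)).
  by rewrite muleA -EFinM mulVf ?gt_eqF// mul1e mule1.
- apply/measurable_EFinP; apply: measurable_funM => //; apply: measurableT_comp => //.
  by apply: measurableT_comp => //; apply: measurable_funM => //; exact: measurable_funX.
- by move=> x _; rewrite lee_fin mulr_ge0 ?expR_ge0// ltW// gpeak_gt0.
- by rewrite lee_fin ltW.
Qed.

Lemma integral_gdens_scale d (s : R) : (0 < s)%R ->
  \int[leb R d]_u (gdens (tscale s u))%:E = (s^-1 ^+ d)%:E.
Proof.
move=> s0; elim: d => [|d IH].
  by rewrite /leb integral_mpow0 /gdens expr0 mul1r /sqnorm big_ord0 oppr0 expR0.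
have mg n : measurable_fun [set: V n] (fun u : V n => (gdens (tscale s u))%:E).
  exact: (measurableT_comp (measurable_gdens (d := n)) (measurable_tscale s)).
rewrite integral_lebS//; last by move=> u; rewrite lee_fin gdens_ge0.
have E x (u : V d) : (gdens (tscale s (ocons (x, u))))%:E =
    (gpeak R * expR (- (s ^+ 2 * x ^+ 2)))%:E * (gdens (tscale s u))%:E.
  rewrite -EFinM /gdens !sqnorm_tscale sqnorm_ocons mulrDr opprD expRD exprS.
  by rewrite mulrACA.
under eq_integral => x _.
  under eq_integral do rewrite E.
  rewrite ge0_integralZl//; last 3 first.
  - exact: mg.
  - by move=> u _; rewrite lee_fin gdens_ge0.
  - by rewrite lee_fin mulr_ge0 ?expR_ge0// ltW// gpeak_gt0.
  rewrite IH; over.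
rewrite ge0_integralZr//.
- by rewrite integral_gauss_scale1// -EFinM exprS.
- apply/measurable_EFinP; apply: measurable_funM => //; apply: measurableT_comp => //.
  by apply: measurableT_comp => //; apply: measurable_funM => //; exact: measurable_funX.
- by move=> x _; rewrite lee_fin mulr_ge0 ?expR_ge0// ltW// gpeak_gt0.
- by rewrite lee_fin exprn_ge0// invr_ge0 ltW.
Qed.

Lemma leb_scale d (s : R) (f : V d -> \bar R) : (0 < s)%R ->
  measurable_fun [set: V d] f -> (forall u, 0 <= f u) ->
  \int[leb R d]_u f (tscale s u) = (s^-1 ^+ d)%:E * \int[leb R d]_u f u.
Proof.
move=> s0 mf f0; rewrite -integral_gdens_scale//.
have sV : (s^-1 * s)%R = 1%R by rewrite mulVf ?gt_eqF.
have sV' : (s * s^-1)%R = 1%R by rewrite mulfV ?gt_eqF.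
apply: (leb_transport (phi := @tscale d s) (psi := @tscale d s^-1)) => //.
- exact: measurable_tscale.
- exact: measurable_tscale.
- by move=> u; rewrite tscaleA sV tscale1.
- move=> a h mh h0.
  have mhs : measurable_fun [set: V d] (fun u => h (tscale s u)).
    exact: (measurableT_comp mh (measurable_tscale s)).
  rewrite -(@leb_translation R d (tscale s^-1 a) _ mhs)//.
  by apply: eq_integral => u _; rewrite tscaleD tscaleA sV' tscale1.
Qed.

Lemma integral_exp_tail (q : R) :
  \int[leb1]_t ((if q <= t then expR (- t) else 0)%R)%:E = (expR (- q))%:E.
Proof.
have cexpN : continuous (fun t : R => expR (- t)).
  move=> x; apply: (@continuous_comp _ _ _ (fun t : R^o => - t)%R (@expR R)).
    exact: (@continuousN _ R^o _ id).
  exact: continuous_expR.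
transitivity (\int[leb1]_(t in `[q, +oo[) (expR (- t))%:E).
  rewrite [RHS]integral_mkcond; apply: eq_integral => t _.
  rewrite patchE; case: (leP q t) => qt.
    by rewrite ifT// inE /= in_itv /= qt.
  by rewrite ifF//; apply/negbTE; rewrite notin_setE /= in_itv /= leNgt qt.
rewrite (@ge0_continuous_FTC2y R (fun t => expR (- t))%R (fun t => - expR (- t))%R q 0).
- by rewrite EFinN oppeK add0e.
- by move=> x _; exact: expR_ge0.
- apply: continuous_subspaceT => x.
  exact: cexpN.
- by rewrite -oppr0; apply: cvgN; exact: cvgr_expR.
- by move=> x _; exact: ex_derive.
- apply: cvg_at_right_filter; apply: cvgN.
  exact: cexpN.
- move=> x _; rewrite derive1E.
  have h : is_derive x 1%R (fun t : R => - expR (- t))%R (expR (- x)).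
    by apply: is_derive_eq; rewrite mulrN1 opprK.
  exact: (@derive_val _ _ _ _ _ _ _ h).
Qed.

(** Write exp(-q) as the integral of exp(-t) over t >= q and exchange the integrals. With
    [q := sqnorm] a Gaussian measure becomes a mixture of Lebesgue measures of balls, which links it
    to the solid cones of [sphere_uniform]. *)
Lemma layer_cake d0 (T : measurableType d0) (m : {sigma_finite_measure set T -> \bar R})
    (q : T -> R) (A : set T) : measurable_fun [set: T] q -> measurable A ->
  \int[m]_u ((\1_A u)%:E * (expR (- q u))%:E) =
  \int[leb1]_t ((expR (- t))%:E * m (A `&` [set u | (q u <= t)%R])).
Proof.
move=> mq mA.
have mi : measurable_fun [set: T] (fun u => (\1_A u)%:E : \bar R).
  by apply/measurable_EFinP; exact: measurable_indic.
pose F (p : T * mR) : \bar R := (\1_A p.1)%:E * ((if q p.1 <= p.2 then expR (- p.2) else 0)%R)%:E.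
have F0 p : 0 <= F p.
  by rewrite mule_ge0// lee_fin//; case: ifP => // _; exact: expR_ge0.
have mF : measurable_fun [set: T * mR] F.
  apply: emeasurable_funM.
    exact: (measurableT_comp mi measurable_fst).
  apply/measurable_EFinP; apply: measurable_fun_if => //.
  - by apply: measurable_fun_ler => //; exact: measurableT_comp.
  - apply: measurable_funTS; apply: measurableT_comp => //.
    by apply: measurableT_comp.
transitivity (\int[m]_u \int[leb1]_t F (u, t)).
  apply: eq_integral => u _; rewrite /F /= ge0_integralZl//.
  - by rewrite integral_exp_tail.
  - apply/measurable_EFinP; apply: measurable_fun_if => //.
    + exact: measurable_fun_ler.
    + by apply: measurable_funTS; apply: measurableT_comp => //; exact: measurableT_comp.
  - by move=> t _; rewrite lee_fin; case: ifP => // _; exact: expR_ge0.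
rewrite (fubini_tonelli (m1 := m) (m2 := leb1) F)//; apply: eq_integral => t _.
have mAt : measurable (A `&` [set u | (q u <= t)%R]).
  by apply: measurableI => //; rewrite -[X in measurable X]setTI; exact: measurable_fun_le.
rewrite -[m _]mul1e -(setIT (A `&` _)) -integral_indic// muleA mule1 -ge0_integralZl//.
- apply: eq_integral => u _; rewrite /F /= indicI [RHS]muleC EFinM -muleA.
  congr (_ * _); rewrite indicE.
  by case: ifPn => [qt|qt]; [rewrite mem_set// mul1e|rewrite memNset ?mul0e//; exact/negP].
- by apply/measurable_EFinP; exact: measurable_indic.
Qed.

End Scaling.

(** * Uniform distribution on the sphere *)

Opaque leb gauss.

Section Cones.
Local Open Scope ereal_scope.
Variable R : realType.
Local Notation mR := (measurableTypeR R).
Local Notation V d := (d.-tuple mR).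
Local Notation leb1 := [the {sigma_finite_measure set mR -> \bar R} of @lebesgue_measure R].

Definition sqball d (t : R) : set (V d) := [set u | (sqnorm u <= t)%R].
Arguments sqball d t : clear implicits.

Lemma measurable_sqball d t : measurable (sqball d t).
Proof.
rewrite -[X in measurable X]setTI; apply: measurable_fun_le => //.
exact: measurable_sqnorm.
Qed.

Lemma integral_indicT d0 (T : measurableType d0) (m : {measure set T -> \bar R}) (E : set T) :
  measurable E -> \int[m]_u (\1_E u)%:E = m E.
Proof. by move=> mE; rewrite integral_indic// setIT. Qed.

Lemma measurable_indicE d0 (T : measurableType d0) (E : set T) :
  measurable E -> measurable_fun [set: T] (fun u => (\1_E u)%:E : \bar R).
Proof. by move=> mE; apply/measurable_EFinP; exact: measurable_indic. Qed.

Lemma gauss_layer d (A : set (V d)) : measurable A ->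
  gauss R d A = (gpeak R ^+ d)%:E *
    \int[leb1]_t ((expR (- t))%:E * leb R d (A `&` sqball d t)).
Proof.
move=> mA; rewrite -(layer_cake _ (measurable_sqnorm (d := d)) mA).
have mi : measurable_fun [set: V d] (fun u => (\1_A u)%:E : \bar R).
  by apply/measurable_EFinP; exact: measurable_indic.
rewrite -ge0_integralZl//; last 2 first.
- apply: emeasurable_funM => //; apply/measurable_EFinP.
  by do 2!apply: measurableT_comp => //; exact: measurable_sqnorm.
- by rewrite lee_fin exprn_ge0// ltW// gpeak_gt0.
rewrite -(setIT A) -integral_indic// integral_gauss ?setIT//.
by apply: eq_integral => u _; rewrite muleCA -EFinM.
Qed.

(** Only the section at first coordinate 0 is nonempty, and a point of the line has measure zero. *)
Lemma leb_point d : leb R d.+1 (sqball d.+1 0) = 0.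
Proof.
rewrite -(setIT (sqball _ _)) -integral_indic//; last exact: measurable_sqball.
rewrite integral_lebS//; last first.
  by apply/measurable_EFinP; apply: measurable_indic; exact: measurable_sqball.
rewrite -[RHS](integral_set1 (fun x => \int[leb R d]_u (\1_(sqball d.+1 0) (ocons (x, u)))%:E) 0%R).
rewrite [RHS]integral_mkcond; apply: eq_integral => x _.
rewrite patchE; case: ifPn => // x0.
apply: integral0_eq => u _; rewrite indicE memNset// /sqball /=.
apply/negP; rewrite -ltNge sqnorm_ocons ltr_pwDl ?sqnorm_ge0//.
rewrite exprn_even_gt0//=; apply: contraNneq x0 => ->.
by rewrite inE.
Qed.

Definition cone d (A : set (V d)) : Prop :=
  forall s u, (0 < s)%R -> A (tscale s u) <-> A u.

Lemma leb_cone_sqball d (A : set (V d)) (t : R) : measurable A -> cone A -> (0 < t)%R ->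
  leb R d (A `&` sqball d t) = ((Num.sqrt t) ^+ d)%:E * leb R d (A `&` sqball d 1).
Proof.
move=> mA cA t0; have mB := measurableI _ _ mA (@measurable_sqball d 1).
have st0 : (0 < (Num.sqrt t)^-1)%R by rewrite invr_gt0 sqrtr_gt0.
rewrite -!integral_indicT//; last by apply: measurableI => //; exact: measurable_sqball.
rewrite -[in RHS](invrK (Num.sqrt t)) -leb_scale//; last exact: measurable_indicE.
apply: eq_integral => u _; rewrite !indicE; congr ((_ : bool)%:R%:E).
rewrite /sqball; apply/idP/idP; rewrite !inE /= sqnorm_tscale exprVn sqr_sqrtr ?(ltW t0)//.
  by move=> [Au ut]; split; [exact/cA|rewrite ler_pdivrMl// mulr1].
by move=> [/cA Au]; rewrite ler_pdivrMl// mulr1 => ut; split; first exact: Au.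
Qed.

(** On the unit ball the Gaussian density is at least [gpeak R ^+ d * expR (- 1)], while its total
    mass is 1. *)
Lemma leb_ball_lty d : leb R d (sqball d 1) < +oo.
Proof.
have c0 : (0 < gpeak R ^+ d * expR (- 1))%R by rewrite mulr_gt0 ?expR_gt0// exprn_gt0// gpeak_gt0.
have : (gpeak R ^+ d * expR (- 1))%:E * leb R d (sqball d 1) <= 1.
  rewrite -(integral_gdens R d) -(setIT (sqball d 1)) -integral_indic//; last exact: measurable_sqball.
  have mi : measurable_fun [set: V d] (fun u => (\1_(sqball d 1) u)%:E : \bar R).
    by apply/measurable_EFinP; apply: measurable_indic; exact: measurable_sqball.
  rewrite -ge0_integralZl//; last by rewrite lee_fin ltW.
  apply: ge0_le_integral => //.
  - by move=> u _; rewrite mule_ge0// lee_fin// ltW.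
  - by apply: emeasurable_funM.
  - exact: measurable_gdens.
  - move=> u _; rewrite indicE /sqball; case: (boolP (u \in _)) => [|_]; rewrite /= -EFinM lee_fin.
      rewrite inE /= mulr1 => u1; rewrite ler_wpM2l ?exprn_ge0// ?(ltW (gpeak_gt0 R))//.
      by rewrite ler_expR lerN2.
    by rewrite mulr0 gdens_ge0.
case: (leb R d _) => [r|//|//]; first by rewrite ltry.
by rewrite gt0_muley ?lte_fin.
Qed.

(** In every layer the cone and the whole space scale by the same power of the radius, so the
    proportion filled by [A] is the same in all balls, hence also for the Gaussian. *)
Lemma gauss_cone d (A : set (V d.+1)) : measurable A -> cone A ->
  gauss R d.+1 A * leb R d.+1 (sqball d.+1 1) = leb R d.+1 (A `&` sqball d.+1 1).
Proof.
move=> mA cA.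
have mT (E : set (V d.+1)) : measurable E ->
    measurable_fun [set: mR] (fun t : mR => (expR (- t))%:E * leb R d.+1 (E `&` sqball d.+1 t)).
  move=> mE; apply: emeasurable_funM.
    by apply/measurable_EFinP; apply: measurableT_comp => //; exact: measurableT_comp.
  have mS : measurable [set p : V d.+1 * mR | E p.1 /\ (sqnorm p.1 <= p.2)%R].
    apply: measurableI.
      by rewrite -[X in measurable X]setTI; exact: (measurable_fst).
    rewrite -[X in measurable X]setTI; apply: measurable_fun_le => //.
    exact: (measurableT_comp (measurable_sqnorm (d := d.+1)) measurable_fst).
  have := measurable_fun_ysection (leb R d.+1) mS.
  congr measurable_fun; apply/funext => t /=; congr (leb R d.+1 _).
  by apply/seteqP; split => u; rewrite /ysection /= inE.
have I0 (E : set (V d.+1)) t : 0 <= (expR (- t))%:E * leb R d.+1 (E `&` sqball d.+1 t).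
  by rewrite mule_ge0// lee_fin expR_ge0.
have L t : leb R d.+1 (A `&` sqball d.+1 t) * leb R d.+1 (sqball d.+1 1) =
           leb R d.+1 (sqball d.+1 t) * leb R d.+1 (A `&` sqball d.+1 1).
  have [t0|t0] := ltP 0%R t.
    have := @leb_cone_sqball d.+1 setT t measurableT (fun _ _ _ => iff_refl _) t0.
    by rewrite !setTI leb_cone_sqball// => ->; rewrite muleAC.
  have z (E : set (V d.+1)) : measurable E -> leb R d.+1 (E `&` sqball d.+1 t) = 0.
    move=> mE; apply/eqP; rewrite eq_le measure_ge0 andbT -(leb_point d).
    apply: le_measure; rewrite ?inE; [|exact: measurable_sqball|].
      by apply: measurableI => //; exact: measurable_sqball.
    by move=> u [_]; rewrite /sqball /= => /le_trans; apply.
  have := z setT measurableT; rewrite setTI => ->.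
  by rewrite z// !mul0e.
rewrite gauss_layer// -muleA -ge0_integralZr//; last exact: mT.
transitivity ((gpeak R ^+ d.+1)%:E * \int[leb1]_t ((expR (- t))%:E *
    leb R d.+1 (setT `&` sqball d.+1 t) * leb R d.+1 (A `&` sqball d.+1 1))).
  apply: (congr1 (fun z => (gpeak R ^+ d.+1)%:E * z)); apply: eq_integral => t _.
  by rewrite (setTI (sqball d.+1 t)) -[LHS]muleA L -[RHS]muleA.
rewrite ge0_integralZr//; last exact: mT.
by rewrite muleA -gauss_layer// gaussT mul1e.
Qed.

(** Otherwise all balls would be null by scaling, and the Gaussian measure would vanish. *)
Lemma leb_ball_gt0 d : 0 < leb R d.+1 (sqball d.+1 1).
Proof.
rewrite lt0e measure_ge0 andbT; apply/eqP => z.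
have : gauss R d.+1 setT = 0.
  rewrite gauss_layer// [X in _ * X](_ : _ = 0) ?mule0//.
  apply: integral0_eq => t _.
  have [t0|t0] := ltP 0%R t; first by rewrite leb_cone_sqball// setTI z !mule0.
  rewrite [X in _ * X](_ : _ = 0) ?mule0//.
  apply/eqP; rewrite eq_le measure_ge0 andbT -(leb_point d) setTI.
  apply: le_measure; rewrite ?inE; [exact: measurable_sqball|exact: measurable_sqball|].
  by move=> u; rewrite /sqball /= => /le_trans; apply.
by rewrite gaussT => /eqP; rewrite onee_eq0.
Qed.

Lemma sphere_uniformE d (A : set (V d.+1)) : measurable A -> cone A ->
  @sphere_uniform R d.+1 A = fine (gauss R d.+1 A).
Proof.
move=> mA cA; rewrite /sphere_uniform !lebesgue_volE -/(leb R d.+1).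
have normE (u : V d.+1) : (tuple_norm u <= 1)%R = (sqnorm u <= 1)%R.
  rewrite /tuple_norm -/(sqnorm u) -[X in (_ <= X)%R = _]sqrtr1 ler_sqrt//.
have -> : [set u : d.+1.-tuple R | (tuple_norm u <= 1)%R] = sqball d.+1 1.
  by apply/seteqP; split => u /=; rewrite /sqball /= normE.
set B := sqball d.+1 1.
have -> : leb R d.+1 [set u | (0 < tuple_norm u <= 1)%R /\
    A (map_tuple (fun c : R => (c / tuple_norm u)%R) u)] = leb R d.+1 (A `&` B).
  have -> : [set u | (0 < tuple_norm u <= 1)%R /\
      A (map_tuple (fun c : R => (c / tuple_norm u)%R) u)] = (A `&` B) `\` sqball d.+1 0.
    have aux (u : V d.+1) : (0 < tuple_norm u)%R ->
        A (map_tuple (fun c : R => (c / tuple_norm u)%R) u) <-> A u.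
      move=> u0; rewrite (_ : map_tuple _ _ = tscale (tuple_norm u)^-1 u).
        by apply: cA; rewrite invr_gt0.
      by apply: eq_from_tnth => i; rewrite tnth_map tnth_mktuple mulrC.
    apply/seteqP; split => u /=; rewrite /B /sqball /= normE.
      move=> [/andP[u0 u1] /(aux _ u0) Au]; split => //.
      by apply/negP; rewrite -ltNge -sqrtr_gt0.
    move=> [[Au u1] /negP]; rewrite -ltNge -sqrtr_gt0 => u0.
    by rewrite u1 andbT; split => //; apply/aux.
  have mAB : measurable (A `&` B) by apply: measurableI => //; exact: measurable_sqball.
  rewrite measureD//; [|exact: measurable_sqball|]; last first.
    by apply: le_lt_trans (leb_ball_lty d.+1); apply: le_measure; rewrite ?inE//; exact: measurable_sqball.
  rewrite [X in _ - X](_ : _ = 0) ?sube0//.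
  apply/eqP; rewrite eq_le measure_ge0 andbT -(leb_point d).
  apply: le_measure; rewrite ?inE; [|exact: measurable_sqball|exact: subIsetr].
  by apply: measurableI => //; exact: measurable_sqball.
have fB : leb R d.+1 B \is a fin_num by rewrite ge0_fin_numE// leb_ball_lty.
have gA : gauss R d.+1 A \is a fin_num.
  rewrite ge0_fin_numE// (@le_lt_trans _ _ 1) ?ltry// -(gaussT R d.+1).
  by apply: le_measure; rewrite ?inE.
rewrite -gauss_cone// fineM// mulfK// gt_eqF// fine_gt0// leb_ball_lty andbT.
exact: leb_ball_gt0.
Qed.

End Cones.
Arguments sqball R d t : clear implicits.

(** * Unitary matrices and cofactors *)

Section UnitaryTransitive.
Variable R : realType.
Local Notation C := R[i].
Local Open Scope sesquilinear_scope.

Lemma adjmxM m n p (A : 'M[C]_(m, n)) (B : 'M[C]_(n, p)) :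
  (A *m B)^t* = B^t* *m A^t*.
Proof. by rewrite trmx_mul map_mxM. Qed.

Lemma adjmxK m n (A : 'M[C]_(m, n)) : A^t*^t* = A.
Proof. by apply/matrixP => i j; rewrite !mxE conjCK. Qed.

Lemma adjmxD m n (A B : 'M[C]_(m, n)) : (A + B)^t* = A^t* + B^t*.
Proof. by rewrite linearD /= map_mxD. Qed.

Lemma adjmxB m n (A B : 'M[C]_(m, n)) : (A - B)^t* = A^t* - B^t*.
Proof. by rewrite linearB /= map_mxB. Qed.

Lemma adjmxZ m n (c : C) (A : 'M[C]_(m, n)) : (c *: A)^t* = c^* *: A^t*.
Proof. by rewrite linearZ /= map_mxZ. Qed.

Lemma adjmx1 n : (1%:M : 'M[C]_n)^t* = 1%:M.
Proof. by rewrite trmx1 map_mx1. Qed.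

Lemma vnsq_eq0 n (w : 'cV[C]_n) : (w^t* *m w == 0) = (w == 0).
Proof.
apply/eqP/eqP => [h|->]; last by rewrite mulmx0.
apply/colP => j; rewrite mxE.
have : vnsq w = 0 by apply: complexI; rewrite vnsqE h mxE.
move=> /eqP; rewrite psumr_eq0 => [/allP /(_ j)|i _]; last exact: nsq_ge0.
rewrite mem_index_enum => /(_ isT); rewrite /nsq paddr_eq0 ?sqr_ge0// !sqrf_eq0.
by case: (w j 0) => a b /= /andP[/eqP -> /eqP ->].
Qed.

Definition ip n (v w : 'cV[C]_n) : C := (v^t* *m w) 0 0.

Lemma ipBl n (u v w : 'cV[C]_n) : ip (u - v) w = ip u w - ip v w.
Proof. by rewrite /ip adjmxB mulmxBl !mxE. Qed.

Lemma ipBr n (u v w : 'cV[C]_n) : ip u (v - w) = ip u v - ip u w.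
Proof. by rewrite /ip mulmxBr !mxE. Qed.

Lemma ipZl n t (u v : 'cV[C]_n) : ip (t *: u) v = t^* * ip u v.
Proof. by rewrite /ip adjmxZ -scalemxAl mxE. Qed.

Lemma ipZr n t (u v : 'cV[C]_n) : ip u (t *: v) = t * ip u v.
Proof. by rewrite /ip -scalemxAr mxE. Qed.

Lemma ip_conj n (u v : 'cV[C]_n) : ip u v = (ip v u)^*.
Proof.
rewrite /ip !mxE rmorph_sum; apply: eq_bigr => j _.
by rewrite !mxE rmorphM /= conjCK mulrC.
Qed.

Lemma ip_vnsq n (u : 'cV[C]_n) : ip u u = (vnsq u)%:C%C.
Proof. by rewrite vnsqE. Qed.

(* A phase change makes the inner product of the two vectors real, and then the
   Householder reflection along their difference exchanges them. *)
Lemma unitary_transitive n (a b : 'cV[C]_n) : vnsq a = vnsq b ->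
  exists2 U : 'M[C]_n, U^t* *m U = 1%:M & U *m a = b.
Proof.
move=> ab; pose c := ip a b.
have [t tt tc] : exists2 t : C, t^* * t = 1 & t^* * c \is Num.real.
  have [->|c0] := eqVneq c 0; first by exists 1; rewrite ?rmorph1 ?mul1r ?mulr0.
  exists (c / `|c|).
    rewrite rmorphM fmorphV /= conj_normC mulrACA [c^* * c]mulrC -normCK -invfM -expr2.
    by rewrite mulfV// expf_neq0// normr_eq0.
  rewrite rmorphM fmorphV /= conj_normC mulrAC [c^* * c]mulrC -normCK.
  by rewrite rpredM ?rpredV ?rpredX//; apply: normr_real.
pose a' := t *: a; pose w := a' - b.
have a'a' : ip a' a' = ip b b.
  by rewrite /a' ipZl ipZr mulrA tt mul1r !ip_vnsq ab.
have a'b : ip a' b = t^* * c by rewrite /a' ipZl.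
have ba' : ip b a' = ip a' b by rewrite ip_conj a'b; apply/CrealP.
have ww : ip w w = 2 * ip w a'.
  by rewrite /w !ipBl !ipBr a'a' ba'; ring.
have [w0|w0] := eqVneq (ip w w) 0.
  exists (t%:M).
    by rewrite -[t%:M]scalemx1 adjmxZ adjmx1 -scalemxAl mul1mx scalerA tt scale1r.
  rewrite mul_scalar_mx -/a'; apply/eqP; rewrite -subr_eq0 -/w -vnsq_eq0.
  by apply/eqP/matrixP => i j; rewrite !ord1 [RHS]mxE; exact: w0.
pose s := 2 / ip w w.
have sR : s^* = s.
  rewrite /s rmorphM fmorphV /= conjC_nat; congr (_ / _).
  by rewrite -ip_conj.
pose H : 'M[C]_n := 1%:M - s *: (w *m w^t*).
have HH : H^t* *m H = 1%:M.
  have -> : H^t* = H.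
    by rewrite /H adjmxB adjmx1 adjmxZ adjmxM adjmxK sR.
  rewrite /H mulmxBl mul1mx mulmxBr mulmx1 -scalemxAl -scalemxAr.
  rewrite -mulmxA [w^t* *m (w *m _)]mulmxA [w^t* *m w]mx11_scalar -/(ip w w).
  rewrite mul_scalar_mx -scalemxAr !scalerA.
  rewrite (_ : s * (s * ip w w) = s *+ 2); last first.
    by rewrite /s divfK// mulr_natr.
  by rewrite mulr2n scalerDl opprB addrK subrK.
have Ha : H *m a' = b.
  rewrite /H mulmxBl mul1mx -scalemxAl -mulmxA [w^t* *m a']mx11_scalar -/(ip w a').
  rewrite mul_mx_scalar scalerA (_ : s * ip w a' = 1).
    by rewrite scale1r /w opprB addrC subrK.
  by rewrite /s mulrAC -ww mulfV.
exists (t *: H).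
  by rewrite adjmxZ -scalemxAl -scalemxAr HH scalerA tt scale1r.
by rewrite -scalemxAl scalemxAr.
Qed.

End UnitaryTransitive.

Section LastColumn.
Variables (F : comUnitRingType) (K : nat).

Definition set_last (M : 'M[F]_K.+1) (v : 'cV[F]_K.+1) : 'M[F]_K.+1 :=
  \matrix_(i, j) if j == ord_max then v i 0 else M i j.

Definition last_cof (M : 'M[F]_K.+1) : 'rV[F]_K.+1 := \row_i cofactor M i ord_max.

Lemma det_set_last M v : \det (set_last M v) = (last_cof M *m v) 0 0.
Proof.
rewrite (expand_det_col _ ord_max) !mxE; apply: eq_bigr => i _.
rewrite !mxE eqxx mulrC; congr (_ * _).
rewrite /cofactor; congr (_ * \det _); apply/matrixP => a b; rewrite !mxE.
by rewrite eq_sym (negbTE (neq_lift _ _)).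
Qed.

Lemma set_last_col M : set_last M (col ord_max M) = M.
Proof. by apply/matrixP => i j; rewrite !mxE; case: eqP => [->|]. Qed.

Lemma set_last_mul (V M : 'M[F]_K.+1) (v : 'cV[F]_K.+1) : set_last (V *m M) (V *m v) = V *m set_last M v.
Proof.
apply/matrixP => i j; rewrite !mxE; case: eqP => [->|jN].
  by apply: eq_bigr => k _; rewrite !mxE eqxx.
by apply: eq_bigr => k _; rewrite !mxE; case: eqP.
Qed.

(** Cofactors paired with a column are a determinant, so this is its multiplicativity. *)
Lemma last_cof_mul (V M : 'M[F]_K.+1) (v : 'cV[F]_K.+1) :
  (last_cof (V *m M) *m (V *m v)) 0 0 = \det V * (last_cof M *m v) 0 0.
Proof. by rewrite -!det_set_last set_last_mul det_mulmx. Qed.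

Lemma eq_last_cof (M M' : 'M[F]_K.+1) : (forall i j, j != ord_max -> M i j = M' i j) ->
  last_cof M = last_cof M'.
Proof.
move=> MM'; apply/rowP => i; rewrite !mxE /cofactor; congr (_ * \det _).
by apply/matrixP => a b; rewrite !mxE MM'// eq_sym neq_lift.
Qed.

End LastColumn.

(** * Laws of Gaussian coordinates *)

Section GaussianFacts.
Local Open Scope ereal_scope.
Variable R : realType.
Local Notation C := R[i].
Local Notation mR := (measurableTypeR R).
Local Notation V N := ((N + N).-tuple mR).
Local Notation leb1 := [the {sigma_finite_measure set mR -> \bar R} of @lebesgue_measure R].
Local Open Scope sesquilinear_scope.

Lemma measurable_le_set d0 (T : measurableType d0) (f g : T -> R) :
  measurable_fun [set: T] f -> measurable_fun [set: T] g ->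
  measurable [set u | (f u <= g u)%R].
Proof. by move=> mf mg; rewrite -[X in measurable X]setTI; exact: measurable_fun_le. Qed.

Lemma measurable_lt_set d0 (T : measurableType d0) (f g : T -> R) :
  measurable_fun [set: T] f -> measurable_fun [set: T] g ->
  measurable [set u | (f u < g u)%R].
Proof.
move=> mf mg; rewrite (_ : [set u | _] = ~` [set u | (g u <= f u)%R]).
  by apply: measurableC; exact: measurable_le_set.
by apply/seteqP; split => u /=; rewrite ltNge => /negP.
Qed.

Lemma gauss_le1 d (A : set (d.-tuple mR)) : measurable A -> gauss R d A <= 1.
Proof. by move=> mA; rewrite -(gaussT R d); apply: le_measure; rewrite ?inE. Qed.

Lemma gauss_fin d (A : set (d.-tuple mR)) : measurable A -> gauss R d A \is a fin_num.
Proof. by move=> mA; rewrite ge0_fin_numE// (le_lt_trans (gauss_le1 mA))// ltry. Qed.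

Lemma gaussC d (A : set (d.-tuple mR)) : measurable A ->
  gauss R d (~` A) = 1 - gauss R d A.
Proof.
move=> mA; rewrite -setTD measureD ?setTI//; first exact: (congr1 (fun z => z - gauss R d A) (gaussT R d)).
by apply: (@le_lt_trans _ _ 1); [exact: gauss_le1|exact: ltry].
Qed.

(** The area grows linearly in the squared radius; this is what makes the squared modulus of a
    complex Gaussian exponential. *)
Lemma leb_sqball2 t : leb R 2 (sqball R 2 t) = (Num.max t 0)%:E * leb R 2 (sqball R 2 1).
Proof.
have [t0|t0] := ltP 0%R t.
  have := @leb_cone_sqball R 2 setT t measurableT (fun _ _ _ => iff_refl _) t0.
  by rewrite !setTI sqr_sqrtr ?(ltW t0).
rewrite mul0e; apply/eqP; rewrite eq_le measure_ge0 andbT -(leb_point R 1).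
apply: le_measure; rewrite ?inE; [exact: measurable_sqball|exact: measurable_sqball|].
by move=> u; rewrite /sqball /= => /le_trans; apply.
Qed.

(** Lack of memory: shifting the layer variable by [r] multiplies the layer integral by exp(-r), and
    the area of the annulus depends only on the difference of squared radii. The area of the unit
    disc cancels against the total mass 1. *)
Lemma gauss2_tail (r : R) : (0 <= r)%R ->
  gauss R 2 [set u | (r < sqnorm u)%R] = (expR (- r))%:E.
Proof.
move=> r0; pose l1 := leb R 2 (sqball R 2 1).
pose phi (t : mR) := (expR (- t))%:E * ((Num.max t 0)%:E * l1).
have l10 : 0 <= l1 by exact: measure_ge0.
have phi0 t : 0 <= phi t.
  by rewrite !mule_ge0// lee_fin ?expR_ge0// le_max lexx orbT.
have mphi : measurable_fun [set: mR] phi.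
  apply: emeasurable_funM.
    by apply/measurable_EFinP; apply: measurableT_comp => //; exact: measurableT_comp.
  apply: emeasurable_funM => //; apply/measurable_EFinP.
  exact: measurable_maxr.
have I1 : (gpeak R ^+ 2)%:E * \int[leb1]_t phi t = 1.
  rewrite -(gaussT R 2) gauss_layer//; congr (_%:E * _).
  by apply: eq_integral => t _; rewrite setTI leb_sqball2.
have mS : measurable [set u : 2.-tuple mR | (r < sqnorm u)%R].
  apply: measurable_lt_set => //.
  exact: measurable_sqnorm.
rewrite gauss_layer// -[RHS]mule1 -I1 muleCA; apply: (congr1 (mule _)).
rewrite -(leb1_shift (- r)%R mphi phi0) -ge0_integralZl//; first last.
- exact: (measurableT_comp mphi (measurable_addr (- r)%R)).
apply: eq_integral => t _; rewrite /phi muleA -EFinM -expRD opprB addKr.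
apply: (congr1 (mule _)).
have [rt|rt] := ltP r t; last first.
  rewrite max_r ?subr_le0// mul0e (_ : _ `&` _ = set0) ?measure0//.
  apply/seteqP; split => // u [/= ru]; rewrite /sqball /= => ut.
  by move: (lt_le_trans ru (le_trans ut rt)); rewrite ltxx.
have -> : [set u | (r < sqnorm u)%R] `&` sqball R 2 t = sqball R 2 t `\` sqball R 2 r.
  apply/seteqP; split => u [] /=; rewrite /sqball /=.
    by move=> ru ut; split => //; apply/negP; rewrite -ltNge.
  by move=> ut /negP; rewrite -ltNge.
have fin s : leb R 2 (sqball R 2 s) < +oo.
  rewrite leb_sqball2; apply: lte_mul_pinfty => //; last exact: leb_ball_lty.
  by rewrite lee_fin le_max lexx orbT.
have rt2 : sqball R 2 t `&` sqball R 2 r = sqball R 2 r.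
  by apply/setIidr => u; rewrite /sqball /= => /le_trans; apply; exact: ltW.
transitivity (leb R 2 (sqball R 2 t) - leb R 2 (sqball R 2 r)).
  rewrite -{2}rt2; apply: measureD; [exact: measurable_sqball|exact: measurable_sqball|].
  exact: fin.
rewrite (leb_sqball2 t) (leb_sqball2 r) !max_l ?subr_ge0 ?(ltW rt)// ?(le_trans r0 (ltW rt))//.
rewrite -/l1; have : l1 \is a fin_num by rewrite ge0_fin_numE// leb_ball_lty.
move=> /fineK <-.
by rewrite -!EFinM -EFinB mulrBl.
Qed.

(** The factor exp(-c |u|^2) merges with the density into a Gaussian dilated by sqrt(1 + c). *)
Lemma gauss_laplace d (c : R) : (0 <= c)%R ->
  \int[gauss R d]_u (expR (- (c * sqnorm u)))%:E = ((Num.sqrt (1 + c))^-1 ^+ d)%:E.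
Proof.
move=> c0; have s0 : (0 < Num.sqrt (1 + c))%R by rewrite sqrtr_gt0 ltr_wpDr.
rewrite -integral_gdens_scale// integral_gauss; first last.
- by move=> u; rewrite lee_fin expR_ge0.
- apply/measurable_EFinP; do 2!apply: measurableT_comp => //.
  by apply: measurable_funM => //; exact: measurable_sqnorm.
apply: eq_integral => u _; rewrite -EFinM /gdens mulrCA -expRD.
rewrite sqnorm_tscale sqr_sqrtr ?addr_ge0//; congr ((_ * expR _)%:E).
by rewrite mulrDl mul1r opprD addrC.
Qed.

Lemma gauss_point d : gauss R d.+1 (sqball R d.+1 0) = 0.
Proof.
rewrite gauss_layer; last exact: measurable_sqball.
rewrite [X in _ * X](_ : _ = 0) ?mule0//.
apply: integral0_eq => t _; rewrite (_ : leb _ _ _ = 0) ?mule0//.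
apply/eqP; rewrite eq_le measure_ge0 andbT -(leb_point R d).
apply: le_measure; rewrite ?inE; [|exact: measurable_sqball|by move=> u []].
by apply: measurableI; exact: measurable_sqball.
Qed.

Lemma measurable_nsq_coord N (j : 'I_N) :
  measurable_fun [set: V N] (fun g : V N => nsq (cvec g j 0)%R).
Proof. by apply: measurable_nsq; exact: mxmeas_cvec. Qed.

Lemma gauss_indic d (A : set (d.-tuple mR)) : measurable A ->
  gauss R d A = \int[gauss R d]_u (\1_A u)%:E.
Proof. by move=> mA; rewrite integral_indicT. Qed.

(** The complement says that the first squared modulus exceeds [c = x / (1 - x)] times the squared
    norm of the others. Given these, its probability is an exponential tail, whose mean is a Laplace
    transform with value (1 + c)^(-K) = (1 - x)^K. *)
Lemma gauss_first_coord K (x : R) : (0 <= x < 1)%R ->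
  gauss R (K.+1 + K.+1) [set g | (nsq (cvec g 0 0) <= x * sqnorm g)%R] =
  (1 - (1 - x) ^+ K)%:E.
Proof.
move=> /andP[x0 x1]; have x1' : (0 < 1 - x)%R by rewrite subr_gt0.
pose c := (x / (1 - x))%R; have c0 : (0 <= c)%R by rewrite divr_ge0// ltW.
have cE : (1 + c)%R = ((1 - x)^-1)%R.
  by rewrite /c -[X in (X + _)%R](mulfV (lt0r_neq0 x1')) -mulrDl subrK mul1r.
set A := [set g | _].
have mA : measurable A.
  apply: measurable_le_set; first exact: measurable_nsq_coord.
  by apply: measurable_funM => //; exact: measurable_sqnorm.
suff AC : gauss R (K.+1 + K.+1) (~` A) = ((1 - x) ^+ K)%:E.
  move: AC; rewrite gaussC//; have := gauss_fin mA.
  by case: (gauss _ _ A) => // r _ [<-]; rewrite opprB addrC subrK.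
have mAC := measurableC mA.
rewrite gauss_indic// -(@gauss_vcat R 1 K (fun g => (\1_(~` A) g)%:E)); first last.
- by move=> u; rewrite lee_fin.
- exact: measurable_indicE.
pose B := [set p : V 1 * V K | (c * sqnorm p.2 < sqnorm p.1)%R].
have mB : measurable B.
  apply: measurable_lt_set => //.
    apply: measurable_funM => //.
    exact: (measurableT_comp (measurable_sqnorm (d := K + K)) measurable_snd).
  exact: (measurableT_comp (measurable_sqnorm (d := 1 + 1)) measurable_fst).
have BE (u : V 1) (v : V K) : (\1_(~` A) (@vcat R 1 K (u, v)))%:E = (\1_B (u, v))%:E :> \bar R.
  rewrite !indicE; congr ((_ : bool)%:R%:E).
  have q1 : (nsq (cvec u 0 0) = sqnorm u)%R by rewrite sqnorm_cvec /vnsq big_ord1.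
  have E : ((nsq (cvec (@vcat R 1 K (u, v) : V K.+1) 0 0) <= x * sqnorm (@vcat R 1 K (u, v))) =
            (sqnorm u <= c * sqnorm v))%R.
    rewrite sqnorm_cvec /vcat vtupK /= vnsq_col_mx -!sqnorm_cvec.
    rewrite [X in nsq X](_ : _ = (cvec u 0 0)%R); last first.
      rewrite -[RHS](@col_mxEu _ 1 K 1 (cvec u) (cvec v)).
    by apply: (congr1 (fun i => col_mx (cvec u) (cvec v) i 0%R)); apply/val_inj.
    rewrite q1 mulrDr -lerBlDl -[X in (X - _)%R]mul1r -mulrBl mulrC -ler_pdivlMr//.
    by rewrite mulrAC.
  apply/idP/idP; rewrite !inE /A /B /=.
    by move=> /negP; rewrite E -ltNge.
  by move=> h; apply/negP; rewrite E -ltNge.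
under eq_integral => u _ do under eq_integral => v _ do rewrite BE.
rewrite (fubini_tonelli (m1 := gauss R (1 + 1)) (m2 := gauss R (K + K)) (fun p => (\1_B p)%:E))//=; last first.
  exact: measurable_indicE.
transitivity (\int[gauss R (K + K)]_v (expR (- (c * sqnorm v)))%:E).
  apply: eq_integral => v _; rewrite -gauss2_tail; last by rewrite mulr_ge0// sqnorm_ge0.
  rewrite gauss_indic; last first.
    by apply: measurable_lt_set => //; exact: measurable_sqnorm.
  apply: eq_integral => u _ /=; rewrite !indicE; congr ((_ : bool)%:R%:E).
rewrite gauss_laplace// cE -sqrtrV ?invr_ge0 ?(ltW x1')// invrK addnn -mul2n exprM.
by rewrite sqr_sqrtr// ltW.
Qed.

End GaussianFacts.

(** * Moments of one coordinate of a uniform point *)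

Section Moments.
Local Open Scope ereal_scope.
Variable R : realType.
Local Notation C := R[i].
Local Notation mR := (measurableTypeR R).
Local Notation V N := ((N + N).-tuple mR).
Local Open Scope sesquilinear_scope.

Lemma nsqM (z w : C) : nsq (z * w)%R = (nsq z * nsq w)%R.
Proof. by case: z w => [a b] [c d]; rewrite /nsq /=; ring. Qed.

(** Ratios by [sqnorm] take the value 0 at the origin; this discards that point. *)
Lemma gauss_ae_eq d (f g : d.+1.-tuple mR -> \bar R) :
  measurable_fun [set: d.+1.-tuple mR] f -> measurable_fun [set: d.+1.-tuple mR] g ->
  (forall u, 0 <= f u) -> (forall u, 0 <= g u) ->
  (forall u, (0 < sqnorm u)%R -> f u = g u) ->
  \int[gauss R d.+1]_u f u = \int[gauss R d.+1]_u g u.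
Proof.
move=> mf mg f0 g0 fg; apply: ge0_ae_eq_integral => //.
exists (sqball R d.+1 0); split; [exact: measurable_sqball|exact: gauss_point|].
move=> u /= ufg; rewrite /sqball /= leNgt; apply/negP => u0.
by apply: ufg => _; exact: fg.
Qed.

(** For a unit row [l], this is the variable Z of the overview. *)
Definition rowproj N (l : 'rV[C]_N) (E : V N) : R :=
  (nsq ((l *m cvec E) 0 0) / sqnorm E)%R.

Lemma rowproj_ge0 N (l : 'rV[C]_N) E : (0 <= rowproj l E)%R.
Proof. by rewrite divr_ge0 ?nsq_ge0// sqnorm_ge0. Qed.

Lemma measurable_ratio d0 (T : measurableType d0) (f g : T -> R) :
  (forall x, 0 <= g x)%R ->
  measurable_fun [set: T] f -> measurable_fun [set: T] g ->
  measurable_fun [set: T] (fun x => f x / g x)%R.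
Proof.
move=> g0 mf mg; apply: measurable_funM => //.
(* The inverse is built from measurable functions, with its default value at 0 kept apart. *)
rewrite (_ : (fun x => _) = (fun x => if g x == 0 then 0 else expR (- ln (g x)))%R).
  apply: measurable_fun_if => //.
    exact: measurable_fun_eqr.
  apply: measurable_funTS; apply: measurableT_comp => //.
  by do 2!apply: measurableT_comp => //.
apply/funext => x; have [->|gx] := eqVneq (g x) 0%R; first by rewrite invr0.
by rewrite expRN lnK// posrE lt_neqAle eq_sym gx g0.
Qed.

Lemma measurable_rowproj N (l : 'rV[C]_N) : measurable_fun [set: V N] (rowproj l).
Proof.
apply: measurable_ratio; [exact: sqnorm_ge0| |exact: measurable_sqnorm].
apply: measurable_nsq; apply: mxmeasM; first exact: mxmeas_cst.
exact: mxmeas_cvec.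
Qed.

Lemma rowproj_unitary N (l l' : 'rV[C]_N) (U : 'M[C]_N) E :
  U^t* *m U = 1%:M -> l' *m U = l -> rowproj l' (mxact U E) = rowproj l E.
Proof.
move=> UU lU; rewrite /rowproj /mxact vtupK mulmxA lU !sqnorm_cvec vtupK.
by rewrite vnsq_unitary.
Qed.

Lemma row_unitary N (l l' : 'rV[C]_N) : vnsq (l^t*) = vnsq (l'^t*) ->
  exists2 U : 'M[C]_N, U^t* *m U = 1%:M & l' *m U = l.
Proof.
move=> /unitary_transitive[U UU Ul]; exists U => //.
by rewrite -(adjmxK l') -Ul adjmxM adjmxK -mulmxA UU mulmx1.
Qed.

Lemma integral_rowproj N (l l' : 'rV[C]_N) p : vnsq (l^t*) = vnsq (l'^t*) ->
  \int[gauss R (N + N)]_E (rowproj l E ^+ p)%:E =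
  \int[gauss R (N + N)]_E (rowproj l' E ^+ p)%:E.
Proof.
move=> /row_unitary[U UU lU].
rewrite -(gauss_unitary (f := fun E => (rowproj l' E ^+ p)%:E) UU)//.
- by apply: eq_integral => E _; rewrite (rowproj_unitary _ UU lU).
- by apply/measurable_EFinP; apply: measurable_funX; exact: measurable_rowproj.
- by move=> E; rewrite lee_fin exprn_ge0// rowproj_ge0.
Qed.

Definition erow N (i : 'I_N) : 'rV[C]_N := (delta_mx 0 i)%R.

Definition crat N (i : 'I_N) (E : V N) : R := (nsq (cvec E i 0%R) / sqnorm E)%R.

Lemma cratE N (i : 'I_N) E : crat i E = rowproj (erow i) E.
Proof. by rewrite /crat /rowproj /erow -rowE [row _ _ _ _]mxE. Qed.

Lemma crat_ge0 N (i : 'I_N) E : (0 <= crat i E)%R.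
Proof. by rewrite cratE rowproj_ge0. Qed.

Lemma measurable_crat N (i : 'I_N) : measurable_fun [set: V N] (crat i).
Proof.
rewrite (_ : crat i = rowproj (erow i)); first exact: measurable_rowproj.
by apply/funext => E; rewrite cratE.
Qed.

Lemma sum_crat N (E : V N) : (0 < sqnorm E)%R -> (\sum_i crat i E = 1)%R.
Proof.
move=> E0; rewrite -mulr_suml -/(vnsq (cvec E)) -sqnorm_cvec.
by rewrite mulfV// gt_eqF.
Qed.

Lemma vnsq_delta N (i : 'I_N) : vnsq ((erow i)^t*) = 1%R.
Proof.
apply: complexI; rewrite vnsqE adjmxK /erow -rowE !mxE !eqxx /=.
by rewrite conjC1.
Qed.

Lemma crat_le1 N (i : 'I_N) (E : V N) : (crat i E <= 1)%R.
Proof.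
have [E0|E0] := eqVneq (sqnorm E) 0%R; first by rewrite /crat E0 invr0 mulr0.
have E1 : (0 < sqnorm E)%R by rewrite lt_neqAle eq_sym E0 sqnorm_ge0.
rewrite -(sum_crat E1) (bigD1 i)//= lerDl sumr_ge0// => j _; exact: crat_ge0.
Qed.

Lemma ge0_integral_EFinD d0 (T : measurableType d0) (m : {measure set T -> \bar R})
    (f g : T -> R) :
  measurable_fun [set: T] f -> measurable_fun [set: T] g ->
  (forall x, 0 <= f x)%R -> (forall x, 0 <= g x)%R ->
  \int[m]_x (f x + g x)%:E = \int[m]_x (f x)%:E + \int[m]_x (g x)%:E.
Proof.
move=> mf mg f0 g0; under eq_integral do rewrite EFinD.
by rewrite ge0_integralD//; first [exact/measurable_EFinP|by move=> x _; rewrite lee_fin].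
Qed.

Lemma ge0_integral_EFinD3 d0 (T : measurableType d0) (m : {measure set T -> \bar R})
    (f g h : T -> R) :
  measurable_fun [set: T] f -> measurable_fun [set: T] g -> measurable_fun [set: T] h ->
  (forall x, 0 <= f x)%R -> (forall x, 0 <= g x)%R -> (forall x, 0 <= h x)%R ->
  \int[m]_x (f x + g x + h x)%:E =
  \int[m]_x (f x)%:E + \int[m]_x (g x)%:E + \int[m]_x (h x)%:E.
Proof.
move=> mf mg mh f0 g0 h0.
rewrite (@ge0_integral_EFinD _ _ m (fun x => f x + g x)%R h)//.
- by rewrite ge0_integral_EFinD.
- exact: measurable_funD.
- by move=> x; rewrite addr_ge0.
Qed.

Lemma ge0_integral_EFinD4 d0 (T : measurableType d0) (m : {measure set T -> \bar R})
    (f g h k : T -> R) :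
  measurable_fun [set: T] f -> measurable_fun [set: T] g ->
  measurable_fun [set: T] h -> measurable_fun [set: T] k ->
  (forall x, 0 <= f x)%R -> (forall x, 0 <= g x)%R ->
  (forall x, 0 <= h x)%R -> (forall x, 0 <= k x)%R ->
  \int[m]_x (f x + g x + h x + k x)%:E =
  \int[m]_x (f x)%:E + \int[m]_x (g x)%:E + \int[m]_x (h x)%:E + \int[m]_x (k x)%:E.
Proof.
move=> mf mg mh mk f0 g0 h0 k0.
rewrite (@ge0_integral_EFinD _ _ m (fun x => f x + g x + h x)%R k)//.
- by rewrite ge0_integral_EFinD3.
- by apply: measurable_funD => //; exact: measurable_funD.
- by move=> x; rewrite !addr_ge0.
Qed.

Section FirstTwo.
Variables (N : nat) (l : 'rV[C]_N.+1).
Hypothesis l1 : vnsq (l^t*) = 1%R.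
Local Notation G := (gauss R (N.+1 + N.+1)).

Lemma integral_crat (i : 'I_N.+1) p :
  \int[G]_E (crat i E ^+ p)%:E = \int[G]_E (rowproj l E ^+ p)%:E.
Proof.
rewrite (@integral_rowproj _ l (erow i)) ?l1 ?vnsq_delta//.
by apply: eq_integral => E _; rewrite cratE.
Qed.

Lemma measurable_cratM (i j : 'I_N.+1) :
  measurable_fun [set: V N.+1] (fun E => (crat i E * crat j E)%:E : \bar R).
Proof.
by apply/measurable_EFinP; apply: measurable_funM; exact: measurable_crat.
Qed.

Lemma le1_gauss_fin d (f : d.-tuple mR -> R) :
  measurable_fun [set: d.-tuple mR] f -> (forall E, 0 <= f E <= 1)%R ->
  \int[gauss R d]_E (f E)%:E \is a fin_num.
Proof.
move=> mf f01; rewrite ge0_fin_numE; last first.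
  by apply: integral_ge0 => E _; rewrite lee_fin; case/andP: (f01 E).
apply: (@le_lt_trans _ _ 1); last exact: ltry.
rewrite -(gaussT R d) -[leRHS]mul1e -integral_cst//.
apply: ge0_le_integral => //.
- by move=> E _; rewrite lee_fin; case/andP: (f01 E).
- exact/measurable_EFinP.
- by move=> E _; rewrite lee_fin; case/andP: (f01 E).
Qed.

(** The [N.+1] coordinate ratios sum to 1 off the origin and, by unitary invariance, all have this
    mean. *)
Lemma integral_rowproj1 : \int[G]_E (rowproj l E)%:E = (N.+1%:R^-1)%:E.
Proof.
have mX (i : 'I_N.+1) : measurable_fun [set: V N.+1] (fun E => (crat i E)%:E : \bar R).
  by apply/measurable_EFinP; exact: measurable_crat.
have c1 (i : 'I_N.+1) : \int[G]_E (crat i E)%:E = \int[G]_E (rowproj l E)%:E.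
  exact: (integral_crat i 1).
have fin : \int[G]_E (rowproj l E)%:E \is a fin_num.
  rewrite -(c1 ord0); apply: le1_gauss_fin; first exact: measurable_crat.
  by move=> E; rewrite crat_ge0 crat_le1.
have : \int[G]_E (\sum_(i < N.+1) (crat i E)%:E) = 1.
  rewrite -(gaussT R (N.+1 + N.+1)) -[RHS]mul1e -integral_cst//.
  apply: gauss_ae_eq => //.
  - exact: emeasurable_sum.
  - by move=> u; rewrite sume_ge0// => i _; rewrite lee_fin crat_ge0.
  - by move=> u u0; rewrite sumEFin sum_crat.
rewrite ge0_integral_sum//; last by move=> i E _; rewrite lee_fin crat_ge0.
under eq_bigr => i _ do rewrite c1.
rewrite -(fineK fin) sumEFin sumr_const card_ord => -[m1].
congr EFin; apply: (@mulIf _ N.+1%:R); first by rewrite pnatr_eq0.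
by rewrite mulr_natr m1 mulVf// pnatr_eq0.
Qed.

(** The phases are the fourth roots of unity: averaging over them keeps only the terms balanced in
    [b] and its conjugate. *)
Lemma polarization : exists t1 t2 t3 t4 : C,
  [/\ nsq t1 = 1%R, nsq t2 = 1%R, nsq t3 = 1%R, nsq t4 = 1%R & forall a b : C,
  (nsq (a + t1 * b) ^+ 2 + nsq (a + t2 * b) ^+ 2 + nsq (a + t3 * b) ^+ 2 + nsq (a + t4 * b) ^+ 2 =
   4 * (nsq a ^+ 2 + nsq b ^+ 2 + 4 * (nsq a * nsq b)))%R].
Proof.
exists (Complex 1 0)%R, (Complex (-1) 0)%R, (Complex 0 1)%R, (Complex 0 (-1))%R.
split; try by rewrite /nsq /= ?sqrrN ?expr1n ?expr0n ?addr0 ?add0r.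
by move=> [a1 a2] [b1 b2]; rewrite /nsq /=; ring.
Qed.

(** The rows (e_i + t e_j) / sqrt 2 are unit, so each has the common second moment e. Summed over
    the four phases, polarization gives 4 e = 2 e + 4 c, where c is the mixed moment. *)
Lemma integral_crat_mixed (i j : 'I_N.+1) : i != j ->
  2%:E * \int[G]_E (crat i E * crat j E)%:E = \int[G]_E (rowproj l E ^+ 2)%:E.
Proof.
have [t1 [t2 [t3 [t4 [n1 n2 n3 n4 pol]]]]] := polarization.
move=> ij; pose s : C := ((Num.sqrt 2)^-1)%:C%C.
have s2 : nsq s = 2^-1%R.
  by rewrite /nsq /= expr0n addr0 exprVn sqr_sqrtr.
pose r (t : C) : 'rV[C]_N.+1 := (s *: (erow i + t *: erow j))%R.
have rE t E : (rowproj (r t) E =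
    2^-1 * nsq (cvec E i 0 + t * cvec E j 0) / sqnorm E)%R.
  rewrite /rowproj -s2 -nsqM; congr (nsq _ / _)%R.
  by rewrite /r -scalemxAl mulmxDl -scalemxAl /erow -!rowE !mxE.
have r1 (t : C) : nsq t = 1%R -> vnsq ((r t)^t*) = 1%R.
  move=> nt; rewrite /vnsq (bigD1 i)//= (bigD1 j) ?(eq_sym j)//= big1 ?addr0.
    rewrite !mxE !eqxx /= (negbTE ij) eq_sym (negbTE ij) /= mulr0 mulr1 addr0 add0r.
    have nc (z : C) : nsq z^* = nsq z by case: z => u v; rewrite /nsq /= sqrrN.
    by rewrite !nc mulr1 nsqM nt mulr1 s2; lra.
  move=> k /andP[ki kj]; rewrite !mxE (negbTE ki) (negbTE kj) !mulr0 addr0 mulr0.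
  by rewrite conjC0 /nsq /= expr0n addr0.
have rI (t : C) : nsq t = 1%R ->
    \int[G]_E (rowproj (r t) E ^+ 2)%:E = \int[G]_E (rowproj l E ^+ 2)%:E.
  by move=> nt; apply: integral_rowproj; rewrite l1 r1.
have key E : (rowproj (r t1) E ^+ 2 + rowproj (r t2) E ^+ 2 +
    rowproj (r t3) E ^+ 2 + rowproj (r t4) E ^+ 2 =
    crat i E ^+ 2 + crat j E ^+ 2 + 4 * (crat i E * crat j E))%R.
  rewrite (rE t1) (rE t2) (rE t3) (rE t4) /crat.
  have := pol (cvec E i 0)%R (cvec E j 0)%R.
  move: (cvec E i 0)%R (cvec E j 0)%R ((sqnorm E)^-1)%R => a' b' q.
  set x := nsq (_ + t1 * _)%R; set y := nsq (_ + t2 * _)%R; set z := nsq (_ + t3 * _)%R.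
  set w := nsq (_ + t4 * _)%R; set a := nsq _; set b := nsq _ => H.
  transitivity ((2^-1 * q) ^+ 2 * (x ^+ 2 + y ^+ 2 + z ^+ 2 + w ^+ 2))%R; first by ring.
  by rewrite H; field.
have fin : \int[G]_E (rowproj l E ^+ 2)%:E \is a fin_num.
  rewrite -(integral_crat i); apply: le1_gauss_fin.
    by apply: measurable_funX; exact: measurable_crat.
  by move=> E; rewrite sqr_ge0 exprn_ile1 ?crat_ge0 ?crat_le1.
have fin2 : \int[G]_E (crat i E * crat j E)%:E \is a fin_num.
  apply: le1_gauss_fin; first by apply: measurable_funM; exact: measurable_crat.
  by move=> E; rewrite mulr_ge0 ?crat_ge0//= mulr_ile1 ?crat_ge0 ?crat_le1.
have m2 (k : 'I_N.+1) : measurable_fun [set: V N.+1] (fun E => (crat k E ^+ 2)%R).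
  by apply: measurable_funX; exact: measurable_crat.
have mm : measurable_fun [set: V N.+1] (fun E => (4 * (crat i E * crat j E))%R).
  apply: measurable_funM => //.
  by apply: measurable_funM; exact: measurable_crat.
have sq0 (f : V N.+1 -> R) E : (0 <= f E ^+ 2)%R by rewrite sqr_ge0.
have c0 E : (0 <= 4 * (crat i E * crat j E))%R by do 2?apply: mulr_ge0 => //; exact: crat_ge0.
have mr t : measurable_fun [set: V N.+1] (fun E => (rowproj (r t) E ^+ 2)%R).
  by apply: measurable_funX; exact: measurable_rowproj.
have L : \int[G]_E (rowproj (r t1) E ^+ 2 + rowproj (r t2) E ^+ 2 +
    rowproj (r t3) E ^+ 2 + rowproj (r t4) E ^+ 2)%:E =
    \int[G]_E (crat i E ^+ 2 + crat j E ^+ 2 + 4 * (crat i E * crat j E))%:E.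
  by apply: eq_integral => E _; rewrite key.
have L1 := ge0_integral_EFinD4 G (mr t1) (mr t2) (mr t3) (mr t4)
  (sq0 _) (sq0 _) (sq0 _) (sq0 _).
have L2 := ge0_integral_EFinD3 G (m2 i) (m2 j) mm (sq0 _) (sq0 _) c0.
have L3 := f_equal2 adde (f_equal2 adde (f_equal2 adde (rI t1 n1) (rI t2 n2)) (rI t3 n3)) (rI t4 n4).
have L4 : \int[G]_E (4 * (crat i E * crat j E))%:E = 4%:E * \int[G]_E (crat i E * crat j E)%:E.
  under eq_integral => E _ do rewrite EFinM.
  apply: ge0_integralZl; [exact: measurableT|exact: measurable_cratM| |].
    by move=> E _; rewrite lee_fin mulr_ge0 ?crat_ge0.
  by rewrite lee_fin.
have L5 := f_equal2 adde (f_equal2 adde (integral_crat i 2) (integral_crat j 2)) L4.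
move: (etrans (esym L3) (etrans (esym L1) (etrans L (etrans L2 L5)))).
rewrite -(fineK fin) -(fineK fin2). 
move: (fine _) (fine _) => c e; rewrite -!EFinM /= => -[H].
by congr EFin; lra.
Qed.

(** Expand the square of the sum of the coordinate ratios, which is 1: the diagonal terms contribute
    e, the N (N + 1) others e / 2 each. *)
Lemma integral_rowproj2 :
  \int[G]_E (rowproj l E ^+ 2)%:E = (2 / (N.+1%:R * N.+2%:R))%:E.
Proof.
have fin : \int[G]_E (rowproj l E ^+ 2)%:E \is a fin_num.
  rewrite -(integral_crat ord0); apply: le1_gauss_fin.
    by apply: measurable_funX; exact: measurable_crat.
  by move=> E; rewrite sqr_ge0 exprn_ile1 ?crat_ge0 ?crat_le1.
have : \int[G]_E (\sum_(i < N.+1) \sum_(j < N.+1) (crat i E * crat j E)%:E) = 1.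
  rewrite -(gaussT R (N.+1 + N.+1)) -[RHS]mul1e -integral_cst//.
  apply: gauss_ae_eq => //.
  - by apply: emeasurable_sum => i; apply: emeasurable_sum => j; exact: measurable_cratM.
  - move=> u; rewrite sume_ge0// => i _; rewrite sume_ge0// => j _.
    by rewrite lee_fin mulr_ge0// crat_ge0.
  - move=> u u0; under eq_bigr do rewrite sumEFin -mulr_sumr sum_crat// mulr1.
    by rewrite sumEFin sum_crat.
rewrite ge0_integral_sum//; last 2 first.
- by move=> i; apply: emeasurable_sum => j; exact: measurable_cratM.
- by move=> i E _; rewrite sume_ge0// => j _; rewrite lee_fin mulr_ge0// crat_ge0.
have E2 (i j : 'I_N.+1) : \int[G]_E (crat i E * crat j E)%:E =
    ((if i == j then 1 else 2^-1) * fine (\int[G]_E (rowproj l E ^+ 2)%:E))%:E.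
  have [<-|ij] := eqVneq i j.
    by rewrite mul1r fineK// -(integral_crat i); apply: eq_integral => E _; rewrite expr2.
  rewrite -(integral_crat_mixed ij) fineM//; last first.
    apply: le1_gauss_fin; first by apply: measurable_funM; exact: measurable_crat.
    by move=> E; rewrite mulr_ge0 ?crat_ge0//= mulr_ile1 ?crat_ge0 ?crat_le1.
  rewrite mulrA mulVf// mul1r fineK//.
  apply: le1_gauss_fin; first by apply: measurable_funM; exact: measurable_crat.
  by move=> E; rewrite mulr_ge0 ?crat_ge0//= mulr_ile1 ?crat_ge0 ?crat_le1.
rewrite -(fineK fin); set c := fine _ => H.
have {}H : (\sum_(i < N.+1) \sum_(j < N.+1) (if i == j then 1 else 2^-1) * c = 1)%R.
  apply: EFin_inj; rewrite -H -sumEFin; apply: eq_bigr => i _.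
  rewrite ge0_integral_sum//; last 2 first.
  - by move=> j; exact: measurable_cratM.
  - by move=> j E _; rewrite lee_fin mulr_ge0// crat_ge0.
  by rewrite -sumEFin; apply: eq_bigr => j _; rewrite E2.
have N1 : (N.+1%:R : R) != 0%R by rewrite pnatr_eq0.
have N2 : (N.+2%:R : R) != 0%R by rewrite pnatr_eq0.
have E3 (i : 'I_N.+1) : (\sum_(j < N.+1) (if i == j then 1 else 2^-1) * c = N.+2%:R / 2 * c)%R.
  rewrite -mulr_suml; congr (_ * _)%R.
  rewrite (bigD1 i)//= eqxx (eq_bigr (fun=> 2^-1))%R; last first.
    by move=> j; rewrite eq_sym => /negbTE ->.
  rewrite sumr_const cardC1 card_ord /= -mulr_natl -(natr1 N.+1) -(natr1 N).
  by field.
move: H; under eq_bigr do rewrite E3.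
rewrite sumr_const card_ord -[(_ / 2 * c *+ _)%R]mulr_natl => H; congr EFin.
apply: (@mulfI _ (N.+1%:R * (N.+2%:R / 2))%R); first by rewrite !mulf_neq0// invr_eq0.
move: (N.+1%:R : R) (N.+2%:R : R) N1 N2 H => a b a0 b0 H.
by rewrite -mulrA H; field; rewrite a0 b0.
Qed.

End FirstTwo.

End Moments.

(** * Law of a ratio of Gaussian determinants *)

Lemma vnsqZ (R : realType) n (c : R[i]) (v : 'cV[R[i]]_n) : vnsq (c *: v) = nsq c * vnsq v.
Proof. by rewrite /vnsq mulr_sumr; apply: eq_bigr => j _; rewrite mxE nsqM. Qed.

Lemma vnsq_functional (R : realType) n (U : 'M[R[i]]_n) (a b : 'rV[R[i]]_n) (c : R[i]) :
  (U^t* *m U = 1%:M -> nsq c = 1 ->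
   (forall v : 'cV_n, (b *m (U *m v)) 0 0 = c * (a *m v) 0 0) ->
  vnsq (b^t*) = vnsq (a^t*))%sesqui.
Proof.
move=> UU c1 ab.
have E : b *m U = c *: a.
  apply/rowP => j; have := ab (delta_mx j 0).
  have colc (A : 'rV_n) : (col j A) 0 0 = A 0 j by rewrite mxE.
  by rewrite mulmxA -!colE !colc => ->; rewrite mxE.
rewrite -(vnsq_unitary (U := (U^t*)%sesqui)); last by rewrite adjmxK (mulmx1C UU).
rewrite -adjmxM E adjmxZ vnsqZ.
have -> : nsq (c^*) = nsq c by case: (c) => x y; rewrite /nsq /= sqrrN.
by rewrite c1 mul1r.
Qed.

Lemma vnsq_orth (R : realType) m n (w : 'cV[R[i]]_n) (A : 'M[R[i]]_(m, n)) (h : 'cV[R[i]]_m) :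
  (A *m w = 0 -> A *m A^t* = 1%:M -> vnsq (w + A^t* *m h) = vnsq w + vnsq h)%sesqui.
Proof.
move=> Aw AA; apply: complexI; rewrite rmorphD /= !vnsqE.
have wA : (w^t* *m A^t* = 0)%sesqui by rewrite -adjmxM Aw trmx0 map_mx0.
rewrite adjmxD adjmxM adjmxK mulmxDl !mulmxDr.
rewrite (mulmxA (w^t*)%sesqui (A^t*)%sesqui) wA mul0mx addr0.
rewrite -(mulmxA (h^t*)%sesqui A w) Aw mulmx0 add0r.
by rewrite -(mulmxA (h^t*)%sesqui A) (mulmxA A) AA mul1mx mxE.
Qed.

Section OrthonormalBlocks.
Variable R : realType.
Local Notation C := R[i].
Local Notation mR := (measurableTypeR R).
Local Notation V N := ((N + N).-tuple mR).
Local Open Scope sesquilinear_scope.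
Variables (K N : nat) (L : 'I_K.+1 -> 'M[C]_(K.+1, N)).
Hypothesis LL : forall i j, L i *m (L j)^t* = if i == j then 1%:M else 0.

(* [hdot z v] is the squared modulus of the determinant of [hmat z] after its
   last column, [hlast z], has been replaced by [v]. *)
Definition hmat (z : 'cV[C]_N) : 'M[C]_K.+1 := \matrix_(a, j) (L j *m z) a 0.
Definition hcof (z : 'cV[C]_N) : 'rV[C]_K.+1 := last_cof (hmat z).
Definition hlast (z : 'cV[C]_N) : 'cV[C]_K.+1 := L ord_max *m z.
Definition hdot (z : 'cV[C]_N) (v : 'cV[C]_K.+1) : R := nsq ((hcof z *m v) 0 0).
Definition hnorm (z : 'cV[C]_N) : R := vnsq ((hcof z)^t*).

Lemma hcof_eq (z w : 'cV[C]_N) :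
  (forall j, j != ord_max -> L j *m z = L j *m w) -> hcof z = hcof w.
Proof. by move=> zw; apply: eq_last_cof => i j jm; rewrite [LHS]mxE [RHS]mxE zw. Qed.

Lemma hdot_last z : hdot z (hlast z) = nsq (\det (hmat z)).
Proof.
rewrite /hdot -det_set_last -[in RHS](set_last_col (hmat z)).
by congr (nsq (\det (set_last _ _))); apply/colP => i; rewrite !mxE.
Qed.

Lemma nsq_det n (U : 'M[C]_n) : U^t* *m U = 1%:M -> nsq (\det U) = 1.
Proof.
move=> UU; apply: complexI; rewrite nsqE.
by have := det1 C n; rewrite -UU det_mulmx det_map_mx det_tr.
Qed.

(** Acts as [X] on every column of [hmat] but the last, and as zero on the orthogonal complement of
    these blocks; by [LL] it is multiplicative in [X]. *)
Definition blocksum (X : 'M[C]_K.+1) : 'M[C]_N :=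
  \sum_(j | j != ord_max) (L j)^t* *m X *m L j.

Lemma L_blocksum i X : L i *m blocksum X = if i != ord_max then X *m L i else 0.
Proof.
rewrite /blocksum mulmx_sumr.
have E j : L i *m ((L j)^t* *m X *m L j) = if i == j then X *m L j else 0.
  by rewrite !mulmxA LL; case: eqP => _; rewrite ?mul1mx// !mul0mx.
under eq_bigr do rewrite E.
case: ifPn => [im|/negPn/eqP ->].
  rewrite (bigD1 i)//= eqxx big1 ?addr0// => j /andP[_ ji].
  by rewrite eq_sym (negbTE ji).
by rewrite big1// => j jm; rewrite eq_sym (negbTE jm).
Qed.

Lemma blocksumM X Y : blocksum X *m blocksum Y = blocksum (X *m Y).
Proof.
rewrite {1}/blocksum mulmx_suml; apply: eq_bigr => j jm.
by rewrite -(mulmxA ((L j)^t* *m X) (L j)) L_blocksum jm !mulmxA.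
Qed.

Lemma blocksum_adj X : (blocksum X)^t* = blocksum (X^t*).
Proof.
rewrite /blocksum linear_sum /= map_mx_sum; apply: eq_bigr => j _.
by rewrite !adjmxM adjmxK mulmxA.
Qed.

Lemma blocksumD X Y : blocksum (X + Y) = blocksum X + blocksum Y.
Proof.
rewrite /blocksum -big_split; apply: eq_bigr => j _ /=.
by rewrite mulmxDr mulmxDl.
Qed.

Lemma blocksum0 : blocksum 0 = 0.
Proof. by rewrite /blocksum big1// => j _; rewrite mulmx0 mul0mx. Qed.

Section Rotate.
Variables (U : 'M[C]_K.+1) (UU : U^t* *m U = 1%:M).

(** Rotates all columns of [hmat] but the last by [U] and fixes the orthogonal complement of those
    blocks. *)
Definition blockrot : 'M[C]_N := 1%:M + blocksum (U - 1%:M).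

Lemma blockrot_unitary : blockrot^t* *m blockrot = 1%:M.
Proof.
rewrite /blockrot adjmxD adjmx1 blocksum_adj mulmxDl mul1mx mulmxDr mulmx1 blocksumM.
rewrite -addrA -!blocksumD adjmxB adjmx1 mulmxBr mulmx1 mulmxBl mul1mx UU.
rewrite (_ : _ + (_ + _) = 0) ?blocksum0 ?addr0//.
by rewrite [U^t* - 1%:M + _]addrC subrK addrA subrK subrr.
Qed.

Lemma L_blockrot i : L i *m blockrot = if i != ord_max then U *m L i else L i.
Proof.
rewrite /blockrot mulmxDr mulmx1 L_blocksum; case: ifP => _; last by rewrite addr0.
by rewrite mulmxBl mul1mx addrC subrK.
Qed.

Lemma hlast_blockrot z : hlast (blockrot *m z) = hlast z.
Proof. by rewrite /hlast mulmxA L_blockrot eqxx. Qed.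

Lemma hcof_blockrot z (v : 'cV[C]_K.+1) : (hcof (blockrot *m z) *m (U *m v)) 0 0 = \det U * (hcof z *m v) 0 0.
Proof.
have -> : hcof (blockrot *m z) = last_cof (U *m hmat z).
  apply: eq_last_cof => i j jm; rewrite [LHS]mxE mulmxA L_blockrot jm -mulmxA.
  by rewrite [LHS]mxE [RHS]mxE; apply: eq_bigr => k _; rewrite [hmat z _ _]mxE.
exact: last_cof_mul.
Qed.

Lemma hdot_blockrot z v : hdot (blockrot *m z) (U *m v) = hdot z v.
Proof. by rewrite /hdot hcof_blockrot nsqM nsq_det// mul1r. Qed.

Lemma hnorm_blockrot z : hnorm (blockrot *m z) = hnorm z.
Proof.
exact: (vnsq_functional UU (nsq_det UU) (hcof_blockrot z)).
Qed.

End Rotate.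

Section Swap.
Local Notation Lm := (L ord_max).

(* This unitary matrix exchanges the last column of [hmat z] with an independent
   vector of the same size. *)
Definition swapmx : 'M[C]_(N + K.+1) := block_mx (1%:M - Lm^t* *m Lm) (Lm^t*) Lm 0.

Lemma LmLm : Lm *m Lm^t* = 1%:M.
Proof. by rewrite LL eqxx. Qed.

Lemma swapmx_unitary : swapmx^t* *m swapmx = 1%:M.
Proof.
have -> : swapmx^t* = swapmx.
  by rewrite /swapmx tr_block_mx map_block_mx adjmxB adjmx1 adjmxM adjmxK trmx0 map_mx0.
rewrite /swapmx mulmx_block !mulmx0 !mul0mx !addr0 LmLm.
rewrite mulmxBl mul1mx mulmxBr mulmx1 mulmxBr mulmx1.
rewrite !mulmxA -[Lm^t* *m Lm *m Lm^t*]mulmxA LmLm mulmx1 mul1mx !subrr subr0 subrK.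
by rewrite mulmxBl mul1mx -mulmxA LmLm mulmx1 subrr -scalar_mx_block.
Qed.

(** This is [z] with the last column of its [hmat] replaced by [h] and its other components kept. *)
Definition newz (z : 'cV[C]_N) (h : 'cV[C]_K.+1) : 'cV[C]_N :=
  z - Lm^t* *m (Lm *m z) + Lm^t* *m h.

Lemma usub_swapmx z h : usubmx (swapmx *m col_mx z h) = newz z h.
Proof. by rewrite mul_block_col col_mxKu mulmxBl mul1mx -mulmxA. Qed.

Lemma hcof_newz z h : hcof (newz z h) = hcof z.
Proof.
apply: hcof_eq => j jm; rewrite /newz mulmxDr mulmxBr !mulmxA LL (negbTE jm).
by rewrite !mul0mx subr0 addr0.
Qed.

Lemma hlast_newz z h : hlast (newz z h) = h.
Proof. by rewrite /hlast /newz mulmxDr mulmxBr !mulmxA LmLm !mul1mx subrr add0r. Qed.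

Lemma vnsq_newz z h : vnsq (newz z h) = vnsq (z - Lm^t* *m (Lm *m z)) + vnsq h.
Proof.
apply: vnsq_orth; last exact: LmLm.
by rewrite mulmxBr !mulmxA LmLm mul1mx subrr.
Qed.

End Swap.

Lemma hdot_newz z h v : hdot (newz z h) v = hdot z v.
Proof. by rewrite /hdot hcof_newz. Qed.

Lemma hnorm_newz z h : hnorm (newz z h) = hnorm z.
Proof. by rewrite /hnorm hcof_newz. Qed.

Lemma hnorm_ge0 z : 0 <= hnorm z.
Proof. exact: vnsq_ge0. Qed.

Lemma hlastE z : hlast z = L ord_max *m z.
Proof. by []. Qed.

Lemma hdotE z v : hdot z v = nsq ((hcof z *m v) 0 0).
Proof. by []. Qed.

Lemma hnorm0_hdot z v : hnorm z = 0 -> hdot z v = 0.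
Proof.
move=> h0; have c0 j : hcof z 0 j = 0.
  have /psumr_eq0P : \sum_i nsq ((hcof z)^t* i 0) = 0 by exact: h0.
  move=> /(_ (fun i _ => nsq_ge0 _)) /(_ j isT).
  have -> : (hcof z)^t* j 0 = (hcof z 0 j)^* by rewrite [in LHS]mxE [in LHS]mxE.
  case: (hcof z 0 j) => a b; rewrite /nsq /= sqrrN => /eqP.
  by rewrite paddr_eq0 ?sqr_ge0// !sqrf_eq0 => /andP[/eqP-> /eqP->].
rewrite hdotE mxE big1 ?/nsq /= ?expr0n ?addr0// => j _.
by rewrite c0 mul0r.
Qed.

Lemma hdotZ z (c : C) v : hdot z (c *: v) = nsq c * hdot z v.
Proof. by rewrite /hdot -scalemxAr mxE nsqM. Qed.

(** Rotate the conjugate cofactor vector onto a multiple of the first basis vector: pairing with it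
    then reads one coordinate. *)
Lemma hdot_rotate z : exists2 U : 'M[C]_K.+1, U^t* *m U = 1%:M &
  forall v, hdot z (U *m v) = hnorm z * nsq (v 0 0).
Proof.
pose s : C := (Num.sqrt (hnorm z))%:C%C.
have [U UU Ue] : exists2 U : 'M[C]_K.+1, U^t* *m U = 1%:M & U *m (hcof z)^t* = s *: delta_mx 0 0.
  apply: unitary_transitive; rewrite vnsqZ.
  rewrite [vnsq (delta_mx _ _)](_ : _ = 1).
    by rewrite mulr1 /nsq /= expr0n addr0 sqr_sqrtr// vnsq_ge0.
  apply: complexI; rewrite vnsqE -colE !mxE eqxx /=.
  by rewrite conjC1.
exists (U^t*); first by rewrite adjmxK (mulmx1C UU).
move=> v; rewrite /hdot mulmxA -[hcof z]adjmxK -adjmxM Ue adjmxZ -scalemxAl mxE nsqM.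
have -> : ((delta_mx 0 0 : 'cV[C]_K.+1)^t* *m v) 0 0 = v 0 0.
  by rewrite trmx_delta map_delta_mx -rowE mxE.
congr (_ * _); rewrite /nsq /= oppr0 expr0n addr0 sqr_sqrtr//; exact: vnsq_ge0.
Qed.

End OrthonormalBlocks.

Section HmatMeasurable.
Variable R : realType.
Local Notation C := R[i].
Local Open Scope sesquilinear_scope.

Lemma mxmeasD d (T : measurableType d) m n (A B : T -> 'M[C]_(m, n)) :
  mxmeas A -> mxmeas B -> mxmeas (fun x => A x + B x).
Proof.
move=> mA mB i j; rewrite (_ : (fun x => _) = (fun x => A x i j + B x i j)).
  exact: cmeasD.
by apply/funext => x; rewrite mxE.
Qed.

Section Fixed.
Context d (T : measurableType d) (K N : nat) (L : 'I_K.+1 -> 'M[C]_(K.+1, N)).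
Variables (z : T -> 'cV[C]_N) (v : T -> 'cV[C]_K.+1).
Hypotheses (mz : mxmeas z) (mv : mxmeas v).

Lemma mxmeas_hmat : mxmeas (fun x => hmat L (z x)).
Proof.
move=> a j; rewrite (_ : (fun x => _) = (fun x => (L j *m z x) a 0)).
  by apply: mxmeasM => //; exact: mxmeas_cst.
by apply/funext => x; rewrite mxE.
Qed.

Lemma mxmeas_hcof : mxmeas (fun x => hcof L (z x)).
Proof.
move=> a j; rewrite (_ : (fun x => _) = (fun x => cofactor (hmat L (z x)) j ord_max)).
  apply: cmeasM; first exact: cmeas_cst.
  apply: cmeas_det => a' j'.
  rewrite (_ : (fun x => _) = (fun x => hmat L (z x) (lift j a') (lift ord_max j'))).
    exact: mxmeas_hmat.
  by apply/funext => x; rewrite [LHS]mxE [LHS]mxE.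
by apply/funext => x; rewrite [LHS]mxE.
Qed.

Lemma measurable_hdot : measurable_fun [set: T] (fun x => hdot L (z x) (v x)).
Proof. by apply: measurable_nsq; apply: mxmeasM => //; exact: mxmeas_hcof. Qed.

Lemma measurable_hnorm : measurable_fun [set: T] (fun x => hnorm L (z x)).
Proof.
rewrite (_ : (fun x => _) = (fun x => \sum_j nsq (hcof L (z x) 0 j))).
  by apply: measurable_sum => j; apply: measurable_nsq; exact: mxmeas_hcof.
apply/funext => x; apply: eq_bigr => j _; rewrite [in LHS]mxE [in LHS]mxE.
by case: (hcof L (z x) 0 j) => a b; rewrite /nsq /= sqrrN.
Qed.

Lemma mxmeas_hlast : mxmeas (fun x => hlast L (z x)).
Proof. by apply: mxmeasM => //; exact: mxmeas_cst. Qed.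

End Fixed.

Lemma mxmeas_newz d (T : measurableType d) K N (L : 'I_K.+1 -> 'M[C]_(K.+1, N))
    (z : T -> 'cV[C]_N) (h : T -> 'cV[C]_K.+1) :
  mxmeas z -> mxmeas h -> mxmeas (fun x => newz L (z x) (h x)).
Proof.
move=> mz mh; rewrite (_ : (fun x => _) =
    (fun x => (1%:M - (L ord_max)^t* *m L ord_max) *m z x + (L ord_max)^t* *m h x)).
  by apply: mxmeasD; apply: mxmeasM => //; exact: mxmeas_cst.
by apply/funext => x; rewrite /newz mulmxBl mul1mx mulmxA.
Qed.

End HmatMeasurable.

Opaque hmat hcof hdot hnorm hlast newz blockrot swapmx.

(** * Rotating one column of a Gaussian matrix given the others *)

Section Core.
Variable R : realType.
Local Notation C := R[i].
Local Notation mR := (measurableTypeR R).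
Local Notation V N := ((N + N).-tuple mR).
Local Notation G N := (gauss R (N + N)).
Local Open Scope sesquilinear_scope.

Lemma integral_gauss_cst d (c : \bar R) : (\int[gauss R d]_u c = c)%E.
Proof.
rewrite (@integral_cst _ _ _ (gauss R d) setT measurableT).
exact: etrans (congr1 (mule c) (gaussT R d)) (mule1 c).
Qed.


Variables (K N : nat) (L : 'I_K.+1 -> 'M[C]_(K.+1, N)).
Hypothesis LL : forall i j, L i *m (L j)^t* = if i == j then 1%:M else 0.

(** Resampling the last column independently does not change the law: adjoin a Gaussian [h], apply
    the unitary [swapmx], and forget the old column. *)
Lemma gauss_swap (f : V N -> \bar R) :
  measurable_fun [set: V N] f -> (forall E, 0 <= f E)%E ->
  (\int[G N]_E f E = \int[G N]_E \int[G K.+1]_h f (vtup (newz L (cvec E) (cvec h))))%E.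
Proof.
move=> mf f0.
pose F (w : V (N + K.+1)) := f (vtup (usubmx (cvec w))).
have mF : measurable_fun [set: V (N + K.+1)] F.
  exact: (measurableT_comp mf (measurableT_comp measurable_fst (@measurable_vuncat R N K.+1))).
have F0 w : (0 <= F w)%E by exact: f0.
transitivity (\int[G N]_E \int[G K.+1]_h F (vcat (E, h)))%E.
  apply: eq_integral => E _; rewrite /F.
  under eq_integral => h _ do rewrite /vcat vtupK /= col_mxKu cvecK.
  by rewrite integral_gauss_cst.
rewrite (gauss_vcat mF F0) -(gauss_unitary (swapmx_unitary LL) mF F0).
have mFs : measurable_fun [set: V (N + K.+1)] (fun w => F (mxact (swapmx L) w)).
  exact: (measurableT_comp mF (measurable_mxact _)).
rewrite -(gauss_vcat mFs (fun w => F0 _)); apply: eq_integral => E _; apply: eq_integral => h _.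
by rewrite /F /mxact /vcat !vtupK usub_swapmx.
Qed.

(** Cross-multiplied lower bound [tau] for the ratio of squared determinants, free of division. The
    factor [vnsq e] makes it independent of the scale of [e], which will become a random vector. *)
Definition det_cond (tau : R) (e : 'cV[C]_K.+1) (z : 'cV[C]_N) : bool :=
  tau * hdot L z e * vnsq z <= hdot L z (hlast L z) * vnsq e.

(** What [det_cond] becomes when the last column is rotated so that only its first entry meets the
    cofactors. *)
Definition coord_cond (tau : R) (e : 'cV[C]_K.+1) (z : 'cV[C]_N) : bool :=
  tau * hdot L z e * vnsq z <= hnorm L z * nsq (hlast L z 0 0) * vnsq e.

Definition ev_det tau e : set (V N) := [set E | det_cond tau e (cvec E)].

Definition ev_coord tau e : set (V N) := [set E | coord_cond tau e (cvec E)].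

Lemma det_cond_newz tau e z h : det_cond tau e (newz L z h) =
  (tau * hdot L z e * (vnsq (z - (L ord_max)^t* *m (L ord_max *m z)) + vnsq h)
   <= hdot L z h * vnsq e).
Proof. by rewrite /det_cond (hlast_newz LL) (vnsq_newz LL) !(hdot_newz LL). Qed.

Lemma coord_cond_newz tau e z h : coord_cond tau e (newz L z h) =
  (tau * hdot L z e * (vnsq (z - (L ord_max)^t* *m (L ord_max *m z)) + vnsq h)
   <= hnorm L z * nsq (h 0 0) * vnsq e).
Proof. by rewrite /coord_cond (hlast_newz LL) (vnsq_newz LL) (hdot_newz LL) (hnorm_newz LL). Qed.

(** Rotating the other columns moves the direction of [e] to that of [g] and leaves the last column
    untouched. *)
Lemma coord_cond_rot tau (e g : 'cV[C]_K.+1) : vnsq e = 1 -> 0 < vnsq g ->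
  exists2 W : 'M[C]_N, W^t* *m W = 1%:M &
    forall z, coord_cond tau g (W *m z) = coord_cond tau e z.
Proof.
move=> e1 g0; pose s : C := (Num.sqrt (vnsq g))%:C%C.
have s2 : nsq s = vnsq g by rewrite /nsq /= expr0n addr0 sqr_sqrtr// ltW.
have [U UU Ue] : exists2 U : 'M[C]_K.+1, U^t* *m U = 1%:M & U *m (s *: e) = g.
  by apply: unitary_transitive; rewrite vnsqZ e1 mulr1.
have WW := blockrot_unitary LL UU; exists (blockrot L U) => // z.
rewrite /coord_cond (vnsq_unitary _ WW) (hlast_blockrot LL) (hnorm_blockrot LL UU) -Ue.
rewrite (hdot_blockrot LL UU) (vnsq_unitary _ UU) vnsqZ e1 s2 !mulr1.
rewrite hdotZ s2.
rewrite (mulrCA tau) -[X in X <= _]mulrA [X in _ <= X]mulrC.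
exact: ler_pM2l.
Qed.

Let mcv M : mxmeas (fun E : V M => cvec E). Proof. by apply: mxmeas_cvec. Qed.

Lemma measurable_ev_det tau e : measurable (ev_det tau e).
Proof.
apply: measurable_le_set.
  apply: measurable_funM; last exact: measurable_vnsq.
  by apply: measurable_funM => //; apply: measurable_hdot => //; exact: mxmeas_cst.
by apply: measurable_funM => //; apply: measurable_hdot => //; exact: mxmeas_hlast.
Qed.

Lemma measurable_ev_coord tau e : measurable (ev_coord tau e).
Proof.
apply: measurable_le_set.
  apply: measurable_funM; last exact: measurable_vnsq.
  by apply: measurable_funM => //; apply: measurable_hdot => //; exact: mxmeas_cst.
apply: measurable_funM => //; apply: measurable_funM; first exact: measurable_hnorm.
by apply: measurable_nsq; apply: mxmeas_hlast.
Qed.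

Lemma eq_indicE (T T' : Type) (A : set T) (B : set T') x y :
  (A x <-> B y) -> (\1_A x : R)%:E = (\1_B y : R)%:E :> \bar R.
Proof.
move=> AB; rewrite !indicE; congr ((_ : bool)%:R%:E).
by apply/idP/idP; rewrite !inE => /AB.
Qed.

(* Given the other columns, the last column may be rotated freely. *)
Lemma gauss_ev_det tau e : G N (ev_det tau e) = G N (ev_coord tau e).
Proof.
rewrite !gauss_indic; [|exact: measurable_ev_coord|exact: measurable_ev_det].
rewrite gauss_swap; [|by apply: measurable_indicE; exact: measurable_ev_det|by []].
rewrite [RHS]gauss_swap; [|by apply: measurable_indicE; exact: measurable_ev_coord|by []].
apply: eq_integral => E _; have [U UU Uh] := hdot_rotate L (cvec E).
have m1 : measurable_fun [set: V K.+1] (fun h =>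
    (\1_(ev_det tau e) (vtup (newz L (cvec E) (cvec h))))%:E : \bar R).
  apply: (measurableT_comp (measurable_indicE (measurable_ev_det tau e))).
  by apply: measurable_vtup; apply: mxmeas_newz => //; exact: mxmeas_cst.
rewrite -(gauss_unitary UU m1); last by [].
apply: eq_integral => h _; apply: eq_indicE; rewrite /ev_det /ev_coord /mkset.
rewrite (vtupK (newz L (cvec E) (cvec (mxact U h)))) (vtupK (newz L (cvec E) (cvec h))).
rewrite det_cond_newz coord_cond_newz [cvec (mxact U h)]vtupK Uh.
by rewrite [X in _ + X]vnsq_unitary.
Qed.

Lemma gauss_ev_coord_rot tau (e g : 'cV[C]_K.+1) : vnsq e = 1 -> 0 < vnsq g ->
  G N (ev_coord tau e) = G N (ev_coord tau g).
Proof.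
move=> e1 g0; have [W WW Wc] := coord_cond_rot tau e1 g0.
rewrite !gauss_indic; [|exact: measurable_ev_coord|exact: measurable_ev_coord].
have mI : measurable_fun [set: V N] (fun E => (\1_(ev_coord tau g) E)%:E : \bar R).
  by apply: measurable_indicE; exact: measurable_ev_coord.
rewrite -(gauss_unitary WW mI); last by [].
apply: eq_integral => E _; apply: eq_indicE; rewrite /ev_coord /mkset.
by rewrite [cvec (mxact W E)]vtupK Wc.
Qed.

End Core.

Section DeterminantTail.
Variable R : realType.
Local Notation C := R[i].
Local Notation mR := (measurableTypeR R).
Local Notation V N := ((N + N).-tuple mR).
Local Notation G N := (gauss R (N + N)).
Local Open Scope sesquilinear_scope.

(** Adds the endpoint x = 1, which can occur when [tau] is 1; there 0 ^ K must be 0, whence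
    [0 < K]. *)
Lemma gauss_first_coord_le K (x : R) : (0 < K)%N -> 0 <= x <= 1 ->
  G K.+1 [set g | nsq (cvec g 0 0) <= x * sqnorm g] = (1 - (1 - x) ^+ K)%:E.
Proof.
move=> K0 /andP[x0]; rewrite le_eqVlt => /predU1P[->|x1]; last first.
  by rewrite gauss_first_coord// x0.
rewrite subrr expr0n eqn0Ngt K0 /= subr0 -(gaussT R (K.+1 + K.+1)).
congr (gauss R _ _); apply/seteqP; split => // g _ /=.
rewrite mul1r sqnorm_cvec /vnsq (bigD1 ord0)//= lerDl.
by apply: sumr_ge0 => j _; exact: nsq_ge0.
Qed.

Lemma rowproj_le1 N (l : 'rV[C]_N.+1) E : vnsq (l^t*) = 1 -> rowproj l E <= 1.
Proof.
move=> l1; have [U UU lU] : exists2 U : 'M[C]_N.+1, U^t* *m U = 1%:M & erow R ord0 *m U = l.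
  by apply: row_unitary; rewrite l1 vnsq_delta.
by rewrite -(rowproj_unitary _ UU lU) -cratE crat_le1.
Qed.

Variables (K N : nat) (L : 'I_K.+1 -> 'M[C]_(K.+1, N.+1)).
Hypothesis LL : forall i j, L i *m (L j)^t* = if i == j then 1%:M else 0.

Definition first_row : 'rV[C]_N.+1 := row 0 (L ord_max).

Lemma first_row1 : vnsq (first_row^t*) = 1.
Proof.
apply: complexI; rewrite vnsqE adjmxK.
transitivity ((L ord_max *m (L ord_max)^t*) 0 0).
  by rewrite !mxE; apply: eq_bigr => k _; rewrite !mxE.
by rewrite LL eqxx mxE eqxx.
Qed.

Lemma hlast0 z : hlast L z 0 0 = (first_row *m z) 0 0.
Proof.
by rewrite hlastE /first_row -row_mul [RHS]mxE.
Qed.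

Hypothesis null : G N.+1 [set E | hnorm L (cvec E) = 0] = 0%E.

(** The probability is the same for all nonzero [e], so [e] may be replaced by an independent
    Gaussian [g]. With [E] fixed, a rotation of [g] reduces its pairing with the cofactors to its
    first coordinate, [hnorm] cancels, and the law of that coordinate applies with x =
    [rowproj first_row E / tau]. *)
Lemma gauss_ev_det_val tau (e : 'cV[C]_K.+1) : (0 < K)%N -> 1 <= tau -> vnsq e = 1 ->
  G N.+1 (ev_det L tau e) =
  (\int[G N.+1]_E (1 - (1 - rowproj first_row E / tau) ^+ K)%:E)%E.
Proof.
move=> K0 tau1 e1; have tau0 : 0 < tau by exact: lt_le_trans tau1.
rewrite gauss_ev_det//.
pose S : set (V N.+1 * V K.+1) := [set p | coord_cond L tau (cvec p.2) (cvec p.1)].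
have mz : mxmeas (fun p : V N.+1 * V K.+1 => cvec p.1) by exact: mxmeas_cvec.
have mg : mxmeas (fun p : V N.+1 * V K.+1 => cvec p.2) by exact: mxmeas_cvec.
have mS : measurable S.
  apply: measurable_le_set.
    apply: measurable_funM; last exact: measurable_vnsq.
    by apply: measurable_funM => //; exact: measurable_hdot.
  apply: measurable_funM; last exact: measurable_vnsq.
  apply: measurable_funM; first exact: measurable_hnorm.
  by apply: measurable_nsq; apply: mxmeas_hlast.
have mI : measurable_fun [set: V N.+1 * V K.+1] (fun p => (\1_S p)%:E : \bar R).
  exact: measurable_indicE.
have mIg : measurable_fun [set: V K.+1] (fun g => \int[G N.+1]_E (\1_S (E, g))%:E)%E.
  by apply: (measurable_fun_fubini_tonelli_G (m1 := G N.+1) (fun p => (\1_S p)%:E)).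
have mIE : measurable_fun [set: V N.+1] (fun E => \int[G K.+1]_g (\1_S (E, g))%:E)%E.
  by apply: (measurable_fun_fubini_tonelli_F (m2 := G K.+1) (fun p => (\1_S p)%:E)).
transitivity (\int[G K.+1]_g \int[G N.+1]_E (\1_S (E, g))%:E)%E.
  (* The constant on the left is averaged over [g], which is nonzero almost surely. *)
  rewrite -[LHS](integral_gauss_cst (K.+1 + K.+1)).
  apply: gauss_ae_eq; [exact: measurable_cst|exact: mIg|by move=> g; exact: measure_ge0| |].
    by move=> g; apply: integral_ge0.
  - move=> g g0'; have g0 : 0 < vnsq (cvec (g : V K.+1)) by rewrite -sqnorm_cvec.
    rewrite (gauss_ev_coord_rot LL tau e1 g0) gauss_indic; last exact: measurable_ev_coord.
    by apply: eq_integral => E _; apply: eq_indicE.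
rewrite -(fubini_tonelli (m1 := G N.+1) (m2 := G K.+1) (fun p => (\1_S p)%:E) mI); last by [].
have mB : measurable [set E : V N.+1 | hnorm L (cvec E) = 0].
  rewrite (_ : [set E | _] = [set E : V N.+1 | hnorm L (cvec E) <= 0]).
    by apply: measurable_le_set => //; apply: measurable_hnorm; exact: mxmeas_cvec.
  apply/seteqP; split => E /= => [->//|h]; apply/eqP; rewrite eq_le h.
  exact: hnorm_ge0.
have x01 E : 0 <= rowproj first_row E / tau <= 1.
  rewrite divr_ge0 ?rowproj_ge0 ?(ltW tau0)//= ler_pdivrMr// mul1r.
  by apply: le_trans tau1; apply: rowproj_le1; exact: first_row1.
apply: ge0_ae_eq_integral => //.
- apply/measurable_EFinP; apply: measurable_funB => //; apply: measurable_funX.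
  by apply: measurable_funB => //; apply: measurable_funM => //; exact: measurable_rowproj.
- by move=> E _; exact: integral_ge0.
- move=> E _; rewrite lee_fin subr_ge0 exprn_ile1//; have /andP[a b] := x01 E.
    by rewrite subr_ge0.
  by rewrite gerBl.
(* Outside this null set both [hnorm] and [sqnorm] can be divided out. *)
exists ([set E : V N.+1 | hnorm L (cvec E) = 0] `|` sqball R (N.+1 + N.+1) 0); split.
- by apply: measurableU => //; exact: measurable_sqball.
- apply: etrans (null : _ = 0%E); apply: measureU0 => //.
    exact: measurable_sqball.
  exact: gauss_point.
move=> E /= nE; have [hE|hE] := pselect (hnorm L (cvec E) = 0); [by left|right].
rewrite /sqball /= leNgt; apply/negP => q0; apply: nE => _.
have hE0 : 0 < hnorm L (cvec E).
  rewrite lt_neqAle eq_sym; apply/andP; split; first exact/eqP.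
  exact: hnorm_ge0.
rewrite -gauss_first_coord_le// gauss_indic; last first.
  apply: measurable_le_set; first exact: measurable_nsq_coord.
  by apply: measurable_funM => //; exact: measurable_sqnorm.
have [U UU Ug] := hdot_rotate L (cvec E).
have mIs : measurable_fun [set: V K.+1] (fun g => (\1_S (E, g))%:E : \bar R).
  exact: (measurableT_comp mI (pair1_measurable E)).
rewrite -(gauss_unitary UU mIs); last by [].
apply: eq_integral => g _; apply: eq_indicE; rewrite /S /mkset /coord_cond.
rewrite [cvec (E, mxact U g).2]vtupK Ug (vnsq_unitary _ UU) hlast0 /= -!sqnorm_cvec.
rewrite /rowproj.
have aux (q b c d h : R) : 0 < q -> 0 < h ->
    (tau * (h * c) * q <= h * d * b) = (c <= d / q / tau * b).
  move=> {}q0 h0; rewrite (_ : tau * (h * c) * q = h * (tau * q * c)); last by ring.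
  rewrite -(mulrA h d b) ler_pM2l// (_ : d / q / tau * b = (d * b) / (tau * q)); last first.
    by field; rewrite !gt_eqF.
  by rewrite ler_pdivlMr ?mulr_gt0// [c * _]mulrC.
by rewrite aux.
Qed.

End DeterminantTail.

Section PowerBounds.
Variable R : realType.

Lemma one_sub_pow_le (K : nat) (y : R) : 0 <= y <= 1 -> 1 - (1 - y) ^+ K <= K%:R * y.
Proof.
move=> /andP[y0 y1]; elim: K => [|K IH]; first by rewrite expr0 subrr mul0r.
have p0 : 0 <= (1 - y) ^+ K by rewrite exprn_ge0// subr_ge0.
have p1 : (1 - y) ^+ K <= 1 by rewrite exprn_ile1// ?subr_ge0// gerBl.
rewrite exprS -natr1; nra.
Qed.

(** Second Bonferroni bound: the induction step subtracts y (1 - (1 - y)^K), bounded by the first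
    order lemma. *)
Lemma one_sub_pow_ge (K : nat) (y : R) : 0 <= y <= 1 ->
  K%:R * y - K%:R * (K%:R - 1) / 2 * y ^+ 2 <= 1 - (1 - y) ^+ K.
Proof.
move=> y01; have /andP[y0 y1] := y01; elim: K => [|K IH].
  by rewrite expr0 subrr !mul0r subrr.
have := one_sub_pow_le K y01.
rewrite (exprS (1 - y)) -natr1; move: IH; set p := (1 - y) ^+ K; set k := K%:R => IH h.
have : y * (1 - p) <= y * (k * y) by rewrite ler_wpM2l.
have -> : (k + 1) * y - (k + 1) * (k + 1 - 1) / 2 * y ^+ 2 =
    (k * y - k * (k - 1) / 2 * y ^+ 2) + (y - y * (k * y)) by field.
have -> : 1 - (1 - y) * p = (1 - p) + (y - y * (1 - p)) by ring.
by move=> h'; apply: lerD => //; rewrite lerD2l lerN2.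
Qed.

End PowerBounds.

Section Bounds.
Variable R : realType.
Local Notation C := R[i].
Local Notation mR := (measurableTypeR R).
Local Notation V N := ((N + N).-tuple mR).
Local Notation G N := (gauss R (N + N)).
Local Open Scope sesquilinear_scope.
Variables (K N : nat) (L : 'I_K.+1 -> 'M[C]_(K.+1, N.+1)).
Hypothesis LL : forall i j, L i *m (L j)^t* = if i == j then 1%:M else 0.
Hypothesis null : G N.+1 [set E | hnorm L (cvec E) = 0] = 0%E.
Variables (tau : R) (e : 'cV[C]_K.+1).
Hypotheses (K0 : (0 < K)%N) (tau1 : 1 <= tau) (e1 : vnsq e = 1).

Local Notation X := (rowproj (first_row L)).

Let tau0 : 0 < tau. Proof. exact: lt_le_trans tau1. Qed.

Let x01 E : 0 <= X E / tau <= 1.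
Proof.
rewrite divr_ge0 ?rowproj_ge0 ?(ltW tau0)//= ler_pdivrMr// mul1r.
by apply: le_trans tau1; apply: rowproj_le1; exact: first_row1.
Qed.

Let mX : measurable_fun [set: V N.+1] X. Proof. exact: measurable_rowproj. Qed.

Let mP : measurable_fun [set: V N.+1] (fun E => 1 - (1 - X E / tau) ^+ K).
Proof.
apply: measurable_funB => //; apply: measurable_funX.
by apply: measurable_funB => //; exact: measurable_funM.
Qed.

Let P0 E : 0 <= 1 - (1 - X E / tau) ^+ K.
Proof.
have /andP[a b] := x01 E.
by rewrite subr_ge0 exprn_ile1// ?subr_ge0// gerBl.
Qed.

Let int1 (c : R) : 0 <= c ->
  (\int[G N.+1]_E (c * X E)%:E = (c * N.+1%:R^-1)%:E)%E.
Proof.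
move=> c0; under eq_integral do rewrite EFinM.
rewrite ge0_integralZl//; [|exact/measurable_EFinP|by move=> E _; rewrite lee_fin rowproj_ge0].
by rewrite integral_rowproj1// first_row1.
Qed.

Let int2 (c : R) : 0 <= c ->
  (\int[G N.+1]_E (c * X E ^+ 2)%:E = (c * (2 / (N.+1%:R * N.+2%:R)))%:E)%E.
Proof.
move=> c0; under eq_integral do rewrite EFinM.
rewrite ge0_integralZl//; [|by apply/measurable_EFinP; exact: measurable_funX|].
  by rewrite integral_rowproj2// first_row1.
by move=> E _; rewrite lee_fin sqr_ge0.
Qed.

Lemma gauss_ev_det_le : (G N.+1 (ev_det L tau e) <= (K%:R / (N.+1%:R * tau))%:E)%E.
Proof.
rewrite gauss_ev_det_val//.
have -> : K%:R / (N.+1%:R * tau) = K%:R / tau * N.+1%:R^-1 :> R.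
  by rewrite invfM mulrCA mulrC -mulrA [_^-1 * _]mulrC mulrA.
rewrite -int1; last by rewrite divr_ge0// ltW.
apply: ge0_le_integral => //.
- by move=> E _; rewrite lee_fin.
- exact/measurable_EFinP.
- by apply/measurable_EFinP; exact: measurable_funM.
- move=> E _; rewrite lee_fin; have /le_trans := one_sub_pow_le K (x01 E); apply.
  rewrite le_eqVlt; apply/orP; left; apply/eqP.
  by move: (X E) (K%:R : R) => a b; ring.
Qed.

Lemma gauss_ev_det_ge :
  ((K%:R / (N.+1%:R * tau) - K%:R * (K%:R - 1) / (N.+1%:R * N.+2%:R * tau ^+ 2))%:E
   <= G N.+1 (ev_det L tau e))%E.
Proof.
rewrite gauss_ev_det_val//.
have I1 : (\int[G N.+1]_E (1 - (1 - X E / tau) ^+ K)%:E \is a fin_num)%E.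
  apply: le1_gauss_fin => // E; rewrite P0 /= gerBl exprn_ge0// subr_ge0.
  by case/andP: (x01 E).
pose c : R := K%:R * (K%:R - 1) / 2 / tau ^+ 2.
have c0 : 0 <= c.
  by rewrite !divr_ge0 ?sqr_ge0// mulr_ge0// subr_ge0 ler1n.
have H : (\int[G N.+1]_E (K%:R / tau * X E)%:E <=
    \int[G N.+1]_E ((1 - (1 - X E / tau) ^+ K) + c * X E ^+ 2)%:E)%E.
  have m2 : measurable_fun [set: V N.+1] (fun E => c * X E ^+ 2).
    by apply: measurable_funM => //; exact: measurable_funX.
  apply: ge0_le_integral => //.
  - by move=> E _; rewrite lee_fin mulr_ge0 ?rowproj_ge0// divr_ge0// ltW.
  - by apply/measurable_EFinP; exact: measurable_funM.
  - by apply/measurable_EFinP; exact: measurable_funD.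
  - move=> E _; rewrite lee_fin -lerBlDr; apply: le_trans (one_sub_pow_ge K (x01 E)).
    rewrite le_eqVlt; apply/orP; left; apply/eqP; rewrite /c.
    by field; rewrite gt_eqF.
move: H; rewrite int1; last by rewrite divr_ge0// ltW.
rewrite ge0_integral_EFinD//; last 2 first.
- by apply: measurable_funM => //; exact: measurable_funX.
- by move=> E; rewrite mulr_ge0// sqr_ge0.
rewrite int2// -(fineK I1) -EFinD !lee_fin => H.
have N1 : (N.+1%:R : R) != 0 by rewrite pnatr_eq0.
have N2 : (N.+2%:R : R) != 0 by rewrite pnatr_eq0.
rewrite lerBlDr; apply: le_trans (_ : K%:R / tau / N.+1%:R <= _).
  by rewrite invfM mulrCA mulrC -mulrA [_^-1 * _]mulrC mulrA.
apply: (le_trans H); rewrite lerD2l le_eqVlt; apply/orP; left; apply/eqP; rewrite /c.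
move: (N.+1%:R : R) (N.+2%:R : R) N1 N2 => a b a0 b0.
by field; rewrite a0 b0 gt_eqF.
Qed.

End Bounds.

(** * Vanishing of minors is a null event *)

Section NullSets.
Variable R : realType.
Local Notation C := R[i].
Local Notation mR := (measurableTypeR R).
Local Notation V N := ((N + N).-tuple mR).
Local Notation G N := (gauss R (N + N)).
Local Open Scope sesquilinear_scope.

Lemma integral_indic_null d0 (T : measurableType d0) (m : {measure set T -> \bar R})
    (A : set T) (f : T -> \bar R) : measurable A -> m A = 0%E ->
  measurable_fun [set: T] f -> (forall x, 0 <= f x)%E ->
  (\int[m]_x ((\1_A x)%:E * f x) = 0)%E.
Proof.
move=> mA A0 mf f0; rewrite -[RHS](integral0 m [set: T]).
have mI := measurable_indicE (R := R) mA.
apply: ge0_ae_eq_integral => //.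
- exact: emeasurable_funM.
- by move=> x _; rewrite mule_ge0// lee_fin.
exists A; split => // x /= Ax; apply: contrapT => nA; apply: Ax => _.
by rewrite indicE memNset// mul0e.
Qed.

Lemma gauss1_null (A : set mR) : measurable A -> @lebesgue_measure R A = 0%E ->
  (\int[gauss1 R]_t (\1_A t)%:E = 0)%E.
Proof.
move=> mA A0; rewrite integral_gauss1//; last exact: measurable_indicE.
apply: integral_indic_null => //.
  apply/measurable_EFinP; apply: measurable_funM => //.
  by do 2!apply: measurableT_comp => //; exact: measurable_funX.
by move=> x; rewrite lee_fin mulr_ge0 ?expR_ge0// ltW// gpeak_gt0.
Qed.

(** Lebesgue measure of [Z] equals the mean over t of that of its translates along [w]; exchanging
    the integrals leaves the sections of [Z] by lines, all null. *)
Lemma gauss_null_line N (Z : set (V N)) (w : 'cV[C]_N) : measurable Z ->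
  (forall z, @lebesgue_measure R [set t : R | Z (vtup (z + t%:C%C *: w))] = 0%E) ->
  G N Z = 0%E.
Proof.
move=> mZ Zw.
have mI : measurable_fun [set: V N] (fun E => (\1_Z E)%:E : \bar R).
  exact: measurable_indicE.
pose F (p : mR * V N) : V N := vtup (cvec p.2 + p.1%:C%C *: w).
have mF : measurable_fun [set: mR * V N] F.
  apply: measurable_vtup => i j.
  rewrite (_ : (fun x => _) = (fun x => cvec x.2 i j + x.1%:C%C * w i j)).
    apply: cmeasD; first exact: mxmeas_cvec.
    by apply: cmeasM; [split => /=; [exact: measurable_fst|exact: measurable_cst]|exact: cmeas_cst].
  by apply/funext => x; rewrite !mxE.
have mIF : measurable_fun [set: mR * V N] (fun p => (\1_Z (F p))%:E : \bar R).
  exact: (measurableT_comp mI mF).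
have lebZ : leb R (N + N) Z = 0%E.
  rewrite -(integral_indicT _ mZ).
  have gT : gauss1 R [set: mR] = 1%E by exact: (@probability_setT _ _ _ (normal_prob 0 _)).
  (* The parameter t is averaged against a probability measure, so a constant keeps its value. *)
  have <- : (\int[gauss1 R]_t (\int[leb R (N + N)]_E (\1_Z E)%:E) = \int[leb R (N + N)]_E (\1_Z E)%:E)%E.
    rewrite integral_cst; last exact: measurableT.
    by apply: etrans (mule1 _); apply: (congr1 (mule _)).
  transitivity (\int[gauss1 R]_t \int[leb R (N + N)]_E (\1_Z (F (t, E)))%:E)%E.
    apply: eq_integral => t _; rewrite -(leb_translation (vtup (t%:C%C *: w)) mI)//.
    by apply: eq_integral => E _; rewrite /F /= vtupD cvecK.
  rewrite (fubini_tonelli (m1 := gauss1 R) (m2 := leb R (N + N)) (fun p => (\1_Z (F p))%:E) mIF); last by [].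
  rewrite (_ : (fun E => _) = cst 0%E) ?integral0//.
  apply/funext => E; apply: (gauss1_null (A := [set t | Z (F (t, E))])).
    rewrite -[X in measurable X]setTI.
    by have := measurableT_comp mF (pair2_measurable E); apply.
  exact: (Zw (cvec E)).
rewrite -(integral_indicT _ mZ) integral_gauss//.
apply: integral_indic_null => //; first exact: measurable_gdens.
by move=> x; rewrite lee_fin gdens_ge0.
Qed.

(** Such t are roots of the characteristic polynomial of -A, hence among the real parts of finitely
    many roots. *)
Lemma shift_singular_null n (A : 'M[C]_n) :
  @lebesgue_measure R [set t : R | \det (A + (t%:C%C)%:M) = 0] = 0%E.
Proof.
apply: countable_lebesgue_measure0; apply: finite_set_countable.
have [s ps] := closed_field_poly_normal (char_poly (- A)).
apply: (@sub_finite_set _ _ [set` map (@complex.Re R) s]); last exact: finite_seq.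
move=> t /= dt; apply/mapP; exists (t%:C%C) => //.
have : root (char_poly (- A)) t%:C%C.
  rewrite /root -[X in _ == X]dt /char_poly -horner_evalE -det_map_mx; apply/eqP.
  congr (\det _); apply/matrixP => i j; rewrite !mxE /horner_eval.
  rewrite -[LHS]/(('X *+ (i == j) - (- A i j)%:P).[t%:C%C]).
  by rewrite !hornerE hornerMn hornerX opprK addrC.
rewrite ps rootZ ?root_prod_XsubC//.
by rewrite (monicP (char_poly_monic _)) oner_eq0.
Qed.

Variables (K N : nat) (L : 'I_K.+1 -> 'M[C]_(K.+1, N)).
Hypothesis LL : forall i j, L i *m (L j)^t* = if i == j then 1%:M else 0.

(* Along this direction the determinants are characteristic polynomials, so each
   line meets the zero set in finitely many points. *)
Lemma hmat_shift z (c : C) :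
  hmat L (z + c *: \sum_j (L j)^t* *m delta_mx j 0) = hmat L z + c%:M.
Proof.
apply/matrixP => a j; rewrite [LHS]mxE [RHS]mxE mulmxDr [LHS]mxE.
apply: f_equal2; first by rewrite [RHS]mxE.
rewrite -scalemxAr mulmx_sumr (bigD1 j)//= big1 ?addr0; last first.
  by move=> i ij; rewrite mulmxA LL eq_sym (negbTE ij) mul0mx.
by rewrite mulmxA LL eqxx mul1mx !mxE eqxx andbT mulr_natr eq_sym.
Qed.

Lemma hcof_last z :
  (hcof L z *m delta_mx ord_max (0 : 'I_1)) 0 0 = \det (row' ord_max (col' ord_max (hmat L z))).
Proof.
rewrite -colE !mxE /cofactor. by rewrite exprD -expr2 sqrr_sign mul1r.
Qed.

Lemma hdot_minor z :
  hdot L z (delta_mx ord_max 0) = nsq (\det (row' ord_max (col' ord_max (hmat L z)))).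
Proof. by rewrite hdotE; congr nsq; exact: hcof_last. Qed.

Lemma measurable_hdot_last :
  measurable [set E : V N | hdot L (cvec E) (delta_mx ord_max 0) = 0].
Proof.
rewrite (_ : [set E | _] = [set E : V N | hdot L (cvec E) (delta_mx ord_max 0) <= 0]).
  apply: measurable_le_set => //; apply: measurable_hdot; first exact: mxmeas_cvec.
  exact: mxmeas_cst.
apply/seteqP; split => E /= => [->//|h]; apply/eqP; rewrite eq_le h hdotE.
exact: nsq_ge0.
Qed.

Lemma null_hdot_last :
  G N [set E | hdot L (cvec E) (delta_mx ord_max 0) = 0] = 0%E.
Proof.
apply: (gauss_null_line (w := \sum_j (L j)^t* *m delta_mx j 0)).
  exact: measurable_hdot_last.
move=> z; pose A := row' ord_max (col' ord_max (hmat L z)).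
rewrite -[RHS](shift_singular_null A); congr (lebesgue_measure _).
have nsq0 (c : C) : (nsq c = 0) <-> (c = 0).
  split=> [|->]; last by rewrite /nsq expr0n addr0.
  case: c => a b; rewrite /nsq /= => /eqP.
  by rewrite paddr_eq0 ?sqr_ge0// !sqrf_eq0 => /andP[/eqP-> /eqP->].
have E t : row' ord_max (col' ord_max (hmat L (z + t%:C%C *: \sum_j (L j)^t* *m delta_mx j 0))) =
    A + (t%:C%C)%:M.
  rewrite hmat_shift; apply/matrixP => i j; rewrite !mxE (inj_eq lift_inj).
  by [].
by apply/seteqP; split => t /=; rewrite vtupK hdot_minor nsq0 E.
Qed.

Lemma null_hnorm : G N [set E | hnorm L (cvec E) = 0] = 0%E.
Proof.
apply/eqP; rewrite eq_le measure_ge0 andbT -null_hdot_last.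
apply: le_measure; rewrite ?inE; last by move=> E /= /hnorm0_hdot ->.
  rewrite (_ : [set E | _] = [set E : V N | hnorm L (cvec E) <= 0]).
    by apply: measurable_le_set => //; apply: measurable_hnorm; exact: mxmeas_cvec.
  apply/seteqP; split => E /= => [->//|h]; apply/eqP; rewrite eq_le h.
  exact: hnorm_ge0.
exact: measurable_hdot_last.
Qed.

End NullSets.

(** * Tail of the ratio on the sphere *)

Section RatioLaw.
Variable R : realType.
Local Notation C := R[i].
Local Notation mR := (measurableTypeR R).
Local Notation V N := ((N + N).-tuple mR).
Local Notation G N := (gauss R (N + N)).
Local Open Scope sesquilinear_scope.

(* With [1 / 0 = 0], the ratio vanishes where its denominator does. *)
Definition hratio K N (L : 'I_K.+1 -> 'M[C]_(K.+1, N)) (z : 'cV[C]_N) : R :=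
  hdot L z (hlast L z) / (hdot L z (delta_mx ord_max 0) * vnsq z).

Lemma hdot_ge0 K N (L : 'I_K.+1 -> 'M[C]_(K.+1, N)) z v : 0 <= hdot L z v.
Proof. by rewrite hdotE nsq_ge0. Qed.

Lemma hmatZ K N (L : 'I_K.+1 -> 'M[C]_(K.+1, N)) z (c : C) : hmat L (c *: z) = c *: hmat L z.
Proof.
apply/matrixP => a j; rewrite [LHS]mxE [RHS]mxE -scalemxAr [LHS]mxE.
by congr (_ * _); rewrite [RHS]mxE.
Qed.

Lemma nsqX (c : C) n : nsq (c ^+ n) = nsq c ^+ n.
Proof.
elim: n => [|n IH]; last by rewrite !exprS nsqM IH.
by rewrite !expr0 /nsq /= expr1n expr0n addr0.
Qed.

Lemma nsq_gt0 (c : C) : c != 0 -> 0 < nsq c.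
Proof.
move=> c0; rewrite lt_neqAle nsq_ge0 andbT eq_sym; apply: contra c0.
case: c => a b; rewrite /nsq paddr_eq0 ?sqr_ge0// !sqrf_eq0 /=.
by move=> /andP[/eqP-> /eqP->].
Qed.

(** Determinants of orders K + 1 and K, with the norm, give total degree 0; so the events below are
    cones. *)
Lemma hratioZ K N (L : 'I_K.+1 -> 'M[C]_(K.+1, N)) z (c : C) : c != 0 ->
  hratio L (c *: z) = hratio L z.
Proof.
move=> c0; rewrite /hratio (hdot_last L z) (hdot_last L (c *: z)).
rewrite (hdot_minor L z) (hdot_minor L (c *: z)) (hmatZ L z c) (vnsqZ c z).
have -> : row' ord_max (col' ord_max (c *: hmat L z)) =
    c *: row' ord_max (col' ord_max (hmat L z)) by apply/matrixP => i j; rewrite !mxE.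
rewrite !detZ !nsqM !nsqX exprS; have := nsq_gt0 c0.
move: (nsq c) => x; move: (nsq (\det _)) (nsq (\det (row' _ _))) (vnsq z) => a b q x0.
have y0 : 0 < x ^+ K by rewrite exprn_gt0.
move: (x ^+ K) y0 => y y0.
rewrite (_ : y * b * (x * q) = (x * y) * (b * q)); last by ring.
by rewrite -mulf_div mulfV ?mul1r// gt_eqF// mulr_gt0.
Qed.

Variables (K N : nat) (L : 'I_K.+1 -> 'M[C]_(K.+1, N.+1)).
Hypothesis LL : forall i j, L i *m (L j)^t* = if i == j then 1%:M else 0.

Let e : 'cV[C]_K.+1 := delta_mx ord_max 0.
Let Z : set (V N.+1) := [set E | hdot L (cvec E) e * vnsq (cvec E) = 0].

Let e1 : vnsq e = 1. Proof.
rewrite /vnsq (bigD1 ord_max)//= big1 => [|j /negbTE jm]; rewrite mxE ?jm ?eqxx /nsq /=.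
  by rewrite expr1n expr0n !addr0.
by rewrite expr0n addr0.
Qed.

Let mZ : measurable Z.
Proof.
have -> : Z = [set E : V N.+1 | hdot L (cvec E) e * vnsq (cvec E) <= 0].
  rewrite /Z; apply/seteqP; split => E /= => [->//|h]; apply/eqP; rewrite eq_le h.
  by rewrite mulr_ge0 ?vnsq_ge0 ?hdot_ge0.
apply: measurable_le_set => //; apply: measurable_funM.
  by apply: measurable_hdot; [exact: mxmeas_cvec|exact: mxmeas_cst].
by apply: measurable_vnsq; exact: mxmeas_cvec.
Qed.

Let Z0 : G N.+1 Z = 0%E.
Proof.
apply/eqP; rewrite eq_le measure_ge0 andbT.
have U0 : G N.+1 ([set E : V N.+1 | hdot L (cvec E) e = 0] `|` sqball R (N.+1 + N.+1) 0) = 0%E.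
  apply: etrans (null_hdot_last LL); apply: measureU0 => //.
  - exact: measurable_hdot_last.
  - exact: measurable_sqball.
  - exact: gauss_point.
rewrite -U0; apply: le_measure; rewrite ?inE//.
  by apply: measurableU; [exact: measurable_hdot_last|exact: measurable_sqball].
move=> E /eqP; rewrite mulf_eq0 => /orP[/eqP|/eqP q0]; [by left|right].
by rewrite /sqball /= sqnorm_cvec q0.
Qed.

(** Where the denominator vanishes, the ratio is 0 and lies below [tau], while [det_cond] holds
    there trivially; hence the removal of the null set [Z]. *)
Lemma hratio_event tau : 0 < tau ->
  [set E : V N.+1 | hratio L (cvec E) < tau] = ~` (ev_det L tau e `\` Z).
Proof.
move=> tau0; apply/seteqP; split=> E; rewrite /Z /hratio -/e /=.
  move=> ht [+ Z1]; have q0 : 0 < hdot L (cvec E) e * vnsq (cvec E).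
    rewrite lt_neqAle eq_sym; apply/andP; split; first exact/eqP.
    by rewrite mulr_ge0 ?vnsq_ge0 ?hdot_ge0.
  rewrite /ev_det /det_cond /= -/e e1 mulr1 -mulrA leNgt => /negP; apply.
  by rewrite -ltr_pdivrMr.
move=> h; have [Z1|/eqP Z1] := pselect (hdot L (cvec E) e * vnsq (cvec E) = 0).
  by rewrite Z1 invr0 mulr0.
rewrite ltNge; apply/negP => ht; apply: h; split; last exact/eqP.
rewrite /ev_det /det_cond /= -/e e1 mulr1 -mulrA -ler_pdivlMr//.
by rewrite lt_neqAle eq_sym Z1 mulr_ge0 ?vnsq_ge0 ?hdot_ge0.
Qed.

Lemma sphere_uniform_hratio tau : 0 < tau ->
  sphere_uniform [set E : V N.+1 | hratio L (cvec E) < tau] =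
  1 - fine (G N.+1 (ev_det L tau e)).
Proof.
move=> tau0.
have mD := measurable_ev_det L tau e.
have mA : measurable [set E : V N.+1 | hratio L (cvec E) < tau].
  by rewrite hratio_event//; apply: measurableC; exact: measurableD.
rewrite sphere_uniformE//; last first.
  move=> s u s0 /=; have -> : cvec (tscale s u : V N.+1) = s%:C%C *: cvec (u : V N.+1).
    apply/colP => j; rewrite !mxE !tnth_mktuple; apply/eqP.
    by rewrite eq_complex /= !mul0r subr0 addr0 !eqxx.
  rewrite hratioZ//; apply/eqP => /(congr1 (@complex.Re R)) /= s00.
  by rewrite s00 ltxx in s0.
rewrite hratio_event// gaussC; last exact: measurableD.
have -> : G N.+1 (ev_det L tau e `\` Z) = G N.+1 (ev_det L tau e).
  have D0 : (G N.+1 (ev_det L tau e) < +oo)%E.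
    by apply: (@le_lt_trans _ _ 1%E); [exact: gauss_le1|exact: ltry].
  apply: (etrans (measureD mD mZ D0)).
  suff h : G N.+1 (ev_det L tau e `&` Z) = 0%E.
    by apply: etrans (sube0 _); apply: (congr1 (fun z => (_ - z)%E)).
  apply/eqP; rewrite eq_le measure_ge0 andbT -Z0; apply: le_measure; rewrite ?inE//.
    exact: measurableI.
by rewrite fineB// gauss_fin.
Qed.

Lemma sphere_uniform_hratio_homo tau tau' : 0 < tau -> tau <= tau' ->
  sphere_uniform [set E : V N.+1 | hratio L (cvec E) < tau] <=
  sphere_uniform [set E : V N.+1 | hratio L (cvec E) < tau'].
Proof.
move=> t0 tt; have t0' := lt_le_trans t0 tt.
rewrite !sphere_uniform_hratio// lerD2l lerN2.
have mD t := measurable_ev_det L t e.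
rewrite fine_le ?gauss_fin//; apply: le_measure; rewrite ?inE//.
move=> E; rewrite /ev_det /det_cond /=; apply: le_trans.
by rewrite ler_wpM2r ?vnsq_ge0// ler_wpM2r// hdot_ge0.
Qed.

Lemma sphere_uniform_hratio_ge tau : (0 < K)%N -> 1 <= tau ->
  1 - K%:R / (N.+1%:R * tau) <=
  sphere_uniform [set E : V N.+1 | hratio L (cvec E) < tau].
Proof.
move=> K0 tau1; rewrite sphere_uniform_hratio ?(lt_le_trans _ tau1)//.
rewrite lerD2l lerN2 -lee_fin fineK ?gauss_fin//; last exact: measurable_ev_det.
by apply: gauss_ev_det_le => //; exact: null_hnorm.
Qed.

Lemma sphere_uniform_hratio_le tau : (0 < K)%N -> 1 <= tau ->
  sphere_uniform [set E : V N.+1 | hratio L (cvec E) < tau] <=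
  1 - (K%:R / (N.+1%:R * tau) - K%:R * (K%:R - 1) / (N.+1%:R * N.+2%:R * tau ^+ 2)).
Proof.
move=> K0 tau1; rewrite sphere_uniform_hratio ?(lt_le_trans _ tau1)//.
rewrite lerD2l lerN2 -lee_fin fineK ?gauss_fin//; last exact: measurable_ev_det.
by apply: gauss_ev_det_ge => //; exact: null_hnorm.
Qed.

End RatioLaw.

Section PositiveDimension.
Variable R : realType.
Local Notation C := R[i].
Local Notation V N := ((N + N).-tuple (measurableTypeR R)).
Local Open Scope sesquilinear_scope.
Variables (K N : nat) (L : 'I_K.+1 -> 'M[C]_(K.+1, N)).
Hypothesis LL : forall i j, L i *m (L j)^t* = if i == j then 1%:M else 0.
Hypotheses (N0 : (0 < N)%N) (K0 : (0 < K)%N).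

Local Notation P tau := (sphere_uniform [set E : V N | hratio L (cvec E) < tau]).

(** The dimension [m.+1 * (p * p)] is not a successor in form, so the three estimates are restated
    for positive [N]. *)
Lemma hratio_law_homo tau tau' : 0 < tau -> tau <= tau' -> P tau <= P tau'.
Proof.
case: N L LL N0 => // N' L' LL' _; exact: sphere_uniform_hratio_homo.
Qed.

Lemma hratio_law_ge tau : 1 <= tau -> 1 - K%:R / (N%:R * tau) <= P tau.
Proof.
case: N L LL N0 => // N' L' LL' _; exact: sphere_uniform_hratio_ge.
Qed.

Lemma hratio_law_le tau : 1 <= tau -> P tau <=
  1 - (K%:R / (N%:R * tau) - K%:R * (K%:R - 1) / (N%:R * N.+1%:R * tau ^+ 2)).
Proof.
case: N L LL N0 => // N' L' LL' _; exact: sphere_uniform_hratio_le.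
Qed.

End PositiveDimension.

(** * Sensitivity of an eigenvalue *)

Section SensitivityMatrix.
Variable R : realType.
Local Notation C := R[i].
Local Notation mR := (measurableTypeR R).
Local Notation V N := ((N + N).-tuple mR).
Local Open Scope sesquilinear_scope.

Lemma sum_mxvec (T : nmodType) m n (F : 'I_(m * n) -> T) :
  \sum_c F c = \sum_i \sum_j F (mxvec_index i j).
Proof.
rewrite pair_bigA /= (reindex _ (curry_mxvec_bij m n)) /=.
by apply: eq_bigr => -[i j] _.
Qed.

Lemma cabsE (z : C) : cabs z = Num.sqrt (nsq z).
Proof. by case: z. Qed.

Lemma sqr_cabs (z : C) : cabs z ^+ 2 = nsq z.
Proof. by rewrite cabsE sqr_sqrtr// nsq_ge0. Qed.

Definition powsum m (lam : C) : R := \sum_(i < m.+1) nsq lam ^+ i.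

Lemma powsum_gt0 m lam : 0 < powsum m lam.
Proof.
rewrite /powsum big_ord_recl expr0 ltr_pwDl//.
by apply: sumr_ge0 => i _; rewrite exprn_ge0// nsq_ge0.
Qed.

Variables (m p K : nat) (lam : C) (X Y : 'M[C]_(p, K.+1)).
Hypotheses (XX : X^t* *m X = 1%:M) (YY : Y^t* *m Y = 1%:M).

Let N := (m.+1 * (p * p))%N.
Let s : C := (Num.sqrt (powsum m lam))^-1%:C%C.

(* [hmat_senmat]: the [j]-th block maps the coordinates of [E] to the [j]-th column
   of [Y^* E(lam) X], normalized so that the blocks are jointly orthonormal. *)
Definition senmat (j : 'I_K.+1) : 'M[C]_(K.+1, N) :=
  \matrix_(r, c) (s * mxvec (\matrix_(i < m.+1, d < p * p)
    (lam ^+ i * mxvec (\matrix_(a < p, b < p) ((Y a r)^* * X b j)) 0 d)) 0 c).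

Let senmat_index j r i a b :
  senmat j r (mxvec_index i (mxvec_index a b)) = s * (lam ^+ i * ((Y a r)^* * X b j)).
Proof. by rewrite !mxE !mxvecE mxE mxvecE mxE. Qed.

Let ss : s^* * s * (powsum m lam)%:C%C = 1.
Proof.
have p0 := powsum_gt0 m lam.
rewrite -nsqE -rmorphM /= /nsq /= expr0n addr0 exprVn sqr_sqrtr ?(ltW p0)//.
by rewrite mulVf// gt_eqF.
Qed.

(** The inner product of two rows factors into [powsum m lam], an entry of the Gram matrix of [Y]
    and one of that of [X]; [s] cancels the first factor. *)
Lemma senmat_orthonormal i j : senmat i *m (senmat j)^t* = if i == j then 1%:M else 0.
Proof.
apply/matrixP => r q; rewrite mxE sum_mxvec.
transitivity (s^* * s * \sum_(l < m.+1) (lam ^+ l)^* * lam ^+ l *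
   ((\sum_a (Y a r)^* * Y a q) * \sum_b (X b j)^* * X b i)).
  rewrite [RHS]mulr_sumr; apply: eq_bigr => l _; rewrite sum_mxvec [X in _ * (_ * X)]mulr_suml !mulr_sumr.
  apply: eq_bigr => a _; rewrite !mulr_sumr; apply: eq_bigr => b _.
  rewrite senmat_index mxE [X in _ * X^*]mxE senmat_index !rmorphM /= conjCK.
  by ring.
have -> : \sum_(l < m.+1) (lam ^+ l)^* * lam ^+ l * ((\sum_a (Y a r)^* * Y a q) * \sum_b (X b j)^* * X b i)
    = (powsum m lam)%:C%C * ((Y^t* *m Y) r q * (X^t* *m X) j i).
  rewrite -mulr_suml; congr (_ * (_ * _)).
  - by rewrite rmorph_sum; apply: eq_bigr => l _; rewrite -nsqE nsqX.
  - by rewrite mxE; apply: eq_bigr => a _; rewrite !mxE.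
  - by rewrite mxE; apply: eq_bigr => a _; rewrite !mxE.
rewrite mulrA ss mul1r XX YY.
by have [->|ij] := eqVneq i j; rewrite !mxE ?eqxx ?mulr1// [j == i]eq_sym (negbTE ij) mulr0.
Qed.

Lemma pert_coordsE (u : V N) (i : 'I_m.+1) a b :
  pert_of_coords (m := m) (p := p) u i a b = cvec u (mxvec_index i (mxvec_index a b)) 0.
Proof. by rewrite !mxE. Qed.

Lemma hmat_senmat (u : V N) : hmat senmat (cvec u) =
  s *: (Y^t* *m pert_eval (pert_of_coords (m := m) (p := p) u) lam *m X).
Proof.
apply/matrixP => r j; rewrite [LHS]mxE [LHS]mxE sum_mxvec.
rewrite /pert_eval mulmx_sumr mulmx_suml scaler_sumr summxE; apply: eq_bigr => i _.
rewrite sum_mxvec -scalemxAr -scalemxAl scalerA mxE mxE mulr_sumr exchange_big /=.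
apply: eq_bigr => b _; rewrite mxE mulr_suml mulr_sumr; apply: eq_bigr => a _.
by rewrite senmat_index -pert_coordsE !mxE; ring.
Qed.

Lemma pert_normE (u : V N) : pert_norm (pert_of_coords (m := m) (p := p) u) ^+ 2 = vnsq (cvec u).
Proof.
have F0 q (A : 'M[C]_q) : 0 <= \sum_i \sum_j cabs (A i j) ^+ 2.
  by apply: sumr_ge0 => i _; apply: sumr_ge0 => j _; rewrite sqr_ge0.
rewrite /pert_norm sqr_sqrtr; last by apply: sumr_ge0 => i _; rewrite sqr_ge0.
rewrite /vnsq [RHS]sum_mxvec; apply: eq_bigr => i _.
rewrite /frobenius_norm sqr_sqrtr// sum_mxvec.
by apply: eq_bigr => a _; apply: eq_bigr => b _; rewrite sqr_cabs pert_coordsE.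
Qed.
End SensitivityMatrix.

Section SensitivityLaw.
Variable R : realType.
Local Notation C := R[i].
Local Notation V N := ((N + N).-tuple (measurableTypeR R)).
Local Open Scope sesquilinear_scope.
Variables (m p k : nat) (P : 'M[{poly C}]_p) (lam : C).
Variables (X Y : 'M[C]_(p, k)) (x y : 'cV[C]_p).

(** The cast from [k + 1] to [k.+1] puts the extra vector in column [ord_max], as [hmat] expects. *)
Definition row_ext (A : 'M[C]_(p, k)) (a : 'cV[C]_p) : 'M[C]_(p, k.+1) :=
  castmx (erefl p, addn1 k) (row_mx A a).

Lemma row_ext_orthonormal A a : (row_mx A a)^t* *m row_mx A a = 1%:M ->
  (row_ext A a)^t* *m row_ext A a = 1%:M.
Proof. by rewrite /row_ext; case: _ / (addn1 k). Qed.

Lemma det_row_ext (E : 'M[C]_p) :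
  \det ((row_mx Y y)^t* *m E *m row_mx X x) = \det ((row_ext Y y)^t* *m E *m row_ext X x).
Proof. by rewrite /row_ext; case: _ / (addn1 k). Qed.

Lemma col'_row_ext A a : col' ord_max (row_ext A a) = A.
Proof.
apply/matrixP => i j; rewrite mxE castmxE /= cast_ord_id.
have -> : cast_ord (esym (addn1 k)) (lift ord_max j) = lshift 1 j.
  by apply: val_inj; rewrite /= /bump leqNgt ltn_ord.
by rewrite row_mxEl.
Qed.

Lemma minor_row_ext (E : 'M[C]_p) :
  row' ord_max (col' ord_max ((row_ext Y y)^t* *m E *m row_ext X x)) = Y^t* *m E *m X.
Proof.
rewrite -[in RHS](col'_row_ext X x) -[in RHS](col'_row_ext Y y).
apply/matrixP => i j; rewrite !mxE; apply: eq_bigr => b _; rewrite !mxE.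
by congr (_ * _); apply: eq_bigr => a _; rewrite !mxE.
Qed.

Local Notation X' := (row_ext X x).
Local Notation Y' := (row_ext Y y).
Local Notation L := (@senmat R m p k lam X' Y').
Local Notation d0 := ((y^t* *m mxeval (mxderiv P) lam *m x) 0 0).

Lemma nsqV (z : C) : nsq z^-1 = (nsq z)^-1.
Proof.
have [->|z0] := eqVneq z 0; first by rewrite !invr0 /nsq expr0n addr0 invr0.
apply: (mulIf (lt0r_neq0 (nsq_gt0 z0))).
rewrite -nsqM (mulVf z0) mulVf ?gt_eqF ?nsq_gt0//.
by rewrite /nsq /= expr1n expr0n addr0.
Qed.

(** The normalization enters k + 1 times in the determinant and k times in the minor, so one factor
    [powsum m lam] survives. *)
Lemma sensitivityE (u : V (m.+1 * (p * p))) :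
  sensitivity P lam X x Y y (pert_of_coords (m := m) (p := p) u) =
  Num.sqrt (powsum m lam / nsq d0 * hratio L (cvec u)).
Proof.
rewrite /sensitivity /hratio hdot_last hdot_minor hmat_senmat.
set E := pert_eval _ _; rewrite det_row_ext.
have -> : row' ord_max (col' ord_max ((Num.sqrt (powsum m lam))^-1%:C%C *: (Y'^t* *m E *m X')))
   = (Num.sqrt (powsum m lam))^-1%:C%C *: (Y^t* *m E *m X).
  by rewrite -minor_row_ext; apply/matrixP => i j; rewrite !mxE.
rewrite !detZ !nsqM !nsqX -(pert_normE u) cabsE.
have -> : nsq ((Num.sqrt (powsum m lam))^-1%:C%C) = (powsum m lam)^-1.
  by rewrite /nsq /= expr0n addr0 exprVn sqr_sqrtr// ltW// powsum_gt0.
have p0 := powsum_gt0 m lam.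
have n0 : 0 <= pert_norm (pert_of_coords (m := m) (p := p) u) by exact: sqrtr_ge0.
rewrite nsqM nsqV nsqM.
move: (pert_norm _) (powsum m lam) (nsq d0) n0 p0 => nu S d nu0 S0.
rewrite -[nu^-1]ger0_norm ?invr_ge0// -sqrtr_sqr -sqrtrM ?sqr_ge0//.
congr Num.sqrt; rewrite (exprVn nu) (exprS S^-1); have : S^-1 ^+ k != 0 by rewrite expf_neq0// invr_eq0 gt_eqF.
move: (S^-1 ^+ k) => sk sk0.
move: (nu ^+ 2) (nsq (\det _)) (nsq (\det _)) => q b a; rewrite !invfM.
move: (d^-1) (b^-1) (q^-1) => d' b' q'.
by field; rewrite sk0 gt_eqF.
Qed.

End SensitivityLaw.

(** * Bounds on the weak condition number *)

Section WeakConditionBounds.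
Variable R : realType.
Local Notation C := R[i].
Local Notation V N := ((N + N).-tuple (measurableTypeR R)).
Local Open Scope sesquilinear_scope.

Lemma sphere_uniform0 d : sphere_uniform (set0 : set (d.-tuple R)) = 0.
Proof.
rewrite /sphere_uniform (_ : [set u | _] = set0); last by apply/seteqP; split => u // -[].
by rewrite lebesgue_volE measure0 mul0r.
Qed.

Lemma sphere_uniformT d : (0 < d)%N -> sphere_uniform [set: d.-tuple R] = 1.
Proof.
case: d => // d _; rewrite sphere_uniformE//.
by apply: (congr1 fine (gaussT R d.+1)).
Qed.

Lemma sqrt_lt_sqr (a t : R) : 0 <= a -> 0 < t -> (Num.sqrt a < t) = (a < t ^+ 2).
Proof.
move=> a0 t0; rewrite -[in RHS](sqr_sqrtr a0) ltr_pXn2r// nnegrE ?sqrtr_ge0//.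
exact: ltW.
Qed.

Variables (m p k : nat) (P : 'M[{poly C}]_p) (lam : C).
Variables (X Y : 'M[C]_(p, k)) (x y : 'cV[C]_p) (delta : R).
Hypotheses (XX : (row_mx X x)^t* *m row_mx X x = 1%:M)
           (YY : (row_mx Y y)^t* *m row_mx Y y = 1%:M).
Hypotheses (p0 : (0 < p)%N) (k0 : (0 < k)%N) (delta0 : 0 < delta) (delta1 : delta < 1).

Local Notation d0 := ((y^t* *m mxeval (mxderiv P) lam *m x) 0 0).
Local Notation N := (m.+1 * (p * p))%N.
Local Notation L := (@senmat R m p k lam (row_ext X x) (row_ext Y y)).
Local Notation sens := (sensitivity (m := m) P lam X x Y y).
Local Notation kappa := (weak_condition m P lam X x Y y delta).

Let N0 : (0 < N)%N. Proof. by rewrite !muln_gt0 p0. Qed.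

Let LL i j : L i *m (L j)^t* = if i == j then 1%:M else 0.
Proof. by apply: senmat_orthonormal; apply: row_ext_orthonormal. Qed.

Let sens_ge0 E : 0 <= sens E.
Proof. by rewrite mulr_ge0 ?invr_ge0 ?sqrtr_ge0// cabsE sqrtr_ge0. Qed.

Let event_le0 t : t <= 0 -> pert_uniform [set E | sens E < t] = 0.
Proof.
move=> t0; rewrite (_ : [set E | _] = set0) ?/pert_uniform ?preimage_set0 ?sphere_uniform0//.
by apply/seteqP; split => E //= /lt_le_trans /(_ t0); rewrite ltNge sens_ge0.
Qed.

Let hratio_ge0 z : 0 <= hratio L z.
Proof. by rewrite divr_ge0 ?mulr_ge0 ?hdot_ge0 ?vnsq_ge0. Qed.

Let event_gt0 t : 0 < t -> d0 != 0 -> pert_uniform [set E | sens E < t] =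
  sphere_uniform [set u : V N | hratio L (cvec u) < t ^+ 2 * nsq d0 / powsum m lam].
Proof.
move=> t0 d00; rewrite /pert_uniform; congr (sphere_uniform _).
have S0 := powsum_gt0 m lam; have D0 := nsq_gt0 d00.
apply/funext => u; apply/propext; rewrite /preimage /= sensitivityE.
rewrite sqrt_lt_sqr//; last by rewrite mulr_ge0// divr_ge0// ltW.
by rewrite mulrAC ltr_pdivrMr// ltr_pdivlMr// [_ * hratio _ _]mulrC.
Qed.

Lemma weak_condition_le tau : d0 != 0 -> 1 <= tau -> k%:R / (N%:R * tau) <= delta ->
  kappa <= Num.sqrt (tau * powsum m lam / nsq d0).
Proof.
move=> d00 tau1 h; have S0 := powsum_gt0 m lam; have D0 := nsq_gt0 d00.
have tau0 : 0 < tau by exact: lt_le_trans tau1.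
rewrite /weak_condition; apply: ge_inf.
  (* The infimum is over a set bounded below by 0: for t <= 0 the event is empty, while 1 - [delta]
     is positive. *)
  exists 0 => t /=; rewrite leNgt => h'; rewrite leNgt; apply/negP => /ltW/event_le0 E.
  by move: h'; rewrite E subr_gt0 delta1.
rewrite /= event_gt0 ?sqrtr_gt0 ?divr_gt0 ?mulr_gt0// sqr_sqrtr ?divr_ge0 ?mulr_ge0 ?(ltW tau0) ?(ltW S0) ?(ltW D0)//.
rewrite divfK ?gt_eqF// mulfK ?gt_eqF//.
by apply: le_trans (hratio_law_ge LL N0 k0 tau1); rewrite lerD2l lerN2.
Qed.

(** Any t below the bound has, by monotonicity, probability less than 1 - [delta]. The alternative 0
    is the default infimum of an empty set. *)
Lemma weak_condition_ge tau : d0 != 0 -> 1 <= tau ->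
  delta < k%:R / (N%:R * tau) - k%:R * (k%:R - 1) / (N%:R * N.+1%:R * tau ^+ 2) ->
  kappa = 0 \/ Num.sqrt (tau * powsum m lam / nsq d0) <= kappa.
Proof.
move=> d00 tau1 h; have S0 := powsum_gt0 m lam; have D0 := nsq_gt0 d00.
have tau0 : 0 < tau by exact: lt_le_trans tau1.
rewrite /weak_condition; set S := [set t | _].
have [S00|/set0P nS] := eqVneq S set0; first by left; rewrite S00 inf0.
right; apply: lb_le_inf => // t St; rewrite leNgt; apply/negP => tt; move: St.
rewrite /S /= leNgt => /negP; apply; have [t0|t0] := leP t 0.
  by rewrite event_le0// subr_gt0.
rewrite event_gt0//; apply: le_lt_trans (_ : _ < 1 - delta).
  apply: (hratio_law_homo LL N0 (tau' := tau)); first by rewrite divr_gt0 ?mulr_gt0 ?exprn_gt0.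
  rewrite ler_pdivrMr// -ler_pdivlMr// ltW//.
  rewrite -(sqr_sqrtr (_ : 0 <= tau * powsum m lam / nsq d0)); last first.
    by rewrite divr_ge0 ?mulr_ge0 ?(ltW tau0) ?(ltW S0) ?(ltW D0).
  by rewrite ltr_pXn2r// nnegrE ?sqrtr_ge0// ltW.
apply: le_lt_trans (hratio_law_le LL N0 k0 tau1) _.
by rewrite ltrD2l ltrN2.
Qed.

(* The sensitivity is then a quotient by zero, which is [0] for every perturbation. *)
Lemma weak_condition_eq0 : d0 = 0 -> kappa = 0.
Proof.
move=> d00; have s0 E : sens E = 0.
  by rewrite /sensitivity d00 mul0r invr0 mulr0 cabsE /nsq /= expr0n addr0 sqrtr0 mulr0.
have eT t : 0 < t -> pert_uniform [set E | sens E < t] = 1.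
  move=> t0; rewrite (_ : [set E | _] = setT) ?/pert_uniform ?preimage_setT ?sphere_uniformT//.
    by rewrite addn_gt0 N0.
  by apply/seteqP; split => // E _ /=; rewrite s0.
rewrite /weak_condition; set S := [set t | _].
have lbS : lbound S 0.
  move=> t; rewrite /S /= leNgt => h'; rewrite leNgt; apply/negP => /ltW/event_le0 E.
  by move: h'; rewrite E subr_gt0 delta1.
have inS t : 0 < t -> S t by move=> t0; rewrite /S /= eT// gerBl ltW.
have nS : S !=set0 by exists 1; exact: inS.
apply/eqP; rewrite eq_le lb_le_inf// andbT leNgt; apply/negP => i0.
have /inS /(ge_inf (ex_intro _ 0 lbS)) : 0 < inf S / 2 by rewrite divr_gt0.
rewrite leNgt => /negP; apply; rewrite ltr_pdivrMr//; lra.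
Qed.

End WeakConditionBounds.

(** * Singular spaces *)

Section SingularSpace.
Variable R : realType.
Local Notation C := R[i].
Local Open Scope sesquilinear_scope.

Lemma mxevalM m n p (A : 'M[{poly C}]_(m, n)) (B : 'M[{poly C}]_(n, p)) z :
  mxeval (A *m B) z = mxeval A z *m mxeval B z.
Proof. exact: map_mxM. Qed.

Lemma mxeval_polyC m n (A : 'M[C]_(m, n)) z : mxeval (map_mx polyC A) z = A.
Proof. by apply/matrixP => i j; rewrite !mxE /horner_eval hornerC. Qed.

Lemma mxfracM m n p (A : 'M[{poly C}]_(m, n)) (B : 'M[{poly C}]_(n, p)) :
  mxfrac (A *m B) = mxfrac A *m mxfrac B.
Proof. exact: map_mxM. Qed.

Lemma mxfrac_eq0 m n (A : 'M[{poly C}]_(m, n)) : mxfrac A = 0 -> A = 0.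
Proof.
move=> /matrixP A0; apply/matrixP => i j; have := A0 i j.
by rewrite !mxE => /eqP; rewrite tofrac_eq0 => /eqP.
Qed.

(** Constant one-sided inverses [U] and [W] turn A(z) into an identity of size its rank. The
    determinant of U A W is a polynomial with value 1 at z, so it is nonzero as a fraction. *)
Lemma rank_mxeval_le m n (A : 'M[{poly C}]_(m, n)) z :
  (\rank (mxeval A z) <= \rank (mxfrac A))%N.
Proof.
set r := \rank (mxeval A z).
set U := pinvmx (col_base (mxeval A z)); set W := pinvmx (row_base (mxeval A z)).
pose D := map_mx polyC U *m A *m map_mx polyC W.
have Dz : mxeval D z = 1%:M.
  have UW : U *m (col_base (mxeval A z) *m row_base (mxeval A z)) *m W = 1%:M.
    have U1 : U *m col_base (mxeval A z) = 1%:M by rewrite mulVpmx ?col_base_full.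
    have W1 : row_base (mxeval A z) *m W = 1%:M by rewrite mulmxVp ?row_base_free.
    by rewrite (mulmxA U) U1 mul1mx W1.
  by rewrite mulmx_base in UW; rewrite !mxevalM !mxeval_polyC UW.
have : \det (mxfrac D) != 0.
  rewrite det_map_mx tofrac_eq0; apply/eqP => D0.
  have := det1 C r; rewrite -Dz det_map_mx D0 rmorph0 => /eqP.
  by rewrite eq_sym oner_eq0.
rewrite -unitfE -/(unitmx _) => /mxrank_unit rD.
apply: leq_trans (eq_leq (esym rD)) _.
by rewrite !mxfracM (leq_trans (mxrankM_maxl _ _))// mxrankM_maxr.
Qed.

Lemma normal_rank_attained p (P : 'M[{poly C}]_p) :
  exists z, \rank (mxeval P z) = normal_rank P.
Proof.
have h : (\rank (mxeval P 0%R) < p.+1)%N by rewrite ltnS rank_leq_row.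
pose Q (k : 'I_p.+1) := `[< exists z : C, \rank (mxeval P z) = k >].
have Q0 : (0 < #|[pred k | Q k]|)%N.
  have Qh : Q (Ordinal h) by rewrite /Q; apply/asboolP; exists 0.
  by apply/card_gt0P; exists (Ordinal h).
have [i Qi E] := eq_bigmax_cond (@nat_of_ord p.+1) Q0.
by have /asboolP[z zi] : Q i by []; exists z; rewrite zi -E.
Qed.

Lemma rank_le_normal_rank p (P : 'M[{poly C}]_p) z :
  (\rank (mxeval P z) <= normal_rank P)%N.
Proof.
have h : (\rank (mxeval P z) < p.+1)%N by rewrite ltnS rank_leq_row.
rewrite /normal_rank -[X in (X <= _)%N]/(nat_of_ord (Ordinal h)).
apply: leq_bigmax_cond => /=.
by apply/asboolP; exists z.
Qed.

(** Turns the definition through minimal bases into a polynomial vector killed by [P], a form that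
    can be differentiated or lifted to the companion matrix. *)
Lemma ker_at_eval p (P : 'M[{poly C}]_p) l0 (v : 'cV[C]_p) : ker_at P l0 v ->
  exists2 V : 'cV[{poly C}]_p, P *m V = 0 & mxeval V l0 = v.
Proof.
case=> B [[[_ rB] _] [c _ <-]]; exists (B *m map_mx polyC c).
  apply: mxfrac_eq0; rewrite !mxfracM mulmxA.
  suff -> : mxfrac P *m mxfrac B = 0 by rewrite mul0mx.
  apply/matrixP => i j; rewrite [RHS]mxE.
  have : singular_space P (col j (mxfrac B)).
    by rewrite -rB; exists (delta_mx j 0) => //; rewrite -colE.
  rewrite /singular_space /= colE mulmxA -colE => /matrixP/(_ i 0).
  by rewrite !mxE.
by rewrite mxevalM mxeval_polyC.
Qed.

(* Otherwise a value outside the range of [X] would give [k + 1] independent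
   elements of the singular space, whose dimension is [p - normal_rank P]. *)
Lemma eval_in_range p k (P : 'M[{poly C}]_p) l0 (X : 'M[C]_(p, k)) (V : 'cV[{poly C}]_p) :
  (p <= k + normal_rank P)%N -> col_basis X (ker_at P l0) -> P *m V = 0 ->
  col_range X (mxeval V l0).
Proof.
move=> pk [rX XE] PV.
have [W PW WX] : exists2 W : 'M[{poly C}]_(p, k), P *m W = 0 & mxeval W l0 = X.
  have H j : exists w : 'cV[{poly C}]_p, P *m w = 0 /\ mxeval w l0 = col j X.
    have : ker_at P l0 (col j X).
      by rewrite -XE; exists (delta_mx j 0) => //; rewrite -colE.
    by move=> /ker_at_eval[w Pw <-]; exists w.
  have [w wP] := choice H; exists (\matrix_(i, j) w j i 0).
    apply/matrixP => i j; have [/matrixP/(_ i 0) + _] := wP j.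
    by rewrite !mxE => h; rewrite -[RHS]h; apply: eq_bigr => l _; rewrite mxE.
  apply/matrixP => i j; have [_ /matrixP/(_ i 0)] := wP j.
  by rewrite !mxE.
pose B : 'M[{poly C}]_(p, k + 1) := row_mx W V.
have PB : mxfrac P *m mxfrac B = 0.
  by rewrite -mxfracM /B mul_mx_row PW PV row_mx0 /mxfrac map_mx0.
have rB : (\rank (mxeval B l0) <= k)%N.
  rewrite (leq_trans (rank_mxeval_le _ _))//.
  have := mulmx0_rank_max PB; have [z rz] := normal_rank_attained P.
  have := rank_mxeval_le P z; rewrite rz => h1 h2.
  by rewrite -(leq_add2l (normal_rank P)) (leq_trans _ (leq_trans pk _)) ?[(k + _)%N]addnC// (leq_trans _ h2)// leq_add2r.
have XB : ((row_mx X (mxeval V l0))^T <= X^T)%MS.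
  have XB : (X^T <= (row_mx X (mxeval V l0))^T)%MS by rewrite tr_row_mx -addsmxE addsmxSl.
  have [h1 h2] := mxrank_leqif_sup XB; rewrite -h2 eqn_leq h1 !mxrank_tr rX.
  have <- : mxeval B l0 = row_mx X (mxeval V l0) by rewrite /mxeval map_row_mx -WX.
  exact: rB.
have : ((mxeval V l0)^T <= X^T)%MS.
  by apply: submx_trans XB; rewrite tr_row_mx -addsmxE addsmxSr.
move=> /submxP[D VD]; exists D^T => //.
by rewrite -[RHS]trmxK VD trmx_mul trmxK.
Qed.

End SingularSpace.

Section LeftSingularSpace.
Variable R : realType.
Local Notation C := R[i].
Local Open Scope sesquilinear_scope.

Definition polyadj m n (A : 'M[{poly C}]_(m, n)) : 'M[{poly C}]_(n, m) :=
  map_mx (map_poly (@Num.conj C)) A^T.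

Lemma polyadjM m n p (A : 'M[{poly C}]_(m, n)) (B : 'M[{poly C}]_(n, p)) :
  polyadj (A *m B) = polyadj B *m polyadj A.
Proof. by rewrite /polyadj trmx_mul map_mxM. Qed.

Lemma polyadjK m n (A : 'M[{poly C}]_(m, n)) : polyadj (polyadj A) = A.
Proof.
by apply/matrixP => i j; rewrite !mxE; apply/polyP => k; rewrite !coef_map /= conjCK.
Qed.

Lemma mxeval_polyadj m n (A : 'M[{poly C}]_(m, n)) z :
  mxeval (polyadj A) (z^*) = (mxeval A z)^t*.
Proof. by apply/matrixP => i j; rewrite !mxE /horner_eval horner_map. Qed.

Lemma normal_rank_adj p (P : 'M[{poly C}]_p) :
  (normal_rank P <= normal_rank (mxpoly_adj P))%N.
Proof.
have [z <-] := normal_rank_attained P.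
rewrite -(mxrank_tr (mxeval P z)) -(mxrank_map (@Num.conj C)).
by rewrite -mxeval_polyadj; exact: rank_le_normal_rank.
Qed.

Lemma left_ker_at_eval p (P : 'M[{poly C}]_p) l0 (u : 'cV[C]_p) : left_ker_at P l0 u ->
  exists2 W : 'rV[{poly C}]_p, W *m P = 0 & mxeval W l0 = u^t*.
Proof.
move=> /ker_at_eval[V PV Vu]; exists (polyadj V).
  rewrite -[P]polyadjK -polyadjM.
  have -> : polyadj P *m V = 0 by exact: PV.
  by apply/matrixP => i j; rewrite !mxE rmorph0.
by rewrite -[l0]conjCK mxeval_polyadj Vu.
Qed.

Lemma left_eval_in_range p k (P : 'M[{poly C}]_p) l0 (Y : 'M[C]_(p, k)) (W : 'rV[{poly C}]_p) :
  (p <= k + normal_rank P)%N -> col_basis Y (left_ker_at P l0) -> W *m P = 0 ->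
  col_range Y ((mxeval W l0)^t*).
Proof.
move=> pk YB WP; rewrite -mxeval_polyadj; apply: (eval_in_range _ YB).
  by rewrite (leq_trans pk)// leq_add2l normal_rank_adj.
rewrite -[mxpoly_adj P]/(polyadj P) -polyadjM WP.
by apply/matrixP => i j; rewrite !mxE rmorph0.
Qed.

(** Differentiate the identity W P = 0. *)
Lemma mxderiv_horner n p (W : 'rV[{poly C}]_n) (P : 'M[{poly C}]_(n, p)) z : W *m P = 0 ->
  mxeval W z *m mxeval (mxderiv P) z = - (mxeval (mxderiv W) z *m mxeval P z).
Proof.
move=> WP; apply/eqP; rewrite -addr_eq0; apply/eqP/matrixP => i j.
have /matrixP/(_ i j)/(congr1 (fun q : {poly C} => q^`().[z])) := WP.
rewrite !mxE deriv0 horner0 => E; apply: etrans E; rewrite -big_split /= (raddf_sum (@deriv C)) horner_sum.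
apply: eq_bigr => l _; rewrite !mxE /horner_eval. rewrite /= derivM hornerD !hornerM addrC.
by [].
Qed.
End LeftSingularSpace.

(** * Rank and kernels of the companion form *)

Section Companion.
Variable R : realType.
Local Notation C := R[i].
Local Open Scope sesquilinear_scope.
Variables (n : nat) (M D K : 'M[C]_n).
Local Notation Q := (quadratic_poly M D K).
Local Notation C1 := (companion1 M D K).

Lemma mxeval_quadratic z : mxeval Q z = z ^+ 2 *: M + z *: D + K.
Proof.
by apply/matrixP => i j; rewrite !mxE /horner_eval !hornerE.
Qed.

Lemma mxeval_deriv_quadratic z : mxeval (mxderiv Q) z = (2 * z) *: M + D.
Proof.
apply/matrixP => i j; rewrite !mxE /horner_eval !derivD !derivM !derivX !derivC.
rewrite !(mul1r, mulr1, mulr0, addr0) hornerD hornerM hornerD hornerX !hornerC.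
by rewrite mulr_natl mulr2n.
Qed.

Lemma mxeval_companion z : mxeval C1 z = block_mx (z *: M + D) K (- 1%:M) (z%:M).
Proof.
have -> : mxeval C1 z = z *: block_mx M 0 0 1%:M + block_mx D K (- 1%:M) 0.
  rewrite /companion1; move: (block_mx _ _ _ _) (block_mx _ _ _ _) => A B.
  by apply/matrixP => i j; rewrite !mxE /horner_eval !hornerE.
by rewrite scale_block_mx add_block_mx !scaler0 !add0r addr0 scalemx1.
Qed.

Lemma mxeval_deriv_companion z : mxeval (mxderiv C1) z = block_mx M 0 0 1%:M.
Proof.
rewrite -(mxeval_polyC (block_mx M 0 0 1%:M) z); congr (mxeval _ z).
rewrite /companion1; move: (block_mx _ _ _ _) (block_mx _ _ _ _) => A B.
apply/matrixP => i j; rewrite !mxE derivD derivM derivX !derivC.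
by rewrite mulr0 !addr0 mul1r.
Qed.

(** The invertible [U] and [W] reduce C1(z) to the block diagonal matrix of Q(z) and -1. *)
Lemma rank_companion z : \rank (mxeval C1 z) = (n + \rank (mxeval Q z))%N.
Proof.
rewrite mxeval_companion mxeval_quadratic.
pose U : 'M[C]_(n + n) := block_mx 1%:M (z *: M + D) 0 1%:M.
pose W : 'M[C]_(n + n) := block_mx z%:M 1%:M 1%:M 0.
have UU : row_free U^T.
  by rewrite row_free_unit unitmx_tr unitmxE det_ublock !det1 mulr1 unitr1.
have WW : row_free W.
  apply/row_freeP; exists (block_mx 0 1%:M 1%:M (- z%:M)).
  by rewrite mulmx_block !mul0mx !mulmx0 !mulmx1 !mul1mx !add0r !addr0 subrr -scalar_mx_block.
rewrite -(mxrankMfree _ WW) -mxrank_tr -(mxrankMfree _ UU) -trmx_mul mxrank_tr.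
have -> : U *m (block_mx (z *: M + D) K (- 1%:M) z%:M *m W) =
    block_mx (K + (z *: M + D) *m z%:M) 0 0 (- 1%:M).
  rewrite /U /W; move: (z *: M + D) => B; rewrite mulmx_block mulNmx !(mul1mx, mulmx1) addNr.
  rewrite (mulmx0 _ K) (mulmx0 _ z%:M) !addr0 mulmx_block !mul1mx (mulmx0 _ B) addr0.
  by rewrite mulmxN mulmx1 subrr !mul0mx !add0r [K + _]addrC.
rewrite rank_diag_block_mx.
rewrite (eqmx_opp 1%:M) mxrank1 addnC; congr (n + \rank _)%N.
by rewrite mul_mx_scalar scalerDr scalerA -expr2 addrC.
Qed.

Lemma normal_rank_companion : normal_rank C1 = (n + normal_rank Q)%N.
Proof.
apply/eqP; rewrite eqn_leq; apply/andP; split.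
  have [z <-] := normal_rank_attained C1.
  by rewrite rank_companion leq_add2l rank_le_normal_rank.
have [z <-] := normal_rank_attained Q.
by rewrite -rank_companion rank_le_normal_rank.
Qed.

Let MP := map_mx (@polyC C) M.
Let DP := map_mx (@polyC C) D.
Let KP := map_mx (@polyC C) K.

Let C1E : C1 = block_mx ('X *: MP + DP) KP (- 1%:M) ('X%:M).
Proof.
rewrite /companion1 !map_block_mx !map_mx0 map_mxN !map_mx1.
by rewrite scale_block_mx add_block_mx !scaler0 !add0r addr0 scalemx1.
Qed.

Lemma companion_right (V : 'cV[{poly C}]_n) : Q *m V = 0 ->
  C1 *m col_mx ('X *: V) V = 0.
Proof.
move=> QV; rewrite C1E mul_block_col mulNmx mul1mx mul_scalar_mx addNr.
apply/eqP; rewrite col_mx_eq0 eqxx andbT; apply/eqP.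
rewrite -[RHS]QV /quadratic_poly !mulmxDl -!scalemxAr -!scalemxAl.
by rewrite scalerA -expr2.
Qed.

Lemma companion_left (W : 'rV[{poly C}]_n) : W *m Q = 0 ->
  row_mx W (W *m ('X *: MP + DP)) *m C1 = 0.
Proof.
move=> WQ; rewrite C1E mul_row_block mulmxN mulmx1 subrr.
apply/eqP; rewrite row_mx_eq0 eqxx /=; apply/eqP.
rewrite -[RHS]WQ /quadratic_poly mul_mx_scalar !mulmxDr scalerDr -!scalemxAr.
by rewrite scalerA -expr2 addrC.
Qed.

End Companion.

(** * Spectral norm *)

Section SpectralNorm.
Variable R : realType.
Local Notation C := R[i].
Local Open Scope sesquilinear_scope.

Lemma vnsq0 n : vnsq (0 : 'cV[C]_n) = 0.
Proof. by rewrite /vnsq big1 // => j _; rewrite mxE /nsq expr0n addr0. Qed.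

Lemma vnsq_eq0P n (u : 'cV[C]_n) : vnsq u = 0 -> u = 0.
Proof.
move=> u0; apply/eqP; rewrite -vnsq_eq0; apply/eqP/matrixP => i j.
by rewrite !ord1 -vnsqE u0 mxE.
Qed.

(** Times |u|^2, the difference is the squared norm of |u|^2 v - (u, v) u. *)
Lemma cauchy_schwarz n (u v : 'cV[C]_n) : nsq (ip u v) <= vnsq u * vnsq v.
Proof.
have [u0|u0] := eqVneq (vnsq u) 0.
  by rewrite (vnsq_eq0P u0) vnsq0 mul0r /ip trmx0 map_mx0 mul0mx mxE /nsq expr0n addr0.
have {}u0 : 0 < vnsq u by rewrite lt_neqAle eq_sym u0 vnsq_ge0.
rewrite -subr_ge0 -(pmulr_rge0 _ u0).
suff -> : vnsq u * (vnsq u * vnsq v - nsq (ip u v)) =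
    vnsq ((vnsq u)%:C%C *: v - ip u v *: u) by exact: vnsq_ge0.
apply: complexI; rewrite -[RHS]ip_vnsq ipBl !ipBr !ipZl !ipZr (ip_conj v u) !ip_vnsq.
rewrite rmorphM rmorphB rmorphM /= nsqE.
have -> : ((vnsq u)%:C%C)^* = (vnsq u)%:C%C by apply/CrealP; rewrite complex_real.
by ring.
Qed.

Lemma vnsqD n (u v : 'cV[C]_n) :
  vnsq (u + v) = vnsq u + vnsq v + 2 * complex.Re (ip u v).
Proof.
rewrite /vnsq /ip mxE raddf_sum mulr_sumr -!big_split /=; apply: eq_bigr => j _.
rewrite !mxE; case: (u j 0) (v j 0) => [a b] [c d]; rewrite /nsq /=; ring.
Qed.

Lemma vnsqD_le n (u v : 'cV[C]_n) (a b : R) : 0 <= a -> 0 <= b ->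
  vnsq u <= a ^+ 2 -> vnsq v <= b ^+ 2 -> vnsq (u + v) <= (a + b) ^+ 2.
Proof.
move=> a0 b0 ua vb; rewrite vnsqD sqrrD.
have h : complex.Re (ip u v) <= a * b.
  apply: le_trans (ler_norm _) _.
  rewrite -ler_sqr ?nnegrE ?mulr_ge0// -normrX ger0_norm ?sqr_ge0// exprMn.
  apply: le_trans (ler_pM (vnsq_ge0 _) (vnsq_ge0 _) ua vb).
  by apply: le_trans (cauchy_schwarz u v); rewrite /nsq lerDl sqr_ge0.
rewrite -mulr_natl; lra.
Qed.

Lemma frobenius_colE n (v : 'cV[C]_n) : frobenius_norm v = Num.sqrt (vnsq v).
Proof.
congr Num.sqrt; apply: eq_bigr => i _; rewrite big_ord1 sqr_cabs.
by [].
Qed.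

Let row_sum m n (A : 'M[C]_(m, n)) : R := \sum_i vnsq ((row i A)^t*).

Lemma vnsq_mulmx_le m n (A : 'M[C]_(m, n)) v : vnsq (A *m v) <= row_sum A * vnsq v.
Proof.
rewrite /vnsq mulr_suml; apply: ler_sum => i _.
apply: le_trans (cauchy_schwarz ((row i A)^t*) v).
by rewrite /ip adjmxK -row_mul [X in _ <= nsq X]mxE.
Qed.

(** The supremum is an upper bound only for a bounded set; the Frobenius norm bounds it. *)
Let spectral_ub m n (A : 'M[C]_(m, n)) :
  has_ubound [set frobenius_norm (A *m v) | v in [set v : 'cV[C]_n | frobenius_norm v <= 1]].
Proof.
exists (Num.sqrt (row_sum A)) => _ [w /= w1 <-]; rewrite frobenius_colE ler_wsqrtr//.
apply: le_trans (vnsq_mulmx_le A w) _; rewrite ler_piMr//.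
  by apply: sumr_ge0 => i _; exact: vnsq_ge0.
move: w1; rewrite frobenius_colE => w1.
by rewrite -(sqr_sqrtr (vnsq_ge0 w)) exprn_ile1// sqrtr_ge0.
Qed.

Lemma spectral_norm_ge0 m n (A : 'M[C]_(m, n)) : 0 <= spectral_norm A.
Proof.
apply: le_trans (_ : frobenius_norm (A *m (0 : 'cV_n)) <= _); first exact: sqrtr_ge0.
apply: ub_le_sup; first exact: spectral_ub.
by exists 0 => //=; rewrite frobenius_colE vnsq0 sqrtr0.
Qed.

Lemma vnsq_spectral m n (A : 'M[C]_(m, n)) v :
  vnsq (A *m v) <= spectral_norm A ^+ 2 * vnsq v.
Proof.
have [v0|v0] := eqVneq (vnsq v) 0.
  by rewrite (vnsq_eq0P v0) mulmx0 !vnsq0 mulr0.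
have {}v0 : 0 < vnsq v by rewrite lt_neqAle eq_sym v0 vnsq_ge0.
rewrite -ler_pdivrMr//.
pose r := Num.sqrt (vnsq v); have r0 : 0 < r by rewrite sqrtr_gt0.
have r2 : r ^+ 2 = vnsq v by rewrite sqr_sqrtr// ltW.
have nr : nsq ((r^-1)%:C%C) = (vnsq v)^-1.
  by rewrite /nsq /= expr0n addr0 exprVn r2.
have F : frobenius_norm (A *m ((r^-1)%:C%C *: v)) <= spectral_norm A.
  apply: ub_le_sup; last first.
    exists ((r^-1)%:C%C *: v) => //=.
    by rewrite frobenius_colE vnsqZ nr mulVf ?sqrtr1// gt_eqF.
  exact: spectral_ub.
have -> : vnsq (A *m v) / vnsq v = frobenius_norm (A *m ((r^-1)%:C%C *: v)) ^+ 2.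
  by rewrite frobenius_colE sqr_sqrtr ?vnsq_ge0// -scalemxAr vnsqZ nr mulrC.
by rewrite ler_sqr// nnegrE ?sqrtr_ge0//; apply: le_trans F; rewrite sqrtr_ge0.
Qed.

(** For w the adjoint applied to y, |w|^2 = (y, A w); Cauchy-Schwarz and the bound for A give |w|^4
    <= |y|^2 |A|^2 |w|^2. *)
Lemma vnsq_spectral_adj m n (A : 'M[C]_(m, n)) (y : 'cV[C]_m) :
  vnsq (A^t* *m y) <= spectral_norm A ^+ 2 * vnsq y.
Proof.
set w := A^t* *m y; have [w0|w0] := eqVneq (vnsq w) 0.
  by rewrite w0 mulr_ge0 ?sqr_ge0 ?vnsq_ge0.
have {}w0 : 0 < vnsq w by rewrite lt_neqAle eq_sym w0 vnsq_ge0.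
rewrite -(ler_pM2r w0) -mulrA [vnsq y * _]mulrC mulrA.
have -> : vnsq w * vnsq w = nsq (ip y (A *m w)).
  have -> : ip y (A *m w) = ip w w by rewrite /ip mulmxA {2}/w adjmxM adjmxK.
  by rewrite ip_vnsq /nsq /= expr0n addr0 expr2.
apply: le_trans (cauchy_schwarz _ _) _; rewrite mulrC ler_wpM2r ?vnsq_ge0//.
exact: vnsq_spectral.
Qed.

End SpectralNorm.

(** * Eigenvectors of the companion form *)

Section Orthonormal.
Variable R : realType.
Local Notation C := R[i].
Local Open Scope sesquilinear_scope.
Variables (p k : nat) (X : 'M[C]_(p, k)) (x : 'cV[C]_p).
Hypothesis XX : (row_mx X x)^t* *m row_mx X x = 1%:M.

Lemma row_mx_adj : (row_mx X x)^t* = col_mx (X^t*) (x^t*).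
Proof. by rewrite tr_row_mx map_col_mx. Qed.

Lemma orthonormal_blocks : [/\ X^t* *m x = 0, x^t* *m X = 0 & vnsq x = 1].
Proof.
move: XX; rewrite row_mx_adj mul_col_row scalar_mx_block.
move=> /eq_block_mx[_ -> -> h]; split => //.
by apply: complexI; rewrite vnsqE h mxE.
Qed.

Lemma span_last (A : 'M[C]_p) : col_basis (row_mx X x) [set v | A *m v = 0] -> A *m x = 0.
Proof.
move=> [_ XE]; suff : [set v | A *m v = 0] x by [].
rewrite -XE; exists (col_mx 0 1%:M) => //.
by rewrite mul_row_col mulmx0 mulmx1 add0r.
Qed.

Lemma span_decomp (A : 'M[C]_p) v : col_basis (row_mx X x) [set v | A *m v = 0] ->
  A *m v = 0 -> exists c, exists a : C, v = X *m c + a *: x.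
Proof.
move=> [_ XE] Av; have : [set v | A *m v = 0] v by [].
rewrite -XE => -[c _ <-]; exists (usubmx c), (dsubmx c 0 0).
rewrite -[in LHS](vsubmxK c) mul_row_col; congr (_ + _).
by rewrite -mul_mx_scalar -mx11_scalar.
Qed.

End Orthonormal.

Section KeyInequality.
Variable R : realType.
Local Notation C := R[i].
Local Open Scope sesquilinear_scope.

Lemma ip_col_mx m n (u u' : 'cV[C]_m) (v v' : 'cV[C]_n) :
  ip (col_mx u v) (col_mx u' v') = ip u u' + ip v v'.
Proof. by rewrite /ip tr_col_mx map_row_mx mul_row_col mxE. Qed.

Lemma ipDr n (u v w : 'cV[C]_n) : ip u (v + w) = ip u v + ip u w.
Proof. by rewrite /ip mulmxDr mxE. Qed.

Variables (n k k1 : nat) (M D K : 'M[C]_n) (l0 : C).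
Local Notation Q := (quadratic_poly M D K).
Local Notation C1 := (companion1 M D K).
Local Notation B := (l0 *: M + D).
Variables (X : 'M[C]_(n, k)) (x : 'cV[C]_n) (Y : 'M[C]_(n, k)) (y : 'cV[C]_n).
Variables (X1 : 'M[C]_(n + n, k1)) (x1 : 'cV[C]_(n + n)).
Variables (Y1 : 'M[C]_(n + n, k1)) (y1 : 'cV[C]_(n + n)).
Hypotheses (bQ : adapted_bases Q l0 X x Y y) (bC : adapted_bases C1 l0 X1 x1 Y1 y1).
Hypothesis kC : (n + n <= k1 + normal_rank C1)%N.

(** The kernel of C1(l0) consists of the (l0 v, v) with v in that of Q(l0). The part X c of v lifts
    into the range of [X1], to which [x1] is orthogonal; testing against that lift gives (1 +
    |l0|^2) |X c|^2 = 0. *)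
Lemma right_vector : exists2 a : C, x1 = a *: col_mx (l0 *: x) x & (1 + nsq l0) * nsq a = 1.
Proof.
have [[oX sX kX] _] := bQ; have [[oX1 sX1 kX1] _] := bC.
have [Xx xX x_1] := orthonormal_blocks oX; have [X1x1 x1X1 x1_1] := orthonormal_blocks oX1.
have [v [Qv x1E]] : exists v, mxeval Q l0 *m v = 0 /\ x1 = col_mx (l0 *: v) v.
  have := span_last sX1; rewrite mxeval_companion -[x1]vsubmxK mul_block_col.
  move=> /eqP; rewrite col_mx_eq0 mulNmx mul1mx mul_scalar_mx [- _ + _]addrC subr_eq0.
  move=> /andP[/eqP h /eqP h']; exists (dsubmx x1); split; last by rewrite h' vsubmxK.
  rewrite mxeval_quadratic -h -h' -scalemxAr !mulmxDl scalerDr -!scalemxAl scalerA.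
  by rewrite expr2.
have [c [a vE]] := span_decomp sX Qv.
have [e Xe] : exists e, col_mx (l0 *: (X *m c)) (X *m c) = X1 *m e.
  have : ker_at Q l0 (X *m c) by case: kX => _ <-; exists c.
  move=> /ker_at_eval[V QV Ve].
  have [e _ eE] := eval_in_range kC kX1 (companion_right QV).
  exists e; rewrite eE /mxeval map_col_mx -Ve; congr col_mx.
  by apply/matrixP => i j; rewrite !mxE /horner_eval !hornerE.
have Xc0 : X *m c = 0.
  apply: vnsq_eq0P; have : ip (X1 *m e) x1 = 0.
    by rewrite /ip adjmxM -mulmxA X1x1 mulmx0 mxE.
  rewrite -Xe x1E ip_col_mx ipZl ipZr mulrA -nsqE -[X in _ + X]mul1r -mulrDl.
  have -> : ip (X *m c) v = (vnsq (X *m c))%:C%C.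
    rewrite vE ipDr ipZr ip_vnsq.
    have -> : ip (X *m c) x = 0 by rewrite /ip adjmxM -mulmxA Xx mulmx0 mxE.
    by rewrite mulr0 addr0.
  rewrite -[1](rmorph1 (real_complex R)) -rmorphD -rmorphM /= => /complexI /eqP.
  by rewrite mulf_eq0 gt_eqF ?ltr_wpDl ?nsq_ge0//= => /eqP.
exists a; first by rewrite x1E vE Xc0 add0r scale_col_mx !scalerA mulrC.
move: x1_1; rewrite x1E vnsq_col_mx vE Xc0 add0r !vnsqZ x_1 mulr1 => h; apply: etrans h.
by rewrite mulrDl mul1r addrC.
Qed.

(** Unlike on the right, the lower block is not a scalar multiple of the upper one, so orthogonality
    to [Y1] does not force [Y *m c] to vanish. It only bounds [b] from below, which suffices by
    [derivative_form_orth]. *)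
Lemma left_vector : exists b : C, exists c : 'cV_k,
   y1 = col_mx (Y *m c + b *: y) (B^t* *m (Y *m c + b *: y)) /\
   1 <= nsq b * (1 + vnsq (B^t* *m y)).
Proof.
have [_ [oY sY kY]] := bQ; have [_ [oY1 sY1 kY1]] := bC.
have [_ _ y_1] := orthonormal_blocks oY; have [_ y1Y1 y1_1] := orthonormal_blocks oY1.
have [w [Qw y1E]] : exists w, (mxeval Q l0)^t* *m w = 0 /\ y1 = col_mx w (B^t* *m w).
  have := span_last sY1; rewrite mxeval_companion tr_block_mx map_block_mx.
  rewrite -[y1]vsubmxK mul_block_col.
  have -> : ((- 1%:M)^t* : 'M[C]_n) = - 1%:M.
    by rewrite -scaleN1r adjmxZ adjmx1 rmorphN rmorph1.
  rewrite mulNmx mul1mx => /eqP; rewrite col_mx_eq0 subr_eq0 => /andP[/eqP h /eqP h'].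
  exists (usubmx y1); split; last by rewrite h vsubmxK.
  rewrite mxeval_quadratic -[RHS]h' -h mulmxA -mulmxDl -adjmxM -adjmxD.
  by rewrite mul_mx_scalar scalerDr scalerA -expr2 addrC.
have [c [b wE]] := span_decomp sY Qw.
have [e Ye] : exists e, col_mx (Y *m c) (B^t* *m (Y *m c)) = Y1 *m e.
  have : left_ker_at Q l0 (Y *m c) by case: kY => _ <-; exists c.
  move=> /left_ker_at_eval[W WQ We].
  have [e _ eE] := left_eval_in_range kC kY1 (companion_left WQ).
  exists e; rewrite eE /mxeval map_row_mx -/(mxeval W l0) We -/(mxeval _ l0).
  rewrite mxevalM We tr_row_mx map_col_mx adjmxK adjmxM adjmxK; congr (col_mx _ (_^t* *m _)).
  by apply/matrixP => i j; rewrite !mxE /horner_eval !hornerE.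
exists b, c; rewrite -wE; split => //.
have y1E' : y1 = Y1 *m e + b *: col_mx y (B^t* *m y).
  by rewrite -Ye scale_col_mx add_col_mx scalemxAr -mulmxDr -wE.
have E1 : ip y1 y1 = b * ip y1 (col_mx y (B^t* *m y)).
  by rewrite {2}y1E' ipDr ipZr {1}/ip mulmxA y1Y1 mul0mx mxE add0r.
have E2 : 1 = nsq b * nsq (ip y1 (col_mx y (B^t* *m y))).
  by rewrite -nsqM -E1 ip_vnsq y1_1 /nsq /= expr1n expr0n addr0.
rewrite [X in X <= _]E2 ler_wpM2l ?nsq_ge0//.
apply: le_trans (cauchy_schwarz _ _) _.
by rewrite y1_1 mul1r vnsq_col_mx y_1.
Qed.

(** A value of the left singular space extends to W with W Q = 0, so W Q' = - W' Q at [l0], and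
    Q(l0) kills [x]. *)
Lemma derivative_form_orth (c : 'cV_k) :
  (Y *m c)^t* *m (mxeval (mxderiv Q) l0 *m x) = 0.
Proof.
have [[_ sX _] [_ _ kY]] := bQ.
have : left_ker_at Q l0 (Y *m c) by case: kY => _ <-; exists c.
move=> /left_ker_at_eval[W WQ <-].
by rewrite mulmxA mxderiv_horner// mulNmx -mulmxA (span_last sX) mulmx0 oppr0.
Qed.

(* [x1] is proportional to [(l0 x, x)]. The component of [y1] along [y] is bounded
   below by testing [y1], which is orthogonal to [Y1], against [(y, B^* y)]. *)
Lemma companion_derivative_form :
  nsq ((y^t* *m mxeval (mxderiv Q) l0 *m x) 0 0) <=
  (1 + nsq l0) * (1 + vnsq (B^t* *m y)) * nsq ((y1^t* *m mxeval (mxderiv C1) l0 *m x1) 0 0).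
Proof.
have [a x1E a1] := right_vector; have [b [c [y1E b1]]] := left_vector.
have -> : (y1^t* *m mxeval (mxderiv C1) l0 *m x1) 0 0 =
    a * b^* * (y^t* *m mxeval (mxderiv Q) l0 *m x) 0 0.
  have -> : y1^t* *m mxeval (mxderiv C1) l0 *m x1 =
      a *: ((Y *m c + b *: y)^t* *m (mxeval (mxderiv Q) l0 *m x)).
    rewrite x1E -scalemxAr; congr (_ *: _).
    rewrite mxeval_deriv_companion -mulmxA mul_block_col !mul0mx mul1mx addr0 add0r.
    rewrite y1E tr_col_mx map_row_mx mul_row_col adjmxM adjmxK.
    rewrite -mulmxA -mulmxDr mxeval_deriv_quadratic; congr (_ *m _).
    rewrite -scalemxAr !mulmxDl -!scalemxAl addrA; congr (_ + _).
    by rewrite -scalerDl; congr (_ *: _); ring.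
  rewrite adjmxD adjmxZ mulmxDl derivative_form_orth add0r -scalemxAl scalerA mxE.
  by rewrite mulmxA.
rewrite !nsqM; have -> : nsq (b^*) = nsq b by case: (b) => u v; rewrite /nsq /= sqrrN.
set d := nsq ((y^t* *m _ *m x) 0 0); set q := 1 + vnsq _ in b1 *.
rewrite (_ : _ * q * _ = (1 + nsq l0) * nsq a * (nsq b * q) * d); last by ring.
by rewrite a1 mul1r ler_peMl// nsq_ge0.
Qed.

End KeyInequality.

(** * Comparison of the condition numbers *)

Section LeftVectorBounds.
Variable R : realType.
Local Notation C := R[i].
Local Open Scope sesquilinear_scope.
Variables (n : nat) (M D K : 'M[C]_n) (l0 : C) (y : 'cV[C]_n).
Hypothesis y1 : vnsq y = 1.
Local Notation B := (l0 *: M + D).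

Lemma nsq_conj (z : C) : nsq (z^*) = nsq z.
Proof. by case: z => u v; rewrite /nsq /= sqrrN. Qed.

(** Since Q = l0 B + K at [l0], the left eigenvector equation exchanges B for K. *)
Lemma left_bound_inv : (mxeval (quadratic_poly M D K) l0)^t* *m y = 0 ->
  spectral_norm K = 1 -> nsq l0 * vnsq (B^t* *m y) <= 1.
Proof.
move=> Qy K1; rewrite -nsq_conj -vnsqZ.
have -> : l0^* *: (B^t* *m y) = - (K^t* *m y).
  apply/eqP; rewrite -addr_eq0; apply/eqP; rewrite -[RHS]Qy mxeval_quadratic.
  rewrite scalemxAl -mulmxDl -adjmxZ -adjmxD; congr (((_ + _)^t*) *m _).
  by rewrite scalerDr scalerA -expr2.
rewrite -scaleN1r vnsqZ (_ : nsq (-1) = 1) ?mul1r; last first.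
  by rewrite /nsq /= sqrrN expr1n oppr0 expr0n addr0.
by apply: le_trans (vnsq_spectral_adj K y) _; rewrite K1 y1 expr1n mulr1.
Qed.

Lemma left_bound_sum : spectral_norm M = 1 -> spectral_norm D <= 1 ->
  vnsq (B^t* *m y) <= (cabs l0 + 1) ^+ 2.
Proof.
move=> M1 D1; rewrite adjmxD mulmxDl; apply: vnsqD_le => //.
- by rewrite cabsE sqrtr_ge0.
- rewrite adjmxZ -scalemxAl vnsqZ nsq_conj sqr_cabs ler_piMr ?nsq_ge0//.
  by apply: le_trans (vnsq_spectral_adj M y) _; rewrite M1 y1 expr1n mulr1.
- apply: le_trans (vnsq_spectral_adj D y) _; rewrite y1 mulr1 ler_pXn2r// nnegrE//.
  exact: spectral_norm_ge0.
Qed.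

End LeftVectorBounds.

Section Numerics.
Variable R : realType.

(* The two thresholds [tau] are in ratio [rho = 437 / 1000], which satisfies
   [rho - rho^2 / 4 > 3 / 8] and [8 / 3 * rho <= (108 / 100)^2]. *)
Lemma rho_bounds : 0 < 437 / 1000 :> R /\ 437 / 1000 <= 1 :> R.
Proof. by split; lra. Qed.

(** Multiplying by [a] eliminates [b]; the remaining polynomial inequality is nearly tight at a =
    1. *)
Lemma ratio_bound_ge1 (a b : R) : 1 <= a -> 0 <= b -> a * b <= 1 ->
  437 / 1000 * ((1 + a) ^+ 2 * (1 + b)) <= (108 / 100) ^+ 2 * (1 + a + a ^+ 2).
Proof.
move=> a1 b0 ab; have a0 : 0 < a by exact: lt_le_trans a1.
rewrite -(ler_pM2r a0).
have h : (1 + b) * a <= 1 + a by rewrite mulrDl mul1r addrC lerD2r mulrC.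
have h2 : (1 + a) ^+ 2 * ((1 + b) * a) <= (1 + a) ^+ 2 * (1 + a).
  by rewrite ler_wpM2l// sqr_ge0.
have h3 : 437 / 1000 * ((1 + a) ^+ 2 * (1 + a)) <= (108 / 100) ^+ 2 * (1 + a + a ^+ 2) * a.
  nra.
lra.
Qed.

Lemma ratio_bound_lt1 (l b : R) : 0 <= l -> l < 1 -> 0 <= b ->
  b <= (l + 1) ^+ 2 -> l ^+ 2 * b <= 1 ->
  437 / 1000 * ((1 + l ^+ 2) ^+ 2 * (1 + b)) <=
  (146 / 100) ^+ 2 * (1 + l ^+ 2 + (l ^+ 2) ^+ 2).
Proof.
move=> l0 l1 b0 bl ab.
have a0 : 0 <= l ^+ 2 by exact: sqr_ge0.
(* The bounds (l + 1)^2 and 1 / l^2 on [b] cross where l (l + 1) = 1, near 0.618. For smaller l the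
   first is used, with 149/40 just above 1 + (1.65)^2, 169/400 the square of 65/100, and 127/100
   bounding (1 + a)^2 / (1 + a + a^2). *)
have [s|s] := leP l (65 / 100).
  have b1 : 1 + b <= 149 / 40 by apply: le_trans (_ : 1 + (l + 1) ^+ 2 <= _); [lra|nra].
  have a1 : l ^+ 2 <= 169 / 400 by nra.
  move: (l ^+ 2) a0 a1 => a a0 a1.
  have h1 : (1 + a) ^+ 2 <= 127 / 100 * (1 + a + a ^+ 2) by nra.
  have h2 : (1 + a) ^+ 2 * (1 + b) <= 127 / 100 * (1 + a + a ^+ 2) * (149 / 40).
    by apply: ler_pM => //; [exact: sqr_ge0|lra].
  have : 0 <= 1 + a + a ^+ 2 by nra.
  lra.
have a1 : 169 / 400 <= l ^+ 2 by nra.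
have a2 : l ^+ 2 <= 1 by nra.
move: (l ^+ 2) ab a0 a1 a2 => a ab _ a1 a2.
have a0 : 0 < a by lra.
rewrite -(ler_pM2r a0).
have h : (1 + b) * a <= 1 + a by rewrite mulrDl mul1r addrC lerD2r mulrC.
have h2 : (1 + a) ^+ 2 * ((1 + b) * a) <= (1 + a) ^+ 2 * (1 + a).
  by rewrite ler_wpM2l// sqr_ge0.
have h3 : 437 / 1000 * ((1 + a) ^+ 2 * (1 + a)) <= (146 / 100) ^+ 2 * (1 + a + a ^+ 2) * a.
  nra.
lra.
Qed.

(** After division by the common first order factor it reads 3/8 < rho - rho^2 q; here q <= 1/4
    follows from k <= n, since 4 (n - 1) <= 3 n^2 + 1. *)
Lemma tail_gap (n k : nat) (t : R) : (0 < k)%N -> (k <= n)%N -> 1 <= t ->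
  k%:R / ((8 * n%:R ^+ 2) * t) <
  k%:R / ((3 * n%:R ^+ 2) * (t / (437 / 1000))) -
  k%:R * (k%:R - 1) / ((3 * n%:R ^+ 2) * (3 * n%:R ^+ 2 + 1) * (t / (437 / 1000)) ^+ 2) :> R.
Proof.
move=> k0 kn t1; have t0 : 0 < t by exact: lt_le_trans t1.
have : 1 <= k%:R :> R by rewrite ler1n.
have : k%:R <= n%:R :> R by rewrite ler_nat.
move: (k%:R : R) (n%:R : R) => x y xy x1.
have y1 : 1 <= y by exact: le_trans xy.
have y0 : 0 < y by lra.
have d0 : 0 < 3 * y ^+ 2 + 1 by rewrite ltr_wpDl// mulr_ge0// sqr_ge0.
have p0 : 0 < x / (3 * y ^+ 2 * t) by rewrite divr_gt0 ?mulr_gt0 ?exprn_gt0//; lra.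
have -> : x / (8 * y ^+ 2 * t) = x / (3 * y ^+ 2 * t) * (3 / 8).
  by field; rewrite !gt_eqF.
have -> : x / (3 * y ^+ 2 * (t / (437 / 1000))) -
    x * (x - 1) / (3 * y ^+ 2 * (3 * y ^+ 2 + 1) * (t / (437 / 1000)) ^+ 2) =
    x / (3 * y ^+ 2 * t) * (437 / 1000 - (437 / 1000) ^+ 2 * ((x - 1) / ((3 * y ^+ 2 + 1) * t))).
  by field; rewrite !gt_eqF.
rewrite ltr_pM2l//.
have : (x - 1) / ((3 * y ^+ 2 + 1) * t) <= 1 / 4.
  rewrite ler_pdivrMr ?mulr_gt0//; nra.
lra.
Qed.
End Numerics.

Section CompanionRatio.
Variable R : realType.
Local Notation C := R[i].
Local Open Scope sesquilinear_scope.
Variables (n k k1 : nat) (M D K : 'M[C]_n) (l0 : C) (delta : R).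
Local Notation Q := (quadratic_poly M D K).
Local Notation C1 := (companion1 M D K).
Local Notation B := (l0 *: M + D).
Variables (X : 'M[C]_(n, k)) (x : 'cV[C]_n) (Y : 'M[C]_(n, k)) (y : 'cV[C]_n).
Variables (X1 : 'M[C]_(n + n, k1)) (x1 : 'cV[C]_(n + n)).
Variables (Y1 : 'M[C]_(n + n, k1)) (y1 : 'cV[C]_(n + n)).
Hypotheses (bQ : adapted_bases Q l0 X x Y y) (bC : adapted_bases C1 l0 X1 x1 Y1 y1).
Hypotheses (kC : (n + n <= k1 + normal_rank C1)%N) (k1k : k1 = k).
Hypotheses (k0 : (0 < k)%N) (kn : (k <= n)%N).
Hypotheses (delta0 : 0 < delta) (delta_le : delta <= k%:R / (8 * n%:R ^+ 2)).

Lemma weak_condition_ratio_le (c : R) : 0 <= c ->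
  437 / 1000 * ((1 + nsq l0) ^+ 2 * (1 + vnsq (B^t* *m y))) <=
    c ^+ 2 * (1 + nsq l0 + nsq l0 ^+ 2) ->
  weak_condition 1 C1 l0 X1 x1 Y1 y1 delta / weak_condition 2 Q l0 X x Y y delta <= c.
Proof.
move=> c0 H.
have n0 : (0 < n)%N by exact: leq_trans kn.
have [[oX _ _] [oY _ _]] := bQ; have [[oX1 _ _] [oY1 _ _]] := bC.
have x0 : 0 < n%:R :> R by rewrite ltr0n.
have kx0 : 0 < k%:R :> R by rewrite ltr0n.
have x1' : 1 <= n%:R :> R by rewrite ler1n.
have n8 : 0 < 8 * n%:R ^+ 2 :> R by rewrite mulr_gt0// exprn_gt0.
have delta1 : delta < 1.
  apply: le_lt_trans delta_le _; rewrite ltr_pdivrMr// mul1r.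
  have : k%:R <= n%:R :> R by rewrite ler_nat.
  nra.
(* Chosen so that the first order tail of C1, of dimension 8 n^2, equals [delta] at [t]; the bound
   on [delta] is [1 <= t]. *)
pose t : R := k%:R / (8 * n%:R ^+ 2 * delta).
have t0 : 0 < t by rewrite divr_gt0// mulr_gt0.
have t1 : 1 <= t.
  by rewrite /t invfM mulrA ler_pdivlMr// mul1r.
have dt : delta = k%:R / (8 * n%:R ^+ 2 * t).
  by rewrite /t; field; rewrite !gt_eqF.
(* In the zero case the denominator of the ratio is 0, and so is the quotient. *)
have [d0|d0] := eqVneq ((y^t* *m mxeval (mxderiv Q) l0 *m x) 0 0) 0.
  by rewrite [weak_condition 2 _ _ _ _ _ _ _]weak_condition_eq0 ?invr0 ?mulr0.
have form := companion_derivative_form bQ bC kC.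
set d := (y^t* *m _ *m x) 0 0 in d0 form *.
set d1 := (y1^t* *m _ *m x1) 0 0 in form.
have nd0 : 0 < nsq d by exact: nsq_gt0.
have d1N : d1 != 0.
  apply: contraTN form => /eqP ->; rewrite {3}/nsq expr0n addr0 mulr0.
  by rewrite -ltNge.
have nd1 := nsq_gt0 d1N.
have up : weak_condition 1 C1 l0 X1 x1 Y1 y1 delta <= Num.sqrt (t * powsum 1 l0 / nsq d1).
  apply: weak_condition_le => //; first by rewrite addn_gt0 n0.
    by rewrite k1k.
  rewrite {1}k1k dt !natrM natrD le_eqVlt; apply/orP; left; apply/eqP.
  by field; rewrite !gt_eqF ?addr_gt0.
(* At this larger threshold the tail of Q still exceeds [delta], by [tail_gap]. *)
pose t2 := t / (437 / 1000).
have [r0 r1] := rho_bounds R.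
have t21 : 1 <= t2 by rewrite ler_pdivlMr// mul1r (le_trans r1).
have [->|lo] : weak_condition 2 Q l0 X x Y y delta = 0 \/
    Num.sqrt (t2 * powsum 2 l0 / nsq d) <= weak_condition 2 Q l0 X x Y y delta.
  apply: weak_condition_ge => //.
  rewrite [X in X < _]dt -[(3 * (n * n)).+1]addn1 natrD !natrM.
  exact: tail_gap.
  by rewrite invr0 mulr0.
have S2 := powsum_gt0 2 l0.
have kQ0 : 0 < weak_condition 2 Q l0 X x Y y delta.
  by apply: lt_le_trans lo; rewrite sqrtr_gt0 divr_gt0// mulr_gt0// (lt_le_trans _ t21).
rewrite ler_pdivrMr//; apply: le_trans up _; apply: le_trans (ler_wpM2l c0 lo).
rewrite -[c]ger0_norm// -sqrtr_sqr -sqrtrM ?sqr_ge0// ler_wsqrtr//.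
have -> : powsum 1 l0 = 1 + nsq l0 by rewrite /powsum !big_ord_recl big_ord0 expr0 expr1 addr0.
have -> : powsum 2 l0 = 1 + nsq l0 + nsq l0 ^+ 2.
  by rewrite /powsum !big_ord_recl big_ord0 expr0 expr1 addr0 addrA.
move: form H (nsq_ge0 l0) (vnsq_ge0 (B^t* *m y)) r0; rewrite /t2.
move: (nsq l0) (vnsq _) (nsq d) (nsq d1) (437 / 1000) nd0 nd1 => a b u v rho u0 v0 form H a0 b0 r0.
rewrite ler_pdivrMr//.
have -> : c ^+ 2 * (t / rho * (1 + a + a ^+ 2) / u) * v =
  t * (c ^+ 2 * (1 + a + a ^+ 2)) * v / (rho * u) by field; rewrite !gt_eqF.
rewrite ler_pdivlMr ?mulr_gt0//.
have h1 : t * (1 + a) * (rho * u) <= t * (1 + a) * (rho * ((1 + a) * (1 + b) * v)).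
  apply: ler_wpM2l; first by rewrite mulr_ge0 ?(ltW t0) ?addr_ge0.
  by apply: ler_wpM2l form; exact: ltW.
apply: le_trans h1 _.
rewrite (_ : t * _ * _ = t * (rho * ((1 + a) ^+ 2 * (1 + b))) * v); last by ring.
by apply: ler_wpM2r; [exact: ltW|apply: ler_wpM2l => //; exact: ltW].
Qed.

End CompanionRatio.

Lemma natr_div_ge0 (R : realFieldType) (m n : nat) : 0 <= m%:R / n%:R :> R.
Proof. by rewrite divr_ge0 ?ler0n. Qed.

Theorem theorem3p4 (R : realType) :
  exists c1 c2 : R,
  [/\ `|c1 - 146 / 100| <= 5 / 1000,
      `|c2 - 108 / 100| <= 5 / 1000 &
  forall (n r : nat) (M C K : 'M[R[i]]_n) (l0 : R[i]) (delta : R)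
    (Q := quadratic_poly M C K) (C1 := companion1 M C K)
    (X : 'M[R[i]]_(n, n - normal_rank Q)) (x : 'cV[R[i]]_n)
    (Y : 'M[R[i]]_(n, n - normal_rank Q)) (y : 'cV[R[i]]_n)
    (X1 : 'M[R[i]]_(n + n, n + n - normal_rank C1)) (x1 : 'cV[R[i]]_(n + n))
    (Y1 : 'M[R[i]]_(n + n, n + n - normal_rank C1)) (y1 : 'cV[R[i]]_(n + n)),
    normal_rank Q = r -> (r < n)%N ->
    spectral_norm M = 1 -> spectral_norm K = 1 ->
    simple_eigenvalue Q l0 ->
    adapted_bases Q l0 X x Y y ->
    adapted_bases C1 l0 X1 x1 Y1 y1 ->
    0 < delta -> delta <= (n - r)%:R / (8 * n%:R ^+ 2) ->
    let ratio := weak_condition 1 C1 l0 X1 x1 Y1 y1 delta /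
                 weak_condition 2 Q l0 X x Y y delta in
    (cabs l0 < 1 -> spectral_norm C <= 1 -> ratio <= c1) /\
    (1 <= cabs l0 -> ratio <= c2)].

Proof.
exists (146 / 100), (108 / 100); split; [by rewrite subrr normr0; exact: natr_div_ge0..|].
move=> n r M C K l0 delta Q C1 X x Y y X1 x1 Y1 y1 rQ rn M1 K1 _ bQ bC d0 dle ratio.
have nC : normal_rank C1 = (n + normal_rank Q)%N by exact: normal_rank_companion.
have Qn : (normal_rank Q <= n)%N by rewrite rQ ltnW.
have kC : (n + n <= n + n - normal_rank C1 + normal_rank C1)%N.
  by rewrite subnK// nC leq_add2l.
have k1k : (n + n - normal_rank C1 = n - normal_rank Q)%N by rewrite nC subnDl.
have k0 : (0 < n - normal_rank Q)%N by rewrite subn_gt0 rQ.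
have {}dle : delta <= (n - normal_rank Q)%:R / (8 * n%:R ^+ 2) by rewrite rQ.
have le c := weak_condition_ratio_le (c := c) bQ bC kC k1k k0 (leq_subr _ _) d0 dle.
have [_ [oY sY _]] := bQ; have [_ _ y_1] := orthonormal_blocks oY.
have inv := left_bound_inv y_1 (span_last sY) K1.
have b0 := vnsq_ge0 (((l0 *: M + C)^t*)%sesqui *m y).
have l02 : nsq l0 = cabs l0 ^+ 2 by rewrite sqr_cabs.
split=> [l1 C1'|l1]; apply: le; first exact: natr_div_ge0.
- rewrite l02 in inv *; apply: ratio_bound_lt1 => //; first by rewrite cabsE sqrtr_ge0.
  exact: left_bound_sum.
- exact: natr_div_ge0.
- by apply: ratio_bound_ge1 => //; rewrite l02 exprn_ege1.
Qed.
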